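(* Fix $d\in\mathbb N$, let $p\in[1,\infty]$, and let $X$ be a finite subset of $\mathbb R^d_p$ ($\mathbb R^d$ with the $\ell_p$-metric). (i) If $d=1$ or $p\in\{1,\infty\}$, then $\mathcal{NR}(X)$ is a simplicial model of the subdivision-Rips bifiltration $\mathcal{SR}(X)$ whose $k$-skeleton has size $O\left(|X|^{\alpha(k+1)+2}\right)$, where $$\alpha=\alpha(d,p)=\begin{cases} d &\text{for } p=\infty \text{ or } d=1\text{ or }(d,p)=(2,1),\\ d\,2^{d^2-1}&\text{for }p=1\text{ and }d>2.\end{cases}$$ (ii) For any $\epsilon\in(0,1)$, there exists a $(1+\epsilon)$-approximation to $\mathcal{SR}(X)$ (a functor $\mathbb N^{\mathrm{op}}\times[0,\infty)\to\mathbf{Simp}$) whose $k$-skeleton has size $O\left(|X|^{\beta(k+1)+2}\right)$, where $\beta=c_d\,\epsilon^{-(d^2-1)/2}$ for some constant $c_d$ depending on $d$.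
   Context: Conventions: $\mathbb N=\{1,2,\dots\}$. $\mathbf{Simp}$ is the category of finite simplicial complexes and simplicial maps, regarded as a subcategory of topological spaces $\mathbf{Top}$ via geometric realization. Posets are regarded as categories; products carry the product order. Rips filtration: For a finite metric space $X$ and $r\ge0$, $\mathcal R(X)_r$ is the simplicial complex on vertex set $X$ whose simplices are the nonempty subsets all of whose pairwise distances are at most $2r$. This gives a filtration $\mathcal R(X)\colon[0,\infty)\to\mathbf{Simp}$. Subdivision-Rips: For a simplicial complex $W$ and $k\in\mathbb N$, $\mathcal S(W)_k$ is the subcomplex of the barycentric subdivision of $W$ (whose simplices are the flags $\sigma_1\subset\cdots\subset\sigma_m$ of simplices of $W$) consisting of the flags whose minimum element has dimension at least $k-1$. $\mathcal{SR}(X)\colon\mathbb N^{\mathrm{op}}\times[0,\infty)\to\mathbf{Simp}$ is $\mathcal{SR}(X)_{k,r}=\mathcal S(\mathcal R(X)_r)_k$, with inclusions as structure maps. The construction $\mathcal{NR}(X)\colon\mathbb N^{\mathrm{op}}\times[0,\infty)\to\mathbf{Simp}$: Choose a total (well-)ordering of $X$ and order simplices on $X$ lexicographically. Let $\Sigma_r$ be the set of maximal simplices of $\mathcal R(X)_r$ (those not properly contained in another simplex). For $r\le r'$, let $\Sigma_r\to\Sigma_{r'}$ be the map sending $\sigma\in\Sigma_r$ to the lexicographically minimum simplex in $\Sigma_{r'}$ containing $\sigma$. The sets $\Sigma_r$ together with these maps form a cover of $\mathcal R(X)$ (each $\mathcal R(X)_r$ being covered by its maximal simplices), which induces via barycentric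 subdivision the cover $\mathcal U$ of $\mathcal{SR}(X)$ with $\mathcal U_{k,r}=\{\mathcal S(\bar\sigma)_k\mid\sigma\in\Sigma_r\}$, where $\bar\sigma$ is the complex of $\sigma$ and all its faces. $\mathcal{NR}(X)$ is the nerve of $\mathcal U$: the simplices of $\mathcal{NR}(X)_{k,r}$ are the nonempty sets $S\subset\Sigma_r$ with $\bigcap_{\sigma\in S}\mathcal S(\bar\sigma)_k\ne\emptyset$, and the structure map $\mathcal{NR}(X)_{k,r}\to\mathcal{NR}(X)_{k',r'}$ is given on vertices by $\Sigma_r\to\Sigma_{r'}$. Models and approximation: Two functors into $\mathbf{Top}$ are weakly equivalent ($\simeq$) if they are connected by a finite zigzag of natural transformations all of whose components are homotopy equivalences. A simplicial model of $\mathcal G\colon P\to\mathbf{Top}$ is a functor $P\to\mathbf{Simp}$ weakly equivalent to $\mathcal G$. For $\epsilon\ge0$ let $I^{(1,1+\epsilon)}$ be the thin category (at most one morphism between any two objects) with object set $\mathbb N^{\mathrm{op}}\times[0,\infty)\times\{0,1\}$ and a morphism $(k,r,i)\to(l,s,j)$ if and only if either $(k,r(1+\epsilon))\le(l,s)$ in $\mathbb N^{\mathrm{op}}\times[0,\infty)$, or $i=j$ and $(k,r)\le(l,s)$. Let $E^i(k,r)=(k,r,i)$ for $i\in\{0,1\}$. Functors $\mathcal F,\mathcal F'\colon\mathbb N^{\mathrm{op}}\times[0,\infty)\to\mathbf C$ are $(1+\epsilon)$-interleaved if there is a functor $\mathcal Z\colon I^{(1,1+\epsilon)}\to\mathbf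 C$ with $\mathcal Z\circ E^0=\mathcal F$ and $\mathcal Z\circ E^1=\mathcal F'$. $\mathcal G$ is a $(1+\epsilon)$-approximation to $\mathcal F$ if there are $(1+\epsilon)$-interleaved functors $\mathcal F',\mathcal G'$ into $\mathbf{Top}$ with $\mathcal F\simeq\mathcal F'$ and $\mathcal G\simeq\mathcal G'$. Size: Fix a field $\mathbb K$. A persistence module over a poset $P$ is a functor $M\colon P\to\mathbf{Vec}$ to $\mathbb K$-vector spaces. For $q\in P$ let $\mathbb K^{\langle q\rangle}$ be the module equal to $\mathbb K$ at all $x\ge q$ and $0$ elsewhere, with identity structure maps between the copies of $\mathbb K$; free modules are those isomorphic to direct sums of such modules. $M$ is finitely presented if it is isomorphic to the cokernel of a morphism between finitely generated free modules. If $P$ is a finite product of totally ordered sets, a finitely presented $M$ has a minimal free resolution $F_\bullet$ (one isomorphic to a direct summand of every free resolution), unique up to isomorphism, with each $F_i$ finitely generated; $\beta_i(M)$ is the cardinality of a minimal generating set of $F_i$. For $\mathcal G\colon P\to\mathbf{Simp}$, $C_j\mathcal G$ is the module $q\mapsto C_j(\mathcal G_q;\mathbb K)$ of simplicial $j$-chains; $\mathcal G$ is finitely presented if every $C_j\mathcal G$ is, and its size is then $\beta_1(C_0\mathcal G)+\sum_{j\ge0}\beta_0(C_j\mathcal G)$. The $k$-skeleton of $\mathcal G$ ($k\ge0$) is the functor $q\mapsto k$-skeleton of $\mathcal G_q$.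
   Formalization: The lexicographically minimum rule for Σ_r→Σ_{r'} need not respect composition, so NR(X) may fail to be a functor; here the rule is applied at the successive half-distances in (r,r'] and composed, which agrees with the original whenever that is functorial. *)

(* Defs.v *)
From HB Require Import structures.
From mathcomp Require Import all_boot all_order all_algebra perm finmap.
From mathcomp Require Import boolp classical_sets functions cardinality.
From mathcomp Require Import set_interval reals ereal topology normedtype exp.
From mathcomp Require Import finset.
From Stdlib Require Import Relation_Operators.

Set Implicit Arguments.
Unset Strict Implicit.
Unset Printing Implicit Defensive.

Import Order.TTheory GRing.Theory Num.Theory.
Import numFieldNormedType.Exports.

Local Open Scope ring_scope.

Record category := Category {
  obj :> Type;
  mor : obj -> obj -> Type;
  idm : forall x, mor x x;
  compm : forall x y z, mor y z -> mor x y -> mor x z;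
  compm_idl : forall x y (f : mor x y), compm (idm y) f = f;
  compm_idr : forall x y (f : mor x y), compm f (idm x) = f;
  compm_assoc : forall x y z t (h : mor z t) (g : mor y z) (f : mor x y),
    compm h (compm g f) = compm (compm h g) f
}.
Arguments idm {c} x.
Arguments compm {c x y z} g f.

Record functor (C D : category) := Functor {
  fobj :> C -> D;
  fmor : forall x y : C, mor x y -> mor (fobj x) (fobj y);
  fmor_id : forall x : C, fmor (idm x) = idm (fobj x);
  fmor_comp : forall (x y z : C) (g : mor y z) (f : mor x y),
    fmor (compm g f) = compm (fmor g) (fmor f)
}.
Arguments fmor {C D} F {x y} h : rename.

Section CompFunctor.
Variables (C D E : category) (G : functor D E) (F : functor C D).

Let compF_id (x : C) : fmor G (fmor F (idm x)) = idm (G (F x)).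
Proof. by rewrite !fmor_id. Qed.

Let compF_comp (x y z : C) (g : mor y z) (f : mor x y) :
  fmor G (fmor F (compm g f)) = compm (fmor G (fmor F g)) (fmor G (fmor F f)).
Proof. by rewrite !fmor_comp. Qed.

Definition compF : functor C E := Functor compF_id compF_comp.
End CompFunctor.

Record nat_trans (C D : category) (F G : functor C D) := NatTrans {
  ncomp :> forall x : C, mor (F x) (G x);
  natural : forall (x y : C) (h : mor x y),
    compm (fmor G h) (ncomp x) = compm (ncomp y) (fmor F h)
}.

Definition isomorphic (C D : category) (F G : functor C D) : Prop :=
  exists (a : nat_trans F G) (b : nat_trans G F),
    forall x, compm (b x) (a x) = idm (F x) /\ compm (a x) (b x) = idm (G x).

Record thin := Thin {
  tob :> Type;
  tle : tob -> tob -> Prop;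
  tle_refl : forall x, tle x x;
  tle_trans : forall x y z, tle y z -> tle x y -> tle x z
}.

Section ThinCategory.
Variable P : thin.

Definition thin_category : category :=
  @Category P (@tle P) (@tle_refl P) (@tle_trans P)
    (fun _ _ _ => Prop_irrelevance _ _) (fun _ _ _ => Prop_irrelevance _ _)
    (fun _ _ _ _ _ _ _ => Prop_irrelevance _ _).
End ThinCategory.
Coercion thin_category : thin >-> category.

Definition Top : category.
Proof.
refine (@Category topologicalType (fun X Y => continuousType X Y)
  (fun X => (@idfun X : continuousType X X))
  (fun X Y Z g f => (g \o f : continuousType X Z)) _ _ _).
- by move=> X Y f; apply/continuousEP.
- by move=> X Y f; apply/continuousEP.
- by move=> X Y Z T h g f; apply/continuousEP.
Defined.

Section Homotopy.
Variable R : realType.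

Definition homotopic (X Y : topologicalType) (f g : X -> Y) : Prop :=
  exists H : X * R -> Y,
    [/\ {within [set: X] `*` `[0, 1], continuous H}%classic,
        forall x, H (x, 0) = f x & forall x, H (x, 1) = g x].

Definition homotopy_equivalence (X Y : topologicalType)
    (f : continuousType X Y) : Prop :=
  exists g : continuousType Y X,
    homotopic (g \o f) idfun /\ homotopic (f \o g) idfun.

Definition objectwise_equivalence (C : category) (F G : functor C Top) : Prop :=
  exists eta : nat_trans F G, forall x, homotopy_equivalence (eta x).

Definition weakly_equivalent (C : category) (F G : functor C Top) : Prop :=
  clos_refl_sym_trans _ (@objectwise_equivalence C) F G.
End Homotopy.

Record simplicial_complex := SimplicialComplex {
  vtx : finType;
  faces : {set {set vtx}};
  face_neq0 : set0 \notin faces;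
  face_sub : forall s t : {set vtx},
    s \in faces -> t \subset s -> t != set0 -> t \in faces;
  face1 : forall v, [set v] \in faces
}.

Record simp_map (L M : simplicial_complex) := SimpMap {
  vmap :> vtx L -> vtx M;
  vmapP : forall s, s \in faces L -> (vmap @: s) \in faces M
}.

Lemma simp_map_ext (L M : simplicial_complex) (f g : simp_map L M) :
  f =1 g -> f = g.
Proof.
case: f g => [f fP] [g gP] /= /funext fg.
by case: _ / fg gP => gP; congr SimpMap; exact: Prop_irrelevance.
Qed.

Lemma simp_idP (L : simplicial_complex) s :
  s \in faces L -> (@idfun (vtx L) @: s) \in faces L.
Proof. by rewrite imset_id. Qed.

Lemma simp_compP (L M N : simplicial_complex) (g : simp_map M N)
    (f : simp_map L M) s :
  s \in faces L -> ((g \o f) @: s) \in faces N.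
Proof. by move=> sL; rewrite imset_comp; do 2!apply: vmapP. Qed.

Definition Simp : category.
Proof.
refine (@Category simplicial_complex simp_map
  (fun L => SimpMap (@simp_idP L))
  (fun L M N g f => SimpMap (simp_compP g f)) _ _ _).
- by move=> L M f; apply: simp_map_ext.
- by move=> L M f; apply: simp_map_ext.
- by move=> L M N O h g f; apply: simp_map_ext.
Defined.

Section Realization.
Variable R : realType.

(* barycentric coordinates; as there are finitely many vertices, the topology
   induced by pointwise convergence is the usual one *)
Definition realization_set (L : simplicial_complex) :
    set {ptws vtx L -> R} :=
  [set t | [/\ forall v, 0 <= t v, \sum_v t v = 1 &
               [set v | t v != 0]%SET \in faces L]]%classic.

Arguments realization_set L t : clear implicits.

Definition realization (L : simplicial_complex) : topologicalType :=
  classical_sets.set_type (realization_set L).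

Definition push (L M : simplicial_complex) (f : vtx L -> vtx M)
    (t : vtx L -> R) : {ptws vtx M -> R} :=
  fun w => \sum_(v | f v == w) t v.

Lemma push_realization (L M : simplicial_complex) (f : simp_map L M) t :
  realization_set L t -> realization_set M (push f t).
Proof.
move=> [t0 t1 tf]; split.
- by move=> w; apply: sumr_ge0 => v _.
- rewrite -t1 [RHS](partition_big f xpredT) //=.
- suff -> : [set w | push f t w != 0] = (f @: [set v | t v != 0]).
    exact: vmapP.
  apply/setP => w; rewrite !inE; apply/idP/imsetP => [|[v]].
    rewrite /push => sn0; apply: contrapT => nw; case/negP: sn0; apply/eqP.
    apply: big1 => v /eqP fv; apply/eqP; apply/negPn/negP => tv.
    by apply: nw; exists v => //; rewrite inE.
  rewrite inE => tv ->; rewrite /push psumr_neq0 //=.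
  by apply/hasP; exists v; rewrite ?mem_index_enum // eqxx /= lt0r tv t0.
Qed.

Definition realization_map (L M : simplicial_complex) (f : simp_map L M)
    (t : realization L) : realization M :=
  exist _ (push f (val t)) (mem_set (push_realization f (set_mem (valP t)))).

Lemma continuous_ptws (T : topologicalType) (V : finType)
    (f : T -> {ptws V -> R}) :
  (forall v, continuous (fun x => f x v)) -> continuous f.
Proof.
move=> cf x; have Fx : Filter (nbhs x) by exact: nbhs_filter.
apply/cvg_sup => v; move: x {Fx}.
apply/(@continuousP _ (initial_topology (@^~ v))) => A [B oB <-].
by have /continuousP/(_ _ oB) := cf v.
Qed.

Lemma realization_map_continuous (L M : simplicial_complex)
    (f : simp_map L M) : continuous (@realization_map L M f).
Proof.
apply: continuous_comp_initial; apply: continuous_ptws => w /=.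
apply: continuous_big => [|v _]; first exact: add_continuous.
move=> u; apply: (@continuous_comp _ _ _ set_val
  (fun g : {ptws vtx L -> R} => g v)); first exact: initial_continuous.
exact: (@proj_continuous _ (fun _ : vtx L => R) v).
Qed.

Definition realization_fun : functor Simp Top.
Proof.
refine (@Functor Simp Top realization
  (fun L M f => (mkcts (@realization_map_continuous L M f)
                 : continuousType (realization L) (realization M))) _ _).
- move=> L; apply/continuousEP => t; apply: val_inj; apply/funext => w /=.
  by rewrite /push (big_pred1 w).
- move=> L M N g f; apply/continuousEP => t; apply: val_inj.
  apply/funext => w /=; rewrite /push /=.
  rewrite (partition_big f (fun u => g u == w)) //=.
  apply: eq_bigr => u gu; apply: eq_bigl => v.
  by have [->|_] := eqVneq (f v) u; rewrite ?gu ?andbF.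
Defined.
End Realization.

Section Skeleton.
Variable k : nat.

Section SkeletonObj.
Variable L : simplicial_complex.

Definition skeleton_faces : {set {set vtx L}} :=
  [set s in faces L | (#|s| <= k.+1)%N].

Let sk_neq0 : set0 \notin skeleton_faces.
Proof. by rewrite inE (negbTE (face_neq0 L)). Qed.

Let sk_sub (s t : {set vtx L}) : s \in skeleton_faces -> t \subset s ->
  t != set0 -> t \in skeleton_faces.
Proof.
rewrite !inE => /andP[sL sk] ts t0; rewrite (face_sub sL ts t0) /=.
exact: leq_trans (subset_leq_card ts) sk.
Qed.

Let sk1 v : [set v] \in skeleton_faces.
Proof. by rewrite inE face1 cards1. Qed.

Definition skeleton : simplicial_complex := SimplicialComplex sk_neq0 sk_sub sk1.
End SkeletonObj.

Lemma skeleton_mapP (L M : simplicial_complex) (f : simp_map L M) s :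
  s \in faces (skeleton L) -> f @: s \in faces (skeleton M).
Proof.
rewrite !inE => /andP[sL sk]; rewrite vmapP //=.
exact: leq_trans (leq_imset_card _ _) sk.
Qed.

Definition skeleton_fun : functor Simp Simp.
Proof.
refine (@Functor Simp Simp skeleton
  (fun L M f => @SimpMap (skeleton L) (skeleton M) f (@skeleton_mapP L M f)) _ _).
- by move=> L; apply: simp_map_ext.
- by move=> L M N g f; apply: simp_map_ext.
Defined.
End Skeleton.

(* a complex with vertices in [T]; not all elements of [T] need be vertices *)
Definition complex_in (T : finType) (A : {set {set T}}) : Prop :=
  set0 \notin A /\
  forall s t : {set T}, s \in A -> t \subset s -> t != set0 -> t \in A.

Section OfSystem.
Variables (T : finType) (A : {set {set T}}) (cA : complex_in A).

Definition system_vtx : finType := {v : T | [set v] \in A}.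

Definition system_faces : {set {set system_vtx}} := 
  [set s : {set system_vtx} | val @: s \in A].

Let sys_neq0 : set0 \notin system_faces.
Proof. by rewrite inE imset0 (proj1 cA). Qed.

Let sys_sub (s t : {set system_vtx}) : s \in system_faces -> t \subset s ->
  t != set0 -> t \in system_faces.
Proof.
rewrite !inE => sA ts t0; apply: (proj2 cA _ _ sA); first exact: imsetS.
by rewrite imset_eq0.
Qed.

Let sys1 v : [set v] \in system_faces.
Proof. by rewrite inE imset_set1; exact: (valP v). Qed.

Definition complex_of : simplicial_complex :=
  SimplicialComplex sys_neq0 sys_sub sys1.
End OfSystem.

(* a diagram of set systems on a fixed set [T]; the laws on [f] are only
   required on the actual vertices *)
Section SystemFunctor.
Variables (P : thin) (T : finType) (A : P -> {set {set T}}).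
Variable f : P -> P -> T -> T.
Hypothesis cA : forall p, complex_in (A p).
Hypothesis fA : forall p q s, tle p q -> s \in A p -> f p q @: s \in A q.
Hypothesis f_id : forall p v, [set v] \in A p -> f p p v = v.
Hypothesis f_comp : forall p q r v, tle p q -> tle q r -> [set v] \in A p ->
  f p r v = f q r (f p q v).

Let sysf_proof p q (h : tle p q) (v : system_vtx (A p)) :
  [set f p q (val v)] \in A q.
Proof. by rewrite -imset_set1; apply: fA => //; exact: (valP v). Qed.

Let sysf p q (h : tle p q) (v : vtx (complex_of (cA p))) :
  vtx (complex_of (cA q)) := exist _ (f p q (val v)) (sysf_proof h v).

Let sysfP p q (h : tle p q) s : s \in faces (complex_of (cA p)) ->
  sysf h @: s \in faces (complex_of (cA q)).
Proof.
rewrite !inE => /(fA h); rewrite -!imset_comp.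
by congr (_ \in _); apply: eq_imset.
Qed.

Definition system_functor : functor P Simp.
Proof.
refine (@Functor P Simp (fun p => complex_of (cA p))
  (fun p q h => SimpMap (sysfP h)) _ _).
- by move=> p; apply: simp_map_ext => v; apply: val_inj; exact: f_id (valP v).
- move=> p q r h1 h2; apply: simp_map_ext => v; apply: val_inj => /=.
  exact: f_comp (valP v).
Defined.
End SystemFunctor.

Section Index.
Variable R : realType.

(* N^op x [0, oo), with N = {1, 2, ...} *)
Definition bindex : Type := {k : nat | (0 < k)%N} * {r : R | 0 <= r}.

Definition bindex_le (a b : bindex) : Prop :=
  (val b.1 <= val a.1)%N /\ val a.2 <= val b.2.

Lemma bindex_le_refl a : bindex_le a a.
Proof. by split. Qed.

Lemma bindex_le_trans a b c : bindex_le b c -> bindex_le a b -> bindex_le a c.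
Proof.
move=> [bc1 bc2] [ab1 ab2].
by split; [exact: leq_trans bc1 ab1|exact: le_trans ab2 bc2].
Qed.

Definition Nop_R : thin := Thin bindex_le_refl bindex_le_trans.

Section Interleaving.
Variables (eps : R) (eps_ge0 : 0 <= eps).

(* (k, r (1 + eps)) <= (l, s) in N^op x [0, oo) *)
Definition shift_le (a b : bindex) : Prop :=
  (val b.1 <= val a.1)%N /\ val a.2 * (1 + eps) <= val b.2.

Definition inter_le (a b : bindex * bool) : Prop :=
  shift_le a.1 b.1 \/ a.2 = b.2 /\ bindex_le a.1 b.1.

Lemma inter_le_refl a : inter_le a a.
Proof. by right; split => //; exact: bindex_le_refl. Qed.

Lemma shift_leW a b : shift_le a b -> bindex_le a b.
Proof.
move=> [ab1 ab2]; split => //; apply: le_trans ab2.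
by rewrite mulrDr mulr1 lerDl mulr_ge0 //; exact: (valP a.2).
Qed.

Lemma inter_le_trans a b c : inter_le b c -> inter_le a b -> inter_le a c.
Proof.
case=> [bc|[bc2 bc]] [ab|[ab2 ab]].
- left; have [bc1 bc2] := shift_leW bc; have [ab1 ab2] := ab.
  by split; [exact: leq_trans bc1 ab1|exact: le_trans ab2 bc2].
- left; have [bc1 bc3] := bc; have [ab1 ab3] := ab.
  split; first exact: leq_trans bc1 ab1.
  by apply: le_trans bc3; rewrite ler_wpM2r // addr_ge0.
- left; have [bc1 bc3] := bc; have [ab1 ab3] := ab.
  by split; [exact: leq_trans bc1 ab1|exact: le_trans ab3 bc3].
- by right; split; [rewrite ab2|exact: bindex_le_trans ab].
Qed.

Definition interleaving_cat : thin := Thin inter_le_refl inter_le_trans.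

Lemma inter_incl_le (i : bool) (a b : bindex) :
  bindex_le a b -> inter_le (a, i) (b, i).
Proof. by right. Qed.

Definition inter_incl (i : bool) : functor Nop_R interleaving_cat.
Proof.
refine (@Functor Nop_R interleaving_cat (fun a => (a, i))
  (@inter_incl_le i) _ _).
- by move=> a; apply: (@Prop_irrelevance (inter_le _ _)).
- by move=> a b c g f; apply: (@Prop_irrelevance (inter_le _ _)).
Defined.

Definition interleaved (C : category) (F F' : functor Nop_R C) : Prop :=
  exists Z : functor interleaving_cat C,
    compF Z (inter_incl false) = F /\ compF Z (inter_incl true) = F'.

(* [G] is a (1 + eps)-approximation to [F] *)
Definition approximation (G F : functor Nop_R Top) : Prop :=
  exists F' G' : functor Nop_R Top,
    [/\ interleaved F' G', weakly_equivalent R F F' & weakly_equivalent R G G'].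
End Interleaving.

Definition realize (F : functor Nop_R Simp) : functor Nop_R Top :=
  compF (realization_fun R) F.

Definition simplicial_model (G : functor Nop_R Simp) (F : functor Nop_R Top) :
    Prop :=
  weakly_equivalent R (realize G) F.
End Index.
Section Barycentric.
Variable T : finType.
Implicit Types (W : {set {set T}}) (F : {set {set T}}) (s t : {set T}).

Definition is_flag F : bool :=
  (F != set0) && [forall s in F, forall t in F, (s \subset t) || (t \subset s)].

(* S(W)_k; a simplex has dimension >= k - 1 when it has at least k vertices *)
Definition subdiv W (k : nat) : {set {set {set T}}} :=
  [set F : {set {set T}} | [&& is_flag F, F \subset W &
    [exists s in F, [forall t in F, s \subset t] && (k <= #|s|)%N]]].

Definition closed_simplex s : {set {set T}} :=
  [set t : {set T} | (t != set0) && (t \subset s)].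

Lemma is_flagP F :
  reflect (F != set0 /\ {in F &, forall s t, s \subset t \/ t \subset s})
          (is_flag F).
Proof.
apply: (iffP andP) => -[F0 FF]; split => //.
  by move=> s t sF tF; have /orP := forall_inP (forall_inP FF s sF) t tF.
apply/forall_inP => s sF; apply/forall_inP => t tF; apply/orP.
exact: FF.
Qed.

Lemma subdivP W k F :
  reflect [/\ is_flag F, F \subset W & {in F, forall s, (k <= #|s|)%N}]
          (F \in subdiv W k).
Proof.
rewrite inE; apply: (iffP and3P) => -[flF FW].
  case/exists_inP => s sF /andP[/forall_inP sm ks]; split => // t tF.
  exact: leq_trans ks (subset_leq_card (sm t tF)).
move=> Fk; split => //; have /is_flagP[/set0Pn[s0 s0F] chF] := flF.
case: (arg_minnP (fun s : {set T} => #|s|) s0F) => s sF smin.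
apply/exists_inP; exists s => //; rewrite Fk // andbT.
apply/forall_inP => t tF; have [//|ts] := chF s t sF tF.
suff /eqP -> : t == s by [].
by rewrite eqEcard ts smin.
Qed.

Lemma subdiv_complex W k : complex_in (subdiv W k).
Proof.
split=> [|F G /subdivP[/is_flagP[F0 chF] FW Fk] GF G0].
  by apply/negP => /subdivP[/is_flagP[]]; rewrite eqxx.
apply/subdivP; split; last by move=> s /(fintype.subsetP GF); exact: Fk.
  apply/is_flagP; split=> // s t /(fintype.subsetP GF) sF /(fintype.subsetP GF).
  exact: chF.
exact: fintype.subset_trans FW.
Qed.

Lemma subdiv_mono W W' k k' : W \subset W' -> (k' <= k)%N ->
  subdiv W k \subset subdiv W' k'.
Proof.
move=> WW kk; apply/fintype.subsetP => F /subdivP[flF FW Fk]; apply/subdivP.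
split=> // [|s /Fk]; first exact: fintype.subset_trans WW.
exact: leq_trans.
Qed.
End Barycentric.

Section Lexicographic.
Variables (T : finType) (le : rel T).

Fixpoint lexseq (a b : seq T) : bool :=
  match a, b with
  | [::], _ => true
  | _ :: _, [::] => false
  | x :: a', y :: b' => le x y && ((x == y) ==> lexseq a' b')
  end.

Definition lexset (s t : {set T}) : bool :=
  lexseq (sort le (enum s)) (sort le (enum t)).

Definition total_order : Prop :=
  [/\ reflexive le, antisymmetric le, transitive le & total le].

Hypothesis ole : total_order.

Lemma lexset_refl : reflexive lexset.
Proof.
have [rle _ _ _] := ole; rewrite /lexset => s.
by elim: (sort le _) => //= x a IH; rewrite rle eqxx.
Qed.

Lemma lexset_trans : transitive lexset.
Proof.
have [_ ale tle _] := ole; rewrite /lexset => s2 s1 s3.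
move: (sort le (enum s1)) (sort le (enum s2)) (sort le (enum s3)).
elim=> [//|x a IH] [//|y b] [//|z c] /=.
move=> /andP[xy /implyP ab] /andP[yz /implyP bc].
rewrite (tle _ _ _ xy yz) /=; apply/implyP => /eqP xz.
have exy : x = y by apply: ale; rewrite xy xz yz.
by apply: IH (ab _) (bc _); rewrite -?xz ?exy.
Qed.

Lemma lexset_total : total lexset.
Proof.
have [rle ale _ tle] := ole; rewrite /lexset => s1 s2.
move: (sort le (enum s1)) (sort le (enum s2)).
elim=> [//|x a IH] [//|y b] /=.
have [->|_] := eqVneq x y; first by rewrite rle; exact: IH.
by rewrite /= !andbT.
Qed.
End Lexicographic.

Section SubdivisionRips.
Variables (R : realType) (T : finType) (dist : T -> T -> R).

Definition rips (r : R) : {set {set T}} :=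
  [set s : {set T} | (s != set0) &&
    [forall x in s, forall y in s, dist x y <= 2 * r]].

Lemma ripsP r s :
  reflect (s != set0 /\ {in s &, forall x y, dist x y <= 2 * r}) (s \in rips r).
Proof.
rewrite inE; apply: (iffP andP) => -[s0 sr]; split => //.
  by move=> x y xs ys; exact: (forall_inP (forall_inP sr x xs)).
by apply/forall_inP => x xs; apply/forall_inP => y ys; exact: sr.
Qed.

Lemma rips_mono r r' : r <= r' -> rips r \subset rips r'.
Proof.
move=> rr; apply/fintype.subsetP => s /ripsP[s0 sr]; apply/ripsP; split=> // x y xs ys.
by apply: le_trans (sr x y xs ys) _; rewrite ler_pM2l.
Qed.

Definition SR_faces (a : Nop_R R) : {set {set {set T}}} :=
  subdiv (rips (val a.2)) (val a.1).

Let SR_complex a : complex_in (SR_faces a).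
Proof. exact: subdiv_complex. Qed.

Let SR_mono (a b : Nop_R R) F : tle a b -> F \in SR_faces a ->
  [set s | s in F] \in SR_faces b.
Proof.
move=> [ab1 ab2]; rewrite imset_id; apply: (fintype.subsetP (subdiv_mono _ ab1)).
exact: rips_mono.
Qed.

(* structure maps are inclusions *)
Definition SR : functor (Nop_R R) Simp :=
  @system_functor (Nop_R R) _ SR_faces (fun _ _ s => s) SR_complex SR_mono
    (fun _ _ _ => erefl) (fun _ _ _ _ _ _ _ => erefl).

Definition max_simplices (r : R) : {set {set T}} :=
  [set s in rips r | ~~ [exists t in rips r, s \proper t]].

Lemma max_simplices_sup r s : s \in rips r ->
  exists2 t, t \in max_simplices r & s \subset t.
Proof.
move=> sr; pose P := [pred t : {set T} | (t \in rips r) && (s \subset t)].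
have Ps : P s by rewrite /= sr /=.
case: (arg_maxnP (fun t : {set T} => #|t|) Ps) => t /andP[tr st] tmax.
exists t => //; rewrite inE tr /=; apply/exists_inP => -[u ur tu].
have := tmax u; rewrite /= ur (fintype.subset_trans st (proper_sub tu)) => /(_ isT).
by rewrite /= leqNgt proper_card.
Qed.

Definition nerve_faces (a : Nop_R R) : {set {set {set T}}} :=
  [set S : {set {set T}} | [&& S != set0, S \subset max_simplices (val a.2) &
    \bigcap_(s in S) subdiv (closed_simplex s) (val a.1) != set0]].

Let nerve_complex a : complex_in (nerve_faces a).
Proof.
split=> [|S S' ]; first by rewrite inE eqxx.
rewrite !inE => /and3P[_ Sm /set0Pn[F /bigcapP FS]] S'S ->.
rewrite (fintype.subset_trans S'S Sm) /=; apply/set0Pn; exists F.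
by apply/bigcapP => s /(fintype.subsetP S'S); exact: FS.
Qed.

Variables (le : rel T) (ole : total_order le).

Definition lexmin (r : R) (s : {set T}) : {set T} :=
  odflt s [pick t in max_simplices r | (s \subset t) &&
             [forall u in max_simplices r, (s \subset u) ==> lexset le t u]].

Lemma lexminP r s : s \in rips r ->
  [/\ lexmin r s \in max_simplices r, s \subset lexmin r s &
      forall u, u \in max_simplices r -> s \subset u ->
        lexset le (lexmin r s) u].
Proof.
move=> sr; rewrite /lexmin; case: pickP => /= [t /and3P[tm st tmin]|].
  split=> // u um su.
  exact: (implyP (forall_inP tmin u um)).
have [t0 t0m st0] := max_simplices_sup sr.
pose P := [pred t : {set T} | (t \in max_simplices r) && (s \subset t)].
have Pt0 : P t0 by rewrite /= t0m.
case: (@extremumP _ _ (lexset le) t0 P id (lexset_refl ole) (lexset_trans ole)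
  (lexset_total ole) Pt0) => t /andP[tm st] tmin.
move=> /(_ t) /negP[]; rewrite tm st /=; apply/forall_inP => u um.
by apply/implyP => su; apply: tmin; rewrite /= um.
Qed.

(* the scales at which the Rips filtration can change *)
Definition critical_scales : seq R :=
  sort <=%R (undup [seq dist x y / 2 | x <- enum T, y <- enum T]).

Definition scales_between (r r' : R) : seq R :=
  [seq c <- critical_scales | r < c <= r'].

(* Sending s to the lexicographically minimum maximal simplex containing s is
   not compatible with composition for arbitrary scales: on the line, with
   vertices ordered 2.2 < 1 < 0 < 2 and scales 0, 1/2, 3/5, the point 1 goes to
   {2.2, 1, 2} directly, but to {1, 0} through scale 1/2. The rule is therefore
   applied at the successive critical scales; [nerve_map_lexmin] shows that
   this is [lexmin r'] whenever the rule does respect composition. *)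
Definition nerve_map (r r' : R) (s : {set T}) : {set T} :=
  foldl (fun t c => lexmin c t) s (scales_between r r').

Lemma mem_critical x y : dist x y / 2 \in critical_scales.
Proof.
rewrite mem_sort mem_undup; apply/allpairsP; exists (x, y).
by rewrite !mem_enum.
Qed.

Lemma scales_between_refl r : scales_between r r = [::].
Proof.
rewrite /scales_between -[RHS](filter_pred0 critical_scales).
by apply: eq_filter => c /=; case: ltP => //= rc; rewrite leNgt rc.
Qed.

Lemma scales_between_cat r r' r'' : r <= r' -> r' <= r'' ->
  scales_between r r'' = scales_between r r' ++ scales_between r' r''.
Proof.
move=> r1 r2; rewrite /scales_between.
have : sorted <=%R critical_scales by apply: sort_sorted; exact: le_total.
elim: critical_scales => //= c l IH cl.
rewrite IH; last exact: path_sorted cl.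
have [cr'|r'c] := leP c r'.
  by rewrite (le_trans cr' r2); case: ltP.
rewrite (le_lt_trans r1 r'c) andbF /=.
suff -> : [seq x <- l | r < x <= r'] = [::] by [].
apply/eqP; rewrite -[_ == _]negbK -has_filter; apply/hasPn => x xl.
rewrite negb_and -!ltNge; apply/orP; right; apply: lt_le_trans r'c _.
by have /allP/(_ x xl) := order_path_min (@le_trans _ R) cl.
Qed.

Lemma foldl_lexmin l q s : path <=%R q l -> s \in rips q ->
  let t := foldl (fun t c => lexmin c t) s l in
  s \subset t /\ (l != [::] -> t \in max_simplices (last q l)).
Proof.
elim: l q s => [//|c l IH] q s /= /andP[qc cl] sq.
have [lm sl _] := lexminP (fintype.subsetP (rips_mono qc) s sq).
have lr : lexmin c s \in rips c by move: lm; rewrite inE => /andP[].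
have [lt tm] := IH c _ cl lr; split; first exact: fintype.subset_trans lt.
by case: l {IH cl lt} tm => [_ _ //|d l] -> .
Qed.

Lemma rips_last r r' : r <= r' -> path <=%R r (scales_between r r') ->
  rips r' = rips (last r (scales_between r r')).
Proof.
move=> rr pl; set c := last _ _.
have ler_last x : x \in r :: scales_between r r' -> x <= c.
  rewrite /c; move: pl; move: (scales_between r r') => l pl.
  elim: l r x {rr c} pl => [|d l IH] q x /=; first by rewrite inE => _ /eqP ->.
  move=> /andP[qd dl]; rewrite inE => /orP[/eqP ->|xl]; last exact: IH.
  by apply: le_trans qd _; apply: IH => //; exact: mem_head.
have cr' : c <= r'.
  have := mem_last r (scales_between r r'); rewrite -/c inE => /orP[/eqP -> //|].
  by rewrite mem_filter => /andP[/andP[]].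
apply/eqP; rewrite eqEsubset (rips_mono cr') andbT.
apply/fintype.subsetP => s /ripsP[s0 sr']; apply/ripsP; split=> // x y xs ys.
rewrite mulrC -ler_pdivrMr //; have [dr|rd] := leP (dist x y / 2) r.
  by apply: le_trans dr (ler_last _ _); exact: mem_head.
apply: ler_last; rewrite inE mem_filter mem_critical rd ler_pdivrMr //.
by rewrite [r' * 2]mulrC sr' // orbT.
Qed.

Lemma scales_between_path r r' : path <=%R r (scales_between r r').
Proof.
rewrite path_sortedE; last exact: le_trans.
apply/andP; split.
  by apply/allP => c; rewrite mem_filter => /andP[/andP[/ltW]].
by apply: (sorted_filter le_trans); apply: sort_sorted; exact: le_total.
Qed.

Lemma nerve_map_max r r' s : r <= r' -> s \in max_simplices r ->
  nerve_map r r' s \in max_simplices r' /\ s \subset nerve_map r r' s.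
Proof.
move=> rr sm; have pl := scales_between_path r r'.
have sr : s \in rips r by move: sm; rewrite inE => /andP[].
have [sub mx] := foldl_lexmin pl sr; split => //.
rewrite /max_simplices (rips_last rr pl); have [l0|/mx //] := eqVneq (scales_between r r') [::].
by rewrite /nerve_map l0.
Qed.

Lemma nerve_map_lexmin r r' s :
  (forall a b c t, a <= b -> b <= c -> t \in max_simplices a ->
     lexmin c t = lexmin c (lexmin b t)) ->
  r <= r' -> s \in max_simplices r -> nerve_map r r' s = lexmin r' s.
Proof.
move=> fun_lexmin rr sm; have pl := scales_between_path r r'.
have mE := rips_last rr pl; have sr : s \in rips r by move: sm; rewrite inE => /andP[].
have -> : lexmin r' s = lexmin (last r (scales_between r r')) s.
  by rewrite /lexmin /max_simplices mE.
rewrite /nerve_map; move: (scales_between r r') pl {mE rr} => l.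
elim: l r s sm sr => [|c l IH] q s sm sq /= => [_|/andP[qc cl]].
  have [+ sub _] := lexminP sq; rewrite inE => /andP[lr _].
  move: sm; rewrite inE => /andP[_ /exists_inPn smax]; apply/eqP.
  have := smax _ lr; rewrite properEneq sub andbT negbK; exact.
have [lm _ _] := lexminP (fintype.subsetP (rips_mono qc) s sq).
rewrite (IH c _ lm _ cl); last by move: lm; rewrite inE => /andP[].
suff cl' : c <= last c l by rewrite (fun_lexmin q c (last c l) s).
elim: l c {IH lm qc sm sq} cl => //= x l IH c /andP[cx xl].
exact: le_trans cx (IH x xl).
Qed.

Let nerve_map_faces (a b : Nop_R R) S : tle a b -> S \in nerve_faces a ->
  nerve_map (val a.2) (val b.2) @: S \in nerve_faces b.
Proof.
move=> [ab1 ab2]; rewrite !inE.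
move=> /and3P[S0 /fintype.subsetP Sm /set0Pn[F /bigcapP FS]].
apply/and3P; split; first by rewrite imset_eq0.
  by apply/fintype.subsetP => _ /imsetP[s /Sm sm ->]; case: (nerve_map_max ab2 sm).
apply/set0Pn; exists F; apply/bigcapP => _ /imsetP[s sS ->].
have [_ sub] := nerve_map_max ab2 (Sm s sS).
apply: (fintype.subsetP (subdiv_mono _ ab1)) (FS s sS).
apply/fintype.subsetP => t; rewrite !inE => /andP[-> ts].
exact: fintype.subset_trans sub.
Qed.

Let nerve_map_id (a : Nop_R R) s : [set s] \in nerve_faces a ->
  nerve_map (val a.2) (val a.2) s = s.
Proof. by rewrite /nerve_map scales_between_refl. Qed.

Let nerve_map_comp (a b c : Nop_R R) s : tle a b -> tle b c ->
  [set s] \in nerve_faces a ->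
  nerve_map (val a.2) (val c.2) s =
  nerve_map (val b.2) (val c.2) (nerve_map (val a.2) (val b.2) s).
Proof.
by move=> [_ ab] [_ bc] _; rewrite /nerve_map (scales_between_cat ab bc) foldl_cat.
Qed.

(* the nerve model; its definition depends on the total order [le] *)
Definition nerve_SR : functor (Nop_R R) Simp :=
  @system_functor (Nop_R R) _ nerve_faces
    (fun a b => nerve_map (val a.2) (val b.2)) nerve_complex
    nerve_map_faces nerve_map_id nerve_map_comp.
End SubdivisionRips.
Section LinearMaps.
Variable K : fieldType.

Definition mklin (U V : lmodType K) (f : U -> V) (lf : linear f) :
    {linear U -> V} :=
  HB.pack f (GRing.isLinear.Build K U V *:%R f lf).

Lemma lin_ext (U V : lmodType K) (f g : {linear U -> V}) : f =1 g -> f = g.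
Proof.
case: f g => [f cf] [g cg] /= /funext fg; move: cf cg; rewrite fg => cf cg.
congr (GRing.Linear.Pack _).
case: cf cg => [[a1] [b1]] [[a2] [b2]].
by rewrite (Prop_irrelevance a1 a2) (Prop_irrelevance b1 b2).
Qed.

Definition Vec : category.
Proof.
refine (@Category (lmodType K) (fun U V => {linear U -> V})
  (fun U => (@idfun U : {linear U -> U}))
  (fun U V W g f => (g \o f : {linear U -> W})) _ _ _).
- by move=> U V f; exact: lin_ext.
- by move=> U V f; exact: lin_ext.
- by move=> U V W Z h g f; exact: lin_ext.
Defined.

(* the subspace of [V] cut out by [S] *)
Section Subspace.
Variables (V : lmodType K) (S : set V).
Hypothesis Sc : submod_closed (fun v => `[< S v >]).

Definition subspace_pred (_ : submod_closed (fun v => `[< S v >])) : {pred V} :=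
  fun v => `[< S v >].

HB.instance Definition _ := GRing.isSubmodClosed.Build K V (subspace_pred Sc) Sc.

Record subspace_type (h : submod_closed (fun v => `[< S v >])) :=
  SubspaceElt { subspace_val : V; _ : subspace_val \in subspace_pred h }.

HB.instance Definition _ := [isSub for @subspace_val Sc].
HB.instance Definition _ := [Choice of subspace_type Sc by <:].
HB.instance Definition _ := [SubChoice_isSubLmodule of subspace_type Sc by <:].
End Subspace.

Definition sub_lmod (V : lmodType K) (S : set V)
    (Sc : submod_closed (fun v => `[< S v >])) : lmodType K :=
  subspace_type Sc.

Section SubMap.
Variables (U V : lmodType K) (f : {linear U -> V}) (S : set U) (T : set V).
Variables (Sc : submod_closed (fun v => `[< S v >]))
          (Tc : submod_closed (fun v => `[< T v >])).
Hypothesis fST : forall u, S u -> T (f u).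

Definition sub_map_fun (u : sub_lmod Sc) : sub_lmod Tc :=
  @SubspaceElt V T Tc (f (val u)) (asboolT (fST (asboolW (valP u)))).

Lemma sub_map_linear : linear sub_map_fun.
Proof. by move=> a u v; apply: val_inj; rewrite /= !linearP. Qed.

Definition sub_map : {linear sub_lmod Sc -> sub_lmod Tc} := mklin sub_map_linear.
End SubMap.
End LinearMaps.

Section PersistenceModules.
Variables (K : fieldType) (P : thin).

Definition pmod := functor P (Vec K).

Definition fiber (M : pmod) (x : P) : lmodType K := M x.

Definition transit (M : pmod) x y (h : tle x y) :
  {linear fiber M x -> fiber M y} := @fmor P (Vec K) M x y h.

Definition pmap (M N : pmod) (f : nat_trans M N) (x : P) :
  {linear fiber M x -> fiber N x} := f x.

Section Free.
Variables (I : Type) (g : I -> P).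

(* the direct sum over [i : I] of the modules K^<g i>, equal to K on the upset
   of [g i] and to 0 elsewhere *)
Definition free_set (x : P) : set (I -> K^o) :=
  [set c | finite_set [set i | c i != 0]%classic /\
           forall i, c i != 0 -> tle (g i) x]%classic.

Lemma free_closed x : submod_closed (fun c => `[< free_set x c >]).
Proof.
split=> [|a c c' /asboolP[cf cx] /asboolP[cf' cx']]; apply/asboolP.
  split=> [|i]; last by rewrite eqxx.
  by apply: (sub_finite_set _ (finite_set0 I)) => i /=; rewrite eqxx.
have cc' i : (a *: c + c') i != 0 -> c i != 0 \/ c' i != 0.
  case: (eqVneq (c i) 0) => [ci|_]; last by left.
  case: (eqVneq (c' i) 0) => [ci'|_]; last by right.
  have -> : (a *: c + c') i = a * c i + c' i by [].
  by rewrite ci ci' mulr0 addr0 eqxx.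
split; last by move=> i /cc'[/cx|/cx'].
apply: (@sub_finite_set _ _
  ([set i | c i != 0] `|` [set i | c' i != 0])%classic) => [i /cc' //|].
by rewrite finite_setU.
Qed.

Lemma free_mono x y : tle x y -> forall c, free_set x c -> free_set y c.
Proof. by move=> xy c [cf cx]; split=> // i /cx; exact: tle_trans. Qed.

Definition free_pmod : pmod.
Proof.
refine (@Functor P (Vec K) (fun x => sub_lmod (free_closed x))
  (fun x y h => sub_map (f := (@idfun (I -> K^o) : {linear (I -> K^o) -> (I -> K^o)}))
                  (free_closed x) (free_closed y) (free_mono h)) _ _).
- by move=> x; apply: lin_ext => c; apply: val_inj.
- by move=> x y z h1 h2; apply: lin_ext => c; apply: val_inj.
Defined.
End Free.

Definition free_module (M : pmod) : Prop :=
  exists (I : Type) (g : I -> P), isomorphic M (free_pmod g).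

(* [p] presents its target as the cokernel of [f] *)
Definition is_cokernel (M N Q : pmod) (f : nat_trans M N) (p : nat_trans N Q) :
    Prop :=
  forall x, (forall q, exists n, pmap p x n = q) /\
            (forall n, pmap p x n = 0 <-> exists m, pmap f x m = n).

Definition finitely_presented (M : pmod) : Prop :=
  exists (m n : nat) (g : 'I_m -> P) (h : 'I_n -> P)
         (f : nat_trans (free_pmod h) (free_pmod g))
         (p : nat_trans (free_pmod g) M), is_cokernel f p.

Record chain_complex := ChainComplex {
  cmod :> nat -> pmod;
  cbd : forall i, nat_trans (cmod i.+1) (cmod i);
  cbd_cbd : forall i x v, pmap (cbd i) x (pmap (cbd i.+1) x v) = 0
}.

Definition complex_iso (F G : chain_complex) : Prop :=
  exists (a : forall i, nat_trans (F i) (G i))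
         (b : forall i, nat_trans (G i) (F i)),
    (forall i x, cancel (pmap (a i) x) (pmap (b i) x) /\
                 cancel (pmap (b i) x) (pmap (a i) x)) /\
    (forall i x v, pmap (a i) x (pmap (cbd F i) x v) =
                   pmap (cbd G i) x (pmap (a i.+1) x v)).

Section PairMap.
Variables (U V U' V' : lmodType K) (f : {linear U -> V}) (g : {linear U' -> V'}).

Definition pair_fun (u : U * U') : V * V' := (f u.1, g u.2).

Lemma pair_linear : linear pair_fun.
Proof. by move=> a u v; rewrite /pair_fun /= !linearP. Qed.

Definition pair_map : {linear (U * U')%type -> (V * V')%type} := mklin pair_linear.
End PairMap.

Definition direct_sum (M N : pmod) : pmod.
Proof.
refine (@Functor P (Vec K) (fun x => (fiber M x * fiber N x)%type : lmodType K)
  (fun x y h => pair_map (transit M h) (transit N h)) _ _).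
- move=> x; apply: lin_ext => -[u v]; rewrite /= /pair_fun /transit /=.
  by rewrite (fmor_id M) (fmor_id N).
- move=> x y z h1 h2; apply: lin_ext => -[u v]; rewrite /= /pair_fun /transit /=.
  by rewrite (fmor_comp M h1 h2) (fmor_comp N h1 h2).
Defined.

Definition direct_sum_map (M N M' N' : pmod) (f : nat_trans M M')
    (g : nat_trans N N') : nat_trans (direct_sum M N) (direct_sum M' N').
Proof.
refine (@NatTrans P (Vec K) (direct_sum M N) (direct_sum M' N')
  (fun x => pair_map (pmap f x) (pmap g x)) _).
move=> x y h; apply: lin_ext => -[u v]; rewrite /= /pair_fun /=; congr pair.
- by have /(congr1 (fun k : {linear _ -> _} => k u)) := natural f h.
- by have /(congr1 (fun k : {linear _ -> _} => k v)) := natural g h.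
Defined.

Definition complex_sum (F G : chain_complex) : chain_complex.
Proof.
refine (@ChainComplex (fun i => direct_sum (F i) (G i))
  (fun i => direct_sum_map (cbd F i) (cbd G i)) _).
by move=> i x [u v]; rewrite /pmap /= /pair_fun /= !cbd_cbd.
Defined.

Definition free_resolution (M : pmod) (F : chain_complex) : Prop :=
  [/\ forall i, free_module (F i),
      forall i x v, pmap (cbd F i) x v = 0 -> exists w, pmap (cbd F i.+1) x w = v &
      exists p : nat_trans (F 0%N) M, is_cokernel (cbd F 0%N) p].

(* a direct summand of every free resolution, up to isomorphism *)
Definition minimal_resolution (M : pmod) (F : chain_complex) : Prop :=
  free_resolution M F /\
  forall F', free_resolution M F' -> exists G, complex_iso F' (complex_sum F G).

Definition submodule (M : pmod) (N : forall x, set (fiber M x)) : Prop :=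
  (forall x, submod_closed (fun v => `[< N x v >])) /\
  (forall x y (h : tle x y) v, N x v -> N y (transit M h v)).

(* a set of elements of [M], each with its degree *)
Definition generates (M : pmod) (S : set {x : P & fiber M x}) : Prop :=
  forall N, submodule N -> (forall e, S e -> N (projT1 e) (projT2 e)) ->
    forall x v, N x v.

Definition minimal_generating_set (M : pmod) (S : set {x : P & fiber M x}) :
    Prop :=
  generates S /\ forall S', (S' `<=` S)%classic -> generates S' -> S' = S.

Definition betti (M : pmod) (i n : nat) : Prop :=
  exists2 F, minimal_resolution M F &
  exists2 S, minimal_generating_set (M := F i) S & (S #= `I_n)%card.
End PersistenceModules.

Section Chains.
Variable K : fieldType.

Section ChainObj.
Variables (j : nat) (L : simplicial_complex).

Definition ordered_tuple := {ffun 'I_j.+1 -> vtx L}.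

(* oriented simplicial chains, as functions on ordered simplices changing sign
   under odd permutations; [c v] is the coefficient of the oriented simplex
   [v_0, ..., v_j] *)
Definition chain_set : set (ordered_tuple -> K^o) :=
  [set c | [/\ forall (v : ordered_tuple) (s : 'S_j.+1),
                 c [ffun i => v (s i)] = (-1) ^+ s * c v,
               forall v : ordered_tuple, ~~ injectiveb v -> c v = 0 &
               forall v : ordered_tuple,
                 [set v i | i : 'I_j.+1] \notin faces L -> c v = 0]]%classic.

Lemma chain_closed : submod_closed (fun c => `[< chain_set c >]).
Proof.
split=> [|a c c' /asboolP[cs cn cf] /asboolP[cs' cn' cf']]; apply/asboolP.
  by split=> // v s; rewrite mulr0.
have cc' v : (a *: c + c') v = a * c v + c' v by [].
split=> [v s|v vi|v vf]; rewrite !cc'.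
- by rewrite cs cs' mulrDr mulrCA.
- by rewrite cn // cn' // mulr0 addr0.
- by rewrite cf // cf' // mulr0 addr0.
Qed.

Definition chains : lmodType K := sub_lmod chain_closed.
End ChainObj.

Section ChainMap.
Variables (j : nat) (L M : simplicial_complex) (f : simp_map L M).

Let tmap (v : ordered_tuple j L) : ordered_tuple j M := [ffun i => f (v i)].

Let tperm_map (L' : simplicial_complex) (s : 'S_j.+1)
    (v : ordered_tuple j L') : ordered_tuple j L' := [ffun i => v (s i)].

Let tperm_mapK (L' : simplicial_complex) (s : 'S_j.+1) :
  cancel (@tperm_map L' s) (@tperm_map L' s^-1%g).
Proof. by move=> v; apply/ffunP => i; rewrite !ffunE permKV. Qed.

Let tperm_mapVK (L' : simplicial_complex) (s : 'S_j.+1) :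
  cancel (@tperm_map L' s^-1%g) (@tperm_map L' s).
Proof. by move=> v; apply/ffunP => i; rewrite !ffunE permK. Qed.

Let tmap_perm s v : tmap (tperm_map s v) = tperm_map s (tmap v).
Proof. by apply/ffunP => i; rewrite !ffunE. Qed.

(* [v_0, ..., v_j] is sent to [f v_0, ..., f v_j]; degenerate simplices are
   sent to 0 because the contributions to their coefficients cancel *)
Definition chain_push (c : ordered_tuple j L -> K^o) : ordered_tuple j M -> K^o :=
  fun w => \sum_(v : ordered_tuple j L | [ffun i => f (v i)] == w) c v.

Lemma chain_push_linear : linear chain_push.
Proof.
move=> a c c'; apply/funext => w.
have -> : (a *: chain_push c + chain_push c') w =
  a * chain_push c w + chain_push c' w by [].
by rewrite /chain_push mulr_sumr -big_split.
Qed.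

Lemma chain_pushP c : chain_set c -> chain_set (chain_push c).
Proof.
move=> [cs cn cf]; split=> [w s|w /injectiveP wn|w wf].
- rewrite /chain_push (reindex (@tperm_map L s)); last first.
    by apply: onW_bij; exists (@tperm_map L s^-1%g);
      [exact: tperm_mapK|exact: tperm_mapVK].
  rewrite mulr_sumr; apply: eq_big => [v|v _]; last exact: cs.
  rewrite -[LHS]/(tmap (tperm_map s v) == tperm_map s w) tmap_perm.
  by rewrite (can_eq (@tperm_mapK M s)).
- have [i [k [ik wik]]] : exists i k, i != k /\ w i = w k.
    apply: contrapT => nex; apply: wn => i k wik.
    by apply/eqP; apply/negPn/negP => ik; apply: nex; exists i, k.
  pose s := tperm i k; have sw : tperm_map s w = w.
    by apply/ffunP => l; rewrite ffunE; case: tpermP => // ->.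
  have ss v : tperm_map s (tperm_map s v) = v :> ordered_tuple j L.
    by apply/ffunP => l; rewrite !ffunE tpermK.
  have fs v : (tmap (tperm_map s v) == w) = (tmap v == w).
    by rewrite -{1}sw tmap_perm (can_eq (@tperm_mapK M s)).
  pose r (v : ordered_tuple j L) l : nat := enum_rank (v l).
  have sl v : r (tperm_map s v) i = r v k by rewrite /r ffunE tpermL.
  have sr v : r (tperm_map s v) k = r v i by rewrite /r ffunE tpermR.
  rewrite /chain_push (bigID (fun v => r v i < r v k)%N) /=.
  rewrite [X in _ + X](bigID (fun v => r v k < r v i)%N) /=.
  rewrite [X in _ + (_ + X)]big1 ?addr0 => [|v /andP[/andP[_ n1] n2]]; last first.
    apply: cn; apply/injectiveP => vi; case/eqP: ik; apply: vi.
    apply: enum_rank_inj; apply: ord_inj; apply/eqP.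
    by rewrite eqn_leq [X in X && _]leqNgt n2 leqNgt n1.
  apply/eqP; rewrite addrC addr_eq0 -sumrN (reindex_inj (can_inj ss)) /=.
  apply/eqP; apply: eq_big => [v|v _].
    rewrite -[X in X && _ && _]/(tmap (tperm_map s v) == w) fs sl sr -leqNgt.
    by rewrite -andbA; congr andb; apply: andb_idl => /ltnW.
  by rewrite -[LHS]/(c [ffun l => v (s l)]) cs odd_tperm ik mulN1r.
- apply: big1 => v /eqP fv; apply: cf; apply: contra wf => vf.
  suff -> : [set w i | i : 'I_j.+1] = f @: [set v i | i : 'I_j.+1].
    exact: vmapP.
  by rewrite -imset_comp; apply: eq_imset => i; rewrite -fv ffunE.
Qed.

Definition chain_map : {linear chains j L -> chains j M} :=
  sub_map (f := mklin chain_push_linear) (chain_closed j L) (chain_closed j M)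
    chain_pushP.
End ChainMap.

Definition chains_fun (j : nat) : functor Simp (Vec K).
Proof.
refine (@Functor Simp (Vec K) (chains j)
  (fun L M f => chain_map j f) _ _).
- move=> L; apply: lin_ext => c; apply: val_inj; apply/funext => w /=.
  rewrite /chain_push (big_pred1 w) // => v.
  by rewrite -[in LHS](_ : v = [ffun i => v i]) //; apply/ffunP => i; rewrite ffunE.
- move=> L M N g f; apply: lin_ext => c; apply: val_inj; apply/funext => w /=.
  rewrite /chain_push.
  rewrite (partition_big (fun v : ordered_tuple j L => [ffun i => f (v i)])
    (fun u : ordered_tuple j M => [ffun i => g (u i)] == w)) /=; last first.
    by move=> v /eqP <-; apply/eqP/ffunP => i; rewrite !ffunE.
  apply: eq_bigr => u gu; apply: eq_bigl => v; apply: andb_idl => /eqP fv.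
  by rewrite -(eqP gu) -fv; apply/eqP/ffunP => i; rewrite !ffunE.
Defined.

Variable P : thin.

Definition chain_module (j : nat) (G : functor P Simp) : pmod K P :=
  compF (chains_fun j) G.

Definition finitely_presented_diagram (G : functor P Simp) : Prop :=
  forall j, finitely_presented (chain_module j G).

(* [G] is finitely presented, of size
   beta_1(C_0 G) + sum_(j >= 0) beta_0(C_j G) = n *)
Definition has_size (G : functor P Simp) (n : nat) : Prop :=
  finitely_presented_diagram G /\
  exists (b1 : nat) (b0 : nat -> nat) (N : nat),
    [/\ betti (chain_module 0 G) 1 b1,
        forall j, betti (chain_module j G) 0 (b0 j),
        forall j, (N <= j)%N -> b0 j = 0%N &
        n = (b1 + \sum_(j < N) b0 j)%N].
End Chains.

Section LpMetric.
Variables (R : realType) (d : nat).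

(* [p] ranges over [1, +oo]; the value at [-oo] is irrelevant *)
Definition lp_dist (p : \bar R) (x y : 'rV[R]_d) : R :=
  match p with
  | q%:E => (\sum_i `|x ord0 i - y ord0 i| `^ q) `^ q^-1
  | _ => \big[Num.max/0]_i `|x ord0 i - y ord0 i|
  end.

Variables (p : \bar R) (X : {fset 'rV[R]_d}).

Definition lp_on (x y : X) : R := lp_dist p (val x) (val y).

Definition SR_lp : functor (Nop_R R) Simp := SR lp_on.

Definition nerve_SR_lp (le : rel X) (ole : total_order le) :
  functor (Nop_R R) Simp := nerve_SR lp_on ole.
End LpMetric.

(* only used for p in {1, +oo} or d = 1 *)
Definition alpha (R : realType) (d : nat) (p : \bar R) : nat :=
  if [|| p == +oo%E, d == 1%N | (d == 2%N) && (p == 1%:E)] then d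
  else (d * 2 ^ (d ^ 2 - 1))%N.

Definition beta (R : realType) (d : nat) (c eps : R) : R :=
  c * eps `^ (- ((d ^ 2 - 1)%N%:R / 2)).

Definition skel (P : thin) (k : nat) (G : functor P Simp) : functor P Simp :=
  compF (skeleton_fun k) G.

(* Main.v *)
Require Import Defs.
From HB Require Import structures.
From mathcomp Require Import all_boot all_order all_algebra perm finmap.
From mathcomp Require Import boolp classical_sets functions cardinality.
From mathcomp Require Import set_interval reals ereal topology normedtype exp.
From mathcomp Require Import fsbigop finset.
From mathcomp Require Import ring lra zify.
From Stdlib Require Import Relation_Operators.

Set Implicit Arguments.
Unset Strict Implicit.
Unset Printing Implicit Defensive.

Import Order.TTheory GRing.Theory Num.Theory.
Import numFieldNormedType.Exports.

Local Open Scope ring_scope.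

(** The proof has three independent ingredients.

   The nerve theorem. A set [S] of maximal simplices spans a simplex of the
   nerve at index [k] exactly when its members share at least [k] vertices
   ([meet_subdiv]). The subdivision and the nerve are compared through two
   complexes whose simplices are also tested on intersections only: the sets of
   simplices with at least [k] common vertices, and the sets of pairs formed by
   a simplex and a maximal simplex containing it, tested on the first entries.
   Inclusion and the two projections give a strictly natural zigzag. The
   projections have simplicial inverses up to contiguity. The inclusion of flags has for inverse
   the map sending a point to the flag of the intersections of the level sets
   of its barycentric coordinates. All homotopies are straight lines
   ([nerve_model]).

   The size. The chains of the nerve in degree [j] have the [j]-simplices as
   bases, each of which goes at the next critical scale to another one, up to
   sign, or to 0. Following backwards the simplices that have the same number
   of common vertices, every basis element descends from a generator; a
   relation is needed each time an element changes generator. This gives a free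
   resolution of length one ([labelled_betti]), which is minimal because
   relations only involve generators of smaller degree
   ([short_resolution_minimal]). There are at most as many generators, and as
   many relations, as pairs of a critical scale and a simplex at this scale.
   With at most [|X|^2] critical scales and [|X|^a] maximal simplices at each of
   them, the [k]-skeleton has size at most [(k + 2) |X|^(a (k + 1) + 2)]
   ([nerve_size]).

   The number of maximal simplices. If the distance is the largest of [n]
   differences of functionals, a maximal simplex is determined by the points
   where the functionals are minimal, hence [a = n] ([card_max_simplices]). The
   coordinates give [n = d] for [p = oo], and signed sums give [n = 2^(d - 1)]
   for [p = 1]. For every [p], functionals norming the points of a
   grid on the facets of the unit cube define a polyhedral distance that
   approximates the distance up to the factor [1 + eps], with [n] of the order
   of [eps^-(d - 1)] ([polyhedral_approximation]); the exponent [d - 1] is at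
   most [(d^2 - 1) / 2]. The nerve for the polyhedral distance is the required
   approximation, because the two subdivision-Rips bifiltrations are interleaved
   by inclusions ([SR_interleaved]). *)

(* hides the operation on sequences *)
Local Notation pmap := Defs.pmap.

(** * Homotopies in realizations *)

Section StraightLine.
Variable R : realType.

Definition carrier (L : simplicial_complex) (t : realization R L) : {set vtx L} :=
  [set v | val t v != 0].

Lemma realizationP (L : simplicial_complex) (t : realization R L) :
  realization_set (val t).
Proof. exact: set_mem (valP t). Qed.

Lemma carrier_face (L : simplicial_complex) (t : realization R L) : carrier t \in faces L.
Proof. by have [] := realizationP t. Qed.

Lemma carrier_map (L M : simplicial_complex) (f : simp_map L M) (t : realization R L) :
  carrier (realization_map f t) = f @: carrier t.
Proof.
have [t0 _ _] := realizationP t; apply/setP => w; rewrite inE /= /push.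
apply/idP/imsetP => [sn0|[v]].
  apply: contrapT => nw; case/negP: sn0; apply/eqP; apply: big1 => v /eqP fv.
  by apply/eqP/negPn/negP => tv; apply: nw; exists v => //; rewrite inE.
rewrite inE => tv ->; rewrite psumr_neq0 => [|v' _]; last exact: t0.
by apply/hasP; exists v; rewrite ?mem_index_enum // eqxx /= lt0r [_ != 0]tv; exact: t0.
Qed.

Lemma coordinate_continuous (L : simplicial_complex) v :
  continuous (fun t : realization R L => val t v).
Proof.
move=> t; apply: (@continuous_comp _ _ _ set_val
  (fun g : {ptws vtx L -> R} => g v)); first exact: initial_continuous.
exact: (@proj_continuous _ (fun _ : vtx L => R) v).
Qed.

Lemma continuous_realization (X : topologicalType) (L : simplicial_complex)
    (f : X -> realization R L) :
  (forall v, continuous (fun x => val (f x) v)) -> continuous f.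
Proof. by move=> fc; apply: continuous_comp_initial; exact: continuous_ptws. Qed.

(** Clamping the parameter makes the homotopies defined and continuous on the
   whole line. *)
Definition clamp (s : R) : R := Num.min 1 (Num.max 0 s).

Lemma clamp_ge0 s : 0 <= clamp s.
Proof. by rewrite /clamp le_min ler01 le_max lexx. Qed.

Lemma clamp_le1 s : clamp s <= 1.
Proof. by rewrite /clamp ge_min lexx. Qed.

Lemma clamp0 : clamp 0 = 0.
Proof. by rewrite /clamp maxxx; apply/min_idPr. Qed.

Lemma clamp1 : clamp 1 = 1.
Proof. by rewrite /clamp (max_idPr ler01) minxx. Qed.

Lemma clamp_continuous : continuous clamp.
Proof.
move=> s; rewrite /clamp.
have h : {for s, continuous ((fun=> 1 : R^o) \min ((fun=> 0 : R^o) \max (idfun : R -> R^o)))}.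
  apply: continuous_min; first exact: cst_continuous.
  by apply: continuous_max; [exact: cst_continuous|exact: cvg_id].
exact: h.
Qed.

Section Segment.
Variables (L : simplicial_complex) (t u : realization R L).
Hypothesis tu : carrier t :|: carrier u \in faces L.

Lemma segment_subproof s :
  realization_set ((fun v => (1 - clamp s) * val t v + clamp s * val u v) :
    {ptws vtx L -> R}).
Proof.
have [t0 t1 _] := realizationP t; have [u0 u1 _] := realizationP u.
have c0 := clamp_ge0 s; have c1 : 0 <= 1 - clamp s by rewrite subr_ge0 clamp_le1.
split=> [v||]; first by rewrite addr_ge0 // mulr_ge0.
  by rewrite big_split /= -!mulr_sumr t1 u1 !mulr1 subrK.
apply: (face_sub tu).
  apply/fintype.subsetP => v; rewrite !inE; apply: contraNT.
  by rewrite negb_or !negbK => /andP[/eqP -> /eqP ->]; rewrite !mulr0 addr0.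
apply/eqP => E; have : \sum_v ((1 - clamp s) * val t v + clamp s * val u v) = 0 :> R.
  by apply: big1 => v _; apply/eqP; move/setP/(_ v): E; rewrite !inE => /negbFE.
by rewrite big_split /= -!mulr_sumr t1 u1 !mulr1 subrK => /eqP; rewrite oner_eq0.
Qed.

Definition segment s : realization R L := 
  exist (fun v => is_true (v \in @realization_set R L)) _ (mem_set (segment_subproof s)).
End Segment.

(** The segment from [f x] to [g x] lies in the simplex spanned by the two
   carriers. *)
Lemma straight_line_homotopic (X : topologicalType) (L : simplicial_complex)
    (f g : X -> realization R L) :
  continuous f -> continuous g ->
  (forall x, carrier (f x) :|: carrier (g x) \in faces L) -> homotopic R f g.
Proof.
move=> fc gc fg; pose H (z : X * R) : realization R L := segment (fg z.1) z.2.
have Hc : continuous H; last exists H; last split=> [|x|x].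
- refine (@continuous_realization _ L H _) => v z /=.
  have cf h : continuous h -> continuous (fun z : X * R => val ((h : X -> realization R L) z.1) v).
    move=> hc y; apply: (continuous_comp (f := fst) (g := fun x => val (h x) v)).
      exact: cvg_fst.
    by apply: (continuous_comp (f := h) (g := fun t : realization R L => val t v)); [exact: hc|exact: coordinate_continuous].
  have cc : continuous (fun z : X * R => clamp z.2).
    move=> y; apply: (continuous_comp (f := snd) (g := clamp)); first exact: cvg_snd.
    exact: clamp_continuous.
  apply: cvgD; apply: cvgM; [|exact: cf|exact: cc|exact: cf].
  by apply: cvgB; [exact: cvg_cst|exact: cc].
- by apply: continuous_subspaceT.
- apply: val_inj; apply/funext => v /=.
  by rewrite clamp0 subr0 mul1r mul0r addr0.
- apply: val_inj; apply/funext => v /=.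
  by rewrite clamp1 subrr mul1r mul0r add0r.
Qed.

Lemma carried_homotopy_equivalence (L M : simplicial_complex) (f : simp_map L M)
    (g : realization R M -> realization R L) :
  continuous g ->
  (forall t, carrier (g (realization_map f t)) :|: carrier t \in faces L) ->
  (forall u, carrier (realization_map f (g u)) :|: carrier u \in faces M) ->
  homotopy_equivalence R (fmor (realization_fun R) f).
Proof.
move=> gc gf fg; pose h : continuousType (realization R M) (realization R L) := mkcts gc.
exists h; split.
- apply: straight_line_homotopic => //; last by move=> t; exact: cvg_id.
  move=> t; apply: continuous_comp; last exact: gc.
  exact: realization_map_continuous.
- apply: straight_line_homotopic => //; last by move=> t; exact: cvg_id.
  move=> t; apply: continuous_comp; first exact: gc.
  exact: realization_map_continuous.
Qed.

Lemma contiguous_homotopy_equivalence (L M : simplicial_complex)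
    (f : simp_map L M) (g : simp_map M L) :
  (forall s, s \in faces L -> (g \o f) @: s :|: s \in faces L) ->
  (forall s, s \in faces M -> (f \o g) @: s :|: s \in faces M) ->
  homotopy_equivalence R (fmor (realization_fun R) f).
Proof.
move=> gf fg; apply: (carried_homotopy_equivalence (g := realization_map g)).
- exact: realization_map_continuous.
- by move=> t; rewrite !carrier_map -imset_comp; exact/gf/carrier_face.
- by move=> t; rewrite !carrier_map -imset_comp; exact/fg/carrier_face.
Qed.

Section Normalize.
Variables (X : topologicalType) (L : simplicial_complex) (h : X -> vtx L -> R).
Hypothesis h_ge0 : forall t v, 0 <= h t v.
Hypothesis h_cont : forall v, continuous (h^~ v).
Hypothesis h_face : forall t, [set v | h t v != 0] \in faces L.

Lemma normalize_sum_gt0 t : 0 < \sum_v h t v.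
Proof.
rewrite lt0r sumr_ge0 ?andbT // psumr_neq0 //.
have /set0Pn[v] : [set v | h t v != 0] != finset.set0.
  by apply: contraNneq (face_neq0 L) => <-.
rewrite inE => hv; apply/hasP; exists v; first exact: mem_index_enum.
by rewrite /= lt0r hv h_ge0.
Qed.

Lemma normalize_subproof t :
  realization_set ((fun v => h t v / \sum_w h t w) : {ptws vtx L -> R}).
Proof.
have s0 := normalize_sum_gt0 t; split=> [v||].
- by rewrite divr_ge0 // ltW.
- by rewrite -mulr_suml divff // gt_eqF.
- suff -> : [set v | h t v / \sum_w h t w != 0] = [set v | h t v != 0] by [].
  by apply/setP => v; rewrite !inE mulf_eq0 invr_eq0 (gt_eqF s0) orbF.
Qed.

Definition normalize t : realization R L := 
  exist (fun v => is_true (v \in @realization_set R L)) _ (mem_set (normalize_subproof t)).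

Lemma carrier_normalize t : carrier (normalize t) = [set v | h t v != 0].
Proof.
by apply/setP => v; rewrite !inE /= mulf_eq0 invr_eq0 (gt_eqF (normalize_sum_gt0 t)) orbF.
Qed.

Lemma normalize_continuous : continuous normalize.
Proof.
refine (@continuous_realization _ L normalize _) => v t /=.
have sc : continuous (fun t => \sum_w h t w).
  by apply: continuous_big => [|w _]; [exact: add_continuous|exact: (@h_cont w)].
apply: (@cvgM _ _ _ _ (h^~ v) (fun t => (\sum_w h t w)^-1)); first exact: (@h_cont v t).
by apply: (@cvgV _ _ _ _ (fun t => \sum_w h t w));
  [rewrite gt_eqF // normalize_sum_gt0|exact: sc].
Qed.
End Normalize.
End StraightLine.

(** * Maps of set systems *)

Section SystemMaps.
Variables (T T' : finType) (A : {set {set T}}) (A' : {set {set T'}}).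
Variables (cA : complex_in A) (cA' : complex_in A') (phi : T -> T').
Hypothesis phiA : forall S, S \in A -> phi @: S \in A'.

Lemma system_map_subproof (v : system_vtx A) : [set phi (val v)] \in A'.
Proof. by rewrite -imset_set1; apply: phiA; exact: valP v. Qed.

Definition system_map_fun (v : vtx (complex_of cA)) : vtx (complex_of cA') :=
  exist (fun w : T' => is_true ([set w] \in A')) (phi (val v)) (system_map_subproof v).

Lemma val_system_map (S : {set vtx (complex_of cA)}) :
  val @: (system_map_fun @: S) = phi @: (val @: S).
Proof. by rewrite -!imset_comp; apply: eq_imset. Qed.

Lemma system_mapP S : S \in faces (complex_of cA) ->
  system_map_fun @: S \in faces (complex_of cA').
Proof. by rewrite !inE val_system_map => /phiA. Qed.

Definition system_map : simp_map (complex_of cA) (complex_of cA') :=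
  SimpMap system_mapP.
End SystemMaps.

Section SystemContiguity.
Variables (R : realType) (T T' : finType) (A : {set {set T}}) (A' : {set {set T'}}).
Variables (cA : complex_in A) (cA' : complex_in A') (phi : T -> T') (psi : T' -> T).
Hypothesis phiA : forall S, S \in A -> phi @: S \in A'.
Hypothesis psiA : forall S, S \in A' -> psi @: S \in A.

Lemma system_homotopy_equivalence :
  (forall S, S \in A -> psi @: (phi @: S) :|: S \in A) ->
  (forall S, S \in A' -> phi @: (psi @: S) :|: S \in A') ->
  homotopy_equivalence R (fmor (realization_fun R) (system_map cA cA' phiA)).
Proof.
move=> pp pp'.
apply: (@contiguous_homotopy_equivalence R _ _ _ (system_map cA' cA psiA)) => S; rewrite !inE.
  by rewrite imsetU imset_comp !val_system_map => /pp.
by rewrite imsetU imset_comp !val_system_map => /pp'.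
Qed.
End SystemContiguity.

Section SystemTransformation.
Variables (R : realType) (P : thin) (T T' : finType).
Variables (A : P -> {set {set T}}) (f : P -> P -> T -> T).
Variables (A' : P -> {set {set T'}}) (f' : P -> P -> T' -> T').
Hypothesis cA : forall p, complex_in (A p).
Hypothesis fA : forall p q s, tle p q -> s \in A p -> f p q @: s \in A q.
Hypothesis f_id : forall p v, [set v] \in A p -> f p p v = v.
Hypothesis f_comp : forall p q r v, tle p q -> tle q r -> [set v] \in A p ->
  f p r v = f q r (f p q v).
Hypothesis cA' : forall p, complex_in (A' p).
Hypothesis fA' : forall p q s, tle p q -> s \in A' p -> f' p q @: s \in A' q.
Hypothesis f_id' : forall p v, [set v] \in A' p -> f' p p v = v.
Hypothesis f_comp' : forall p q r v, tle p q -> tle q r -> [set v] \in A' p ->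
  f' p r v = f' q r (f' p q v).
Variable phi : T -> T'.
Hypothesis phiA : forall p S, S \in A p -> phi @: S \in A' p.
Hypothesis phif : forall p q v, tle p q -> [set v] \in A p ->
  phi (f p q v) = f' p q (phi v).

Lemma system_natural (p q : P) (h : tle p q) :
  @compm Simp _ _ _ (fmor (system_functor cA' fA' f_id' f_comp') h)
    (system_map (cA p) (cA' p) (@phiA p)) =
  @compm Simp _ _ _ (system_map (cA q) (cA' q) (@phiA q))
    (fmor (system_functor cA fA f_id f_comp) h).
Proof.
apply: simp_map_ext => v; apply: val_inj => /=.
by rewrite phif //; exact: (valP v).
Qed.

Definition system_trans :
    nat_trans (system_functor cA fA f_id f_comp) (system_functor cA' fA' f_id' f_comp') :=
  @NatTrans P Simp (system_functor cA fA f_id f_comp)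
    (system_functor cA' fA' f_id' f_comp') (fun p => system_map (cA p) (cA' p) (@phiA p)) system_natural.
End SystemTransformation.

Section Whisker.
Variables (R : realType) (F G : functor (Nop_R R) Simp) (eta : nat_trans F G).

Lemma realize_natural (p q : Nop_R R) (h : tle p q) :
  @compm Top _ _ _ (fmor (realize G) h) (fmor (realization_fun R) (eta p)) =
  @compm Top _ _ _ (fmor (realization_fun R) (eta q)) (fmor (realize F) h).
Proof.
have := congr1 (fmor (realization_fun R)) (natural eta h).
by rewrite !(fmor_comp (realization_fun R)).
Qed.

Definition realize_trans : nat_trans (realize F) (realize G) :=
  @NatTrans (Nop_R R) Top (realize F) (realize G)
    (fun p => fmor (realization_fun R) (eta p)) realize_natural.

Lemma realize_equivalent :
  (forall p, homotopy_equivalence R (fmor (realization_fun R) (eta p))) ->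
  weakly_equivalent R (realize F) (realize G).
Proof. by move=> h; apply: rst_step; exists realize_trans. Qed.
End Whisker.

(** * Intersections of simplices *)

Section Meets.
Variable T : finType.
Implicit Types (S : {set {set T}}) (s t : {set T}).

Definition meet S : {set T} := \bigcap_(s in S) s.

Lemma meet_sub S s : s \in S -> meet S \subset s.
Proof. by move=> sS; exact: bigcap_inf. Qed.

Lemma sub_meet S t : (forall s, s \in S -> t \subset s) -> t \subset meet S.
Proof. by move=> tS; apply/bigcapsP. Qed.

Lemma meet_anti S S' : S \subset S' -> meet S' \subset meet S.
Proof. by move=> /fintype.subsetP SS; apply: sub_meet => s /SS; exact: meet_sub. Qed.

Lemma meet_chain S : is_flag S -> meet S \in S.
Proof.
case/is_flagP => /set0Pn[s0 s0S] ch; pose f (s : {set T}) := #|s|.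
case: (arg_minnP f s0S) => s sS smin.
suff -> : meet S = s by [].
apply/eqP; rewrite eqEsubset meet_sub //; apply: sub_meet => t tS.
have [//|ts] := ch s t sS tS; suff /eqP -> : t == s by [].
by rewrite eqEcard ts; exact: smin.
Qed.

(** The members of a flag common to the subdivisions lie in the intersection;
   conversely, the intersection alone is such a flag. *)
Lemma meet_subdiv S k : S != finset.set0 -> (0 < k)%N ->
  (\bigcap_(s in S) subdiv (closed_simplex s) k != finset.set0) = (k <= #|meet S|)%N.
Proof.
move=> /set0Pn[s0 s0S] k0; apply/set0Pn/idP => [[F /bigcapP FS]|kS].
  have /subdivP[/is_flagP[/set0Pn[t tF] _] _ Fk] := FS s0 s0S.
  apply: leq_trans (Fk t tF) (subset_leq_card _); apply/bigcapsP => s sS.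
  have /subdivP[_ /fintype.subsetP/(_ t tF) + _] := FS s sS.
  by rewrite inE => /andP[].
exists [set meet S]; apply/bigcapP => s sS; apply/subdivP; split.
- apply/is_flagP; split=> [|a b /set1P -> /set1P ->]; last by left.
  by apply/set0Pn; exists (meet S); rewrite inE.
- rewrite sub1set inE -card_gt0 (leq_trans k0 kS) /=.
  exact: bigcap_inf.
- by move=> t /set1P ->.
Qed.

End Meets.

(** * The nerve theorem *)

Section Weights.
Variables (R : realType) (I : finType).
Implicit Types (f : I -> R) (B : {set I}).

(** For [f >= 0], this is positive exactly on the upper level sets of [f] made of
   indices where [f] is positive. *)
Definition weight f B : R :=
  \prod_(b in B) (f b * \prod_(b' in ~: B) Num.max 0 (f b - f b')).

Lemma weight_ge0 f B : (forall i, 0 <= f i) -> 0 <= weight f B.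
Proof.
move=> f0; apply: prodr_ge0 => b _; rewrite mulr_ge0 // prodr_ge0 // => b' _.
by rewrite le_max lexx.
Qed.

Lemma weight_neq0 f B : weight f B != 0 ->
  {in B, forall b, f b != 0} /\ {in B & ~: B, forall b b', f b' < f b}.
Proof.
move=> w0; split=> [b bB|b b' bB b'B].
  by apply: contraNneq w0 => fb; rewrite /weight (bigD1 b) //= fb !mul0r.
rewrite ltNge; apply: contraNN w0 => fbb'.
rewrite /weight (bigD1 b) //= (bigD1 b') //=.
by rewrite (max_idPl _) ?subr_le0 // mul0r mulr0 mul0r.
Qed.

Lemma weight_support f : (forall i, 0 <= f i) -> weight f [set i | f i != 0] != 0.
Proof.
move=> f0; apply/prodf_neq0 => b; rewrite inE => fb; rewrite mulf_neq0 //.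
apply/prodf_neq0 => b'; rewrite !inE negbK => /eqP ->.
by rewrite subr0 (max_idPr _).
Qed.

(** Upper level sets of one function are nested. *)
Lemma weight_chain f B B' : weight f B != 0 -> weight f B' != 0 ->
  B \subset B' \/ B' \subset B.
Proof.
move=> /weight_neq0[_ wB] /weight_neq0[_ wB'].
have [BB'|/subsetPn[b bB bB']] := boolP (B \subset B'); first by left.
right; apply/fintype.subsetP => b' b'B'; apply/negPn/negP => b'B.
have := wB b b' bB; rewrite inE => /(_ b'B) lt1.
have := wB' b' b b'B'; rewrite inE => /(_ bB') lt2.
by have := lt_trans lt1 lt2; rewrite ltxx.
Qed.

Lemma weight_continuous (X : topologicalType) (g : X -> I -> R) B :
  (forall i, continuous (g^~ i)) -> continuous (fun x => weight (g x) B).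
Proof.
move=> gc; apply: continuous_big => [|b _]; first exact: mul_continuous.
have pc : continuous (fun x => \prod_(b' in ~: B) Num.max 0 (g x b - g x b')).
  apply: continuous_big => [|b' _]; first exact: mul_continuous.
  move=> x; have h : {for x, continuous ((fun=> 0 : R^o) \max (fun x => g x b - g x b' : R^o))}.
    apply: continuous_max; first exact: cst_continuous.
    by apply: (@cvgB _ _ _ _ _ (g^~ b) (g^~ b')); exact: gc.
  exact: h.
by move=> x; apply: (@cvgM _ _ _ _ (g^~ b)); [exact: gc|exact: pc].
Qed.
End Weights.

Section NerveTheorem.
Variables (R : realType) (T : finType) (dist : T -> T -> R).
Variables (le : rel T) (ole : total_order le).
Implicit Types (S : {set {set T}}) (s t : {set T}) (p q : Nop_R R).
Local Notation maxs := (max_simplices dist).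
Local Notation pairs := ({set T} * {set T})%type.

Lemma maxs_rips r s : s \in maxs r -> s \in rips dist r.
Proof. by rewrite inE => /andP[]. Qed.

Lemma rips_sub r s t : s \in rips dist r -> t \subset s -> t != finset.set0 ->
  t \in rips dist r.
Proof.
move=> /ripsP[_ sr] /fintype.subsetP ts t0; apply/ripsP.
by split=> // x y /ts xs /ts ys; exact: sr.
Qed.

Lemma index_gt0 p : (0 < val p.1)%N.
Proof. exact: (valP p.1). Qed.

Lemma nerve_facesP p S :
  (S \in nerve_faces dist p) =
  [&& S != finset.set0, S \subset maxs (val p.2) & (val p.1 <= #|meet S|)%N].
Proof.
rewrite inE; have [//|S0 /=] := boolP (S == finset.set0).
by rewrite meet_subdiv // index_gt0.
Qed.

(** The intermediary between flags and the nerve: every flag is such a family,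
   the structure maps are still inclusions, and being a face only depends on
   the intersection, as in the nerve. *)
Definition family_faces p : {set {set {set T}}} :=
  [set S : {set {set T}} | [&& S != finset.set0, S \subset rips dist (val p.2) &
                               (val p.1 <= #|meet S|)%N]].

Lemma family_complex p : complex_in (family_faces p).
Proof.
split=> [|S S' ]; first by rewrite inE eqxx.
rewrite !inE => /and3P[_ Sr kS] S'S ->.
rewrite (fintype.subset_trans S'S Sr) /=.
exact: leq_trans kS (subset_leq_card (meet_anti S'S)).
Qed.

Lemma family_mono p q S : tle p q -> S \in family_faces p ->
  [set s | s in S] \in family_faces q.
Proof.
move=> [pq1 pq2]; rewrite imset_id !inE => /and3P[-> Sr kS] /=.
by rewrite (fintype.subset_trans Sr (rips_mono dist pq2)) (leq_trans pq1 kS).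
Qed.

Definition family_fun : functor (Nop_R R) Simp :=
  @system_functor (Nop_R R) _ family_faces (fun _ _ s => s) family_complex
    family_mono (fun _ _ _ => erefl) (fun _ _ _ _ _ _ _ => erefl).

(** When the scale grows, simplices stay and maximal simplices move; keeping
   one of each in a pair makes both projections natural. *)
Definition pair_faces p : {set {set pairs}} :=
  [set Q : {set pairs} | [&& Q != finset.set0,
     [forall x in Q, (x.1 \subset x.2) && (x.2 \in maxs (val p.2))] &
     (val p.1 <= #|meet (fst @: Q)|)%N]].

Lemma pair_facesP p (Q : {set pairs}) :
  reflect [/\ Q != finset.set0,
    forall x, x \in Q -> x.1 \subset x.2 /\ x.2 \in maxs (val p.2) &
    (val p.1 <= #|meet (fst @: Q)|)%N] (Q \in pair_faces p).
Proof.
rewrite inE; apply: (iffP and3P) => -[Q0 Qm kQ]; split=> //.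
  by move=> x xQ; apply/andP; exact: (forall_inP Qm).
by apply/forall_inP => x xQ; apply/andP; exact: Qm.
Qed.

Lemma pair_complex p : complex_in (pair_faces p).
Proof.
split=> [|Q Q' /pair_facesP[_ Qm kQ] Q'Q Q'0]; first by rewrite inE eqxx.
apply/pair_facesP; split=> // [x /(fintype.subsetP Q'Q)|]; first exact: Qm.
exact: leq_trans kQ (subset_leq_card (meet_anti (imsetS fst Q'Q))).
Qed.

Definition pair_map p q (x : pairs) : pairs :=
  (x.1, nerve_map dist le (val p.2) (val q.2) x.2).

Lemma fst_pair_map p q (Q : {set pairs}) : fst @: (pair_map p q @: Q) = fst @: Q.
Proof. by rewrite -imset_comp; apply: eq_imset. Qed.

Lemma pair_mono p q (Q : {set pairs}) : tle p q -> Q \in pair_faces p ->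
  pair_map p q @: Q \in pair_faces q.
Proof.
move=> [pq1 pq2] /pair_facesP[Q0 Qm kQ]; apply/pair_facesP; split.
- by rewrite imset_eq0.
- move=> _ /imsetP[x /Qm[x12 x2] ->] /=.
  have [x2' sub] := nerve_map_max ole pq2 x2; split=> //.
  exact: fintype.subset_trans sub.
- by rewrite fst_pair_map (leq_trans pq1).
Qed.

Lemma pair_id p (x : pairs) : [set x] \in pair_faces p -> pair_map p p x = x.
Proof. by case: x => s t _; rewrite /pair_map /nerve_map scales_between_refl. Qed.

Lemma pair_comp p q r (x : pairs) : tle p q -> tle q r -> [set x] \in pair_faces p ->
  pair_map p r x = pair_map q r (pair_map p q x).
Proof.
by move=> [_ pq] [_ qr] _; rewrite /pair_map /nerve_map (scales_between_cat _ pq qr) foldl_cat.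
Qed.

Definition pair_fun : functor (Nop_R R) Simp :=
  system_functor pair_complex pair_mono pair_id pair_comp.

Lemma fst_faces p (Q : {set pairs}) : Q \in pair_faces p -> fst @: Q \in family_faces p.
Proof.
move=> /pair_facesP[Q0 Qm kQ]; rewrite inE imset_eq0 Q0 kQ andbT /=.
apply/fintype.subsetP => _ /imsetP[x xQ ->]; have [x12 x2] := Qm x xQ.
apply: rips_sub (maxs_rips x2) x12 _; rewrite -card_gt0.
apply: leq_trans (index_gt0 p) (leq_trans kQ (subset_leq_card _)).
by apply: meet_sub; exact: imset_f.
Qed.

Lemma snd_faces p (Q : {set pairs}) : Q \in pair_faces p -> snd @: Q \in nerve_faces dist p.
Proof.
move=> /pair_facesP[Q0 Qm kQ]; rewrite nerve_facesP imset_eq0 Q0 /=; apply/andP; split.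
  by apply/fintype.subsetP => _ /imsetP[x /Qm[_ x2] ->].
apply: leq_trans kQ (subset_leq_card _); apply: sub_meet => _ /imsetP[x xQ ->].
have [x12 _] := Qm x xQ; apply: fintype.subset_trans x12.
by apply: meet_sub; exact: imset_f.
Qed.

Definition cover r (s : {set T}) : {set T} :=
  odflt s [pick t in maxs r | s \subset t].

Lemma coverP r s : s \in rips dist r -> cover r s \in maxs r /\ s \subset cover r s.
Proof.
move=> /max_simplices_sup[t tm st]; rewrite /cover; case: pickP => [u /andP[]//|].
by move/(_ t); rewrite tm st.
Qed.

(** The inverse pairs every simplex with a chosen maximal simplex above it. The
   choice need not be compatible with the structure maps, as a homotopy inverse
   is only wanted at each index. *)
Lemma fst_equivalence p :
  homotopy_equivalence R (fmor (realization_fun R)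
    (system_map (pair_complex p) (family_complex p) (@fst_faces p))).
Proof.
pose psi (s : {set T}) : pairs := (s, cover (val p.2) s).
have fst_psi S : fst @: (psi @: S) = S.
  by rewrite -imset_comp -[RHS]imset_id; apply: eq_imset.
have psiA S : S \in family_faces p -> psi @: S \in pair_faces p.
  rewrite inE => /and3P[S0 Sr kS]; apply/pair_facesP; split.
  - by rewrite imset_eq0.
  - move=> _ /imsetP[s /(fintype.subsetP Sr)/coverP[sm sub] ->] //.
  - by rewrite fst_psi.
apply: (@system_homotopy_equivalence R _ _ _ _ _ _ _ psi _ psiA) => [Q QP|S SF].
  have /pair_facesP[Q0' Qm' _] := psiA _ (fst_faces QP).
  have /pair_facesP[Q0 Qm kQ] := QP; apply/pair_facesP; split.
  - by rewrite setU_eq0 negb_and Q0 orbT.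
  - by move=> x; rewrite inE => /orP[/Qm'|/Qm].
  - by rewrite imsetU fst_psi setUid.
by rewrite fst_psi setUid.
Qed.

(** The inverse pairs every maximal simplex with itself, which leaves the
   intersection of a family unchanged. *)
Lemma snd_equivalence p (cN : complex_in (nerve_faces dist p)) :
  homotopy_equivalence R (fmor (realization_fun R)
    (system_map (pair_complex p) cN (@snd_faces p))).
Proof.
pose psi s : pairs := (s, s).
have snd_psi S : snd @: (psi @: S) = S.
  by rewrite -imset_comp -[RHS]imset_id; apply: eq_imset.
have fst_psi S : fst @: (psi @: S) = S.
  by rewrite -imset_comp -[RHS]imset_id; apply: eq_imset.
have psiA S : S \in nerve_faces dist p -> psi @: S \in pair_faces p.
  rewrite nerve_facesP => /and3P[S0 Sm kS]; apply/pair_facesP; split.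
  - by rewrite imset_eq0.
  - by move=> _ /imsetP[s /(fintype.subsetP Sm) sm ->].
  - by rewrite fst_psi.
apply: (@system_homotopy_equivalence R _ _ _ _ _ _ _ psi _ psiA) => [Q QP|S SF].
  have /pair_facesP[Q0' Qm' _] := psiA _ (snd_faces QP).
  have /pair_facesP[Q0 Qm kQ] := QP; apply/pair_facesP; split.
  - by rewrite setU_eq0 negb_and Q0 orbT.
  - by move=> x; rewrite inE => /orP[/Qm'|/Qm].
  - apply: leq_trans kQ (subset_leq_card _); rewrite imsetU fst_psi.
    apply: sub_meet => s; rewrite inE => /orP[/imsetP[x xQ ->]|/meet_sub //].
    have [x12 _] := Qm x xQ; apply: fintype.subset_trans x12.
    by apply: meet_sub; exact: imset_f.
by rewrite snd_psi setUid.
Qed.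

Lemma SR_facesP p S : (S \in SR_faces dist p) =
  [&& is_flag S, S \subset rips dist (val p.2) & [forall s in S, (val p.1 <= #|s|)%N]].
Proof.
apply/subdivP/and3P => -[fS rS kS]; split=> //; first exact/forall_inP.
by move=> s; exact: (forall_inP kS).
Qed.

Lemma flag_families p S : S \in SR_faces dist p -> id @: S \in family_faces p.
Proof.
rewrite SR_facesP imset_id inE => /and3P[fS -> /forall_inP kS] /=.
by rewrite kS ?meet_chain // andbT; have /is_flagP[] := fS.
Qed.

Section FlagInverse.
Variables (p : Nop_R R) (cS : complex_in (SR_faces dist p)).
Local Notation L := (complex_of cS).
Local Notation L' := (complex_of (family_complex p)).

(** The coordinates, before normalization, of the image of [t]: every level set
   of the coordinates of [t] contributes its weight to its intersection. *)
Definition level_meets (t : realization R L') (v : vtx L) : R :=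
  \sum_(B : {set vtx L'} | (B != finset.set0) && (meet (val @: B) == val v))
    weight (val t) B.

Lemma coordinate_ge0 (M : simplicial_complex) (t : realization R M) v : 0 <= val t v.
Proof. by have [] := realizationP t. Qed.

Lemma level_meets_ge0 (t : realization R L') v : 0 <= level_meets t v.
Proof.
by apply: sumr_ge0 => B _; apply: weight_ge0 => w; exact: coordinate_ge0.
Qed.

Lemma level_meets_continuous v : continuous (level_meets^~ v).
Proof.
apply: continuous_big => [|B _]; first exact: add_continuous.
by apply: (weight_continuous (g := fun t : realization R L' => val t));
  exact: coordinate_continuous.
Qed.

Lemma level_meets_neq0 (t : realization R L') v : level_meets t v != 0 -> exists B : {set vtx L'},
  [/\ B != finset.set0, B \subset carrier t, weight (val t) B != 0 &
      meet (val @: B) = val v].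
Proof.
move=> n0; apply: contrapT => nB; case/negP: n0; apply/eqP.
apply: big1 => B /andP[B0 /eqP Bv]; apply/eqP/negPn/negP => wB; apply: nB.
exists B; split=> //; apply/fintype.subsetP => b bB; rewrite inE.
by have [+ _] := weight_neq0 wB; exact.
Qed.

Lemma flag_vertex (v : vtx L) :
  val v \in rips dist (val p.2) /\ (val p.1 <= #|val v|)%N.
Proof.
have := valP v; rewrite SR_facesP sub1set => /and3P[_ vr /forall_inP/(_ (val v))].
by rewrite inE eqxx => /(_ isT).
Qed.

Lemma meet_vertex (B : {set vtx L'}) : B \in faces L' ->
  exists v : vtx L, val v = meet (val @: B).
Proof.
rewrite inE inE => /and3P[B0 Br kB]; suff vS : [set meet (val @: B)] \in SR_faces dist p.
  by exists (exist (fun s => is_true ([set s] \in SR_faces dist p)) _ vS).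
rewrite SR_facesP; apply/and3P; split.
- apply/is_flagP; split=> [|s t /set1P -> /set1P ->]; last by left.
  by apply/set0Pn; exists (meet (val @: B)); rewrite inE.
- rewrite sub1set; have /set0Pn[s sB] := B0.
  apply: rips_sub (fintype.subsetP Br s sB) (meet_sub sB) _.
  by rewrite -card_gt0 (leq_trans (index_gt0 p)).
- by apply/forall_inP => s /set1P ->.
Qed.

Lemma level_meets_face (t : realization R L') : [set v | level_meets t v != 0] \in faces L.
Proof.
rewrite inE SR_facesP; apply/and3P; split.
- apply/is_flagP; split.
    have [v vE] := meet_vertex (carrier_face t).
    rewrite imset_eq0; apply/set0Pn; exists v; rewrite inE.
    rewrite psumr_neq0 => [|B _]; last by apply: weight_ge0 => w; exact: coordinate_ge0.
    apply/hasP; exists (carrier t); first exact: mem_index_enum.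
    rewrite vE eqxx andbT lt0r weight_support; last by move=> w; exact: coordinate_ge0.
    rewrite weight_ge0 => [|w]; last exact: coordinate_ge0.
    by rewrite !andbT; apply: contraNneq (face_neq0 L') => <-; exact: carrier_face.
  move=> _ _ /imsetP[v + ->] /imsetP[w + ->]; rewrite !inE.
  move=> /level_meets_neq0[B [_ _ wB <-]] /level_meets_neq0[B' [_ _ wB' <-]].
  have [BB|BB] := weight_chain wB wB'; [right|left]; exact/meet_anti/imsetS.
- by apply/fintype.subsetP => _ /imsetP[v _ ->]; have [] := flag_vertex v.
- by apply/forall_inP => _ /imsetP[v _ ->]; have [] := flag_vertex v.
Qed.

(** Both composites move a point inside the span of its carrier and of the
   intersections of parts of its carrier. For a flag these intersections belong
   to the flag; for a family they contain the intersection of the family. *)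
Lemma flag_equivalence :
  homotopy_equivalence R (fmor (realization_fun R)
    (system_map cS (family_complex p) (@flag_families p))).
Proof.
set f := system_map _ _ _.
pose g := normalize level_meets_ge0 level_meets_face.
apply: (@carried_homotopy_equivalence R _ _ _ g).
- exact: (@normalize_continuous R _ _ _ level_meets_ge0 (@level_meets_continuous)
    level_meets_face).
- move=> t; rewrite carrier_normalize.
  suff /setUidPr -> : [set v | level_meets (realization_map f t) v != 0] \subset carrier t.
    exact: carrier_face.
  apply/fintype.subsetP => v; rewrite inE => /level_meets_neq0[B [B0 + _ Bv]].
  rewrite carrier_map => Bt.
  have tF := carrier_face t; move: (tF); rewrite inE SR_facesP => /and3P[fl _ _].
  have sub : val @: B \subset val @: carrier t.
    by apply: fintype.subset_trans (imsetS val Bt) _; rewrite val_system_map imset_id.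
  have : val v \in val @: carrier t.
    apply: (fintype.subsetP sub); rewrite -Bv; apply: meet_chain; apply/is_flagP.
    have [_ ch] := is_flagP _ fl; split; first by rewrite imset_eq0.
    by move=> s s' /(fintype.subsetP sub) ss /(fintype.subsetP sub) ss'; exact: ch.
  by case/imsetP => w wt /val_inj ->.
- move=> u; rewrite carrier_map carrier_normalize inE imsetU val_system_map imset_id.
  have := carrier_face u; rewrite inE !inE => /and3P[C0 Cr kC].
  rewrite setU_eq0 negb_and C0 orbT /= subUset Cr andbT; apply/andP; split.
    by apply/fintype.subsetP => _ /imsetP[v _ ->]; have [] := flag_vertex v.
  apply: leq_trans kC (subset_leq_card _); apply: sub_meet => s.
  rewrite inE => /orP[/imsetP[v + ->]|/meet_sub //].
  rewrite inE => /level_meets_neq0[B [_ Bu _ <-]].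
  exact/meet_anti/imsetS.
Qed.
End FlagInverse.

(** The zigzag is formed by the inclusion of flags into families and the two
   projections of pairs, to families and to the nerve. *)
Theorem nerve_model : simplicial_model (nerve_SR dist ole) (realize (SR dist)).
Proof.
have SR_fam : weakly_equivalent R (realize (SR dist)) (realize family_fun).
  suff H cA fA f_id f_comp : weakly_equivalent R
      (realize (@system_functor (Nop_R R) _ (SR_faces dist) (fun _ _ s => s)
         cA fA f_id f_comp)) (realize family_fun) by exact: H.
  pose eta := @system_trans (Nop_R R) _ _ (SR_faces dist) (fun _ _ s => s) family_faces
    (fun _ _ s => s) cA fA f_id f_comp family_complex family_mono
    (fun _ _ _ => erefl) (fun _ _ _ _ _ _ _ => erefl) id flag_families
    (fun _ _ _ _ _ => erefl).
  by apply: (realize_equivalent (eta := eta)) => p; exact: flag_equivalence.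
have pair_fam : weakly_equivalent R (realize pair_fun) (realize family_fun).
  pose eta := @system_trans (Nop_R R) _ _ pair_faces pair_map family_faces
    (fun _ _ s => s) pair_complex pair_mono pair_id pair_comp family_complex family_mono
    (fun _ _ _ => erefl) (fun _ _ _ _ _ _ _ => erefl) fst fst_faces
    (fun _ _ _ _ _ => erefl).
  by apply: (realize_equivalent (eta := eta)) => p; exact: fst_equivalence.
have pair_nerve : weakly_equivalent R (realize pair_fun) (realize (nerve_SR dist ole)).
  suff H cA fA f_id f_comp : weakly_equivalent R (realize pair_fun)
      (realize (@system_functor (Nop_R R) _ (nerve_faces dist)
         (fun a b => nerve_map dist le (val a.2) (val b.2)) cA fA f_id f_comp)).
    exact: H.
  pose eta := @system_trans (Nop_R R) _ _ pair_faces pair_map (nerve_faces dist)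
    (fun a b => nerve_map dist le (val a.2) (val b.2)) pair_complex pair_mono pair_id
    pair_comp cA fA f_id f_comp snd snd_faces (fun _ _ _ _ _ => erefl).
  by apply: (realize_equivalent (eta := eta)) => p; exact: snd_equivalence.
apply: rst_trans (rst_sym _ _ _ _ pair_nerve) _.
exact: rst_trans pair_fam (rst_sym _ _ _ _ SR_fam).
Qed.
End NerveTheorem.

(** * Natural maps and retracts of complexes *)

Section NaturalMaps.
Variables (K : fieldType) (P : thin).
Implicit Types M N Q : pmod K P.

Definition natural_map M N (f : forall x, fiber M x -> fiber N x)
    (lf : forall x, linear (f x))
    (nf : forall x y (h : tle x y) v, transit N h (f x v) = f y (transit M h v)) :
  nat_trans M N.
Proof.
refine (@NatTrans P (Vec K) M N (fun x => mklin (lf x)) _).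
by move=> x y h; apply: lin_ext => v; exact: nf.
Defined.

Lemma pmap_transit M N (f : nat_trans M N) x y (h : tle x y) v :
  transit N h (pmap f x v) = pmap f y (transit M h v).
Proof. by have /(congr1 (fun k : {linear _ -> _} => k v)) := natural f h. Qed.

Lemma transit_id M x (h : tle x x) v : transit M h v = v.
Proof.
by rewrite /transit (_ : h = tle_refl x) ?(fmor_id M) //; exact: Prop_irrelevance.
Qed.

Lemma transit_comp M x y z (h1 : tle x y) (h2 : tle y z) (h : tle x z) v :
  transit M h2 (transit M h1 v) = transit M h v.
Proof.
rewrite (_ : h = tle_trans h2 h1); last exact: Prop_irrelevance.
by rewrite /transit (fmor_comp M h2 h1).
Qed.

Definition comp_map M N Q (f : nat_trans N Q) (g : nat_trans M N) : nat_trans M Q.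
Proof.
refine (@natural_map M Q (fun x v => pmap f x (pmap g x v)) _ _).
- by move=> x a u v; rewrite !linearP.
- by move=> x y h v; rewrite !pmap_transit.
Defined.

Definition zero_map M N : nat_trans M N.
Proof.
refine (@natural_map M N (fun x v => 0) _ _).
- by move=> x a u v; rewrite scaler0 addr0.
- by move=> x y h v; rewrite linear0.
Defined.

Lemma pmap_comp M N Q (f : nat_trans N Q) (g : nat_trans M N) x v :
  pmap (comp_map f g) x v = pmap f x (pmap g x v).
Proof. by []. Qed.

Lemma pmap_zero M N x v : pmap (zero_map M N) x v = 0.
Proof. by []. Qed.

Lemma pmapZ M N (f : nat_trans M N) x a v :
  pmap f x (a *: v) = a *: pmap f x v.
Proof. exact: linearZ. Qed.

Lemma pmapB M N (f : nat_trans M N) x u v :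
  pmap f x (u - v) = pmap f x u - pmap f x v.
Proof. exact: linearB. Qed.

Lemma transitZ M x y (h : tle x y) a v : transit M h (a *: v) = a *: transit M h v.
Proof. exact: linearZ. Qed.

Lemma transitB M x y (h : tle x y) u v :
  transit M h (u - v) = transit M h u - transit M h v.
Proof. exact: linearB. Qed.

Lemma inverse_map M N (f : nat_trans M N) :
  (forall x v, pmap f x v = 0 -> v = 0) ->
  (forall x w, exists v, pmap f x v = w) ->
  exists g : nat_trans N M,
    forall x, cancel (pmap f x) (pmap g x) /\ cancel (pmap g x) (pmap f x).
Proof.
move=> finj fsurj.
have fI x u v : pmap f x u = pmap f x v -> u = v.
  by move=> uv; apply/eqP; rewrite -subr_eq0; apply/eqP/(finj x);
    rewrite linearB /= uv subrr.
pose g x w := projT1 (cid (fsurj x w)).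
have gK x w : pmap f x (g x w) = w by rewrite /g; case: cid.
have lg x : linear (g x).
  by move=> a u v; apply: (fI x); rewrite linearP /= !gK.
have ng x y (h : tle x y) v : transit M h (g x v) = g y (transit N h v).
  by apply: (fI y); rewrite -pmap_transit !gK.
exists (natural_map lg ng) => x; split=> [v|w]; last exact: gK.
by apply: (fI x); rewrite [LHS]gK.
Qed.

Lemma kernel_closed M N (f : nat_trans M N) x :
  submod_closed (fun v => `[< pmap f x v = 0 >]).
Proof.
split=> [|a u v /asboolP u0 /asboolP v0]; apply/asboolP; first exact: linear0.
by rewrite linearP /= u0 v0 scaler0 addr0.
Qed.

Lemma kernel_transit M N (f : nat_trans M N) x y (h : tle x y) (v : fiber M x) :
  pmap f x v = 0 -> pmap f y (transit M h v) = 0.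
Proof. by move=> v0; rewrite -pmap_transit v0 linear0. Qed.

Definition kernel M N (f : nat_trans M N) : pmod K P.
Proof.
refine (@Functor P (Vec K) (fun x => sub_lmod (kernel_closed f x))
  (fun x y h => Defs.sub_map (f := transit M h) (kernel_closed f x)
     (kernel_closed f y) (@kernel_transit M N f x y h)) _ _).
- by move=> x; apply: lin_ext => c; apply: val_inj; exact: transit_id.
- move=> x y z h1 h2; apply: lin_ext => c; apply: val_inj.
  by rewrite /= (transit_comp _ _ (tle_trans h1 h2)).
Defined.

Lemma kernelP M N (f : nat_trans M N) x (v : fiber (kernel f) x) :
  pmap f x (val v) = 0.
Proof. exact: (asboolW (valP v)). Qed.

Definition to_kernel M N (f : nat_trans M N) x v (v0 : pmap f x v = 0) :
  fiber (kernel f) x := @SubspaceElt K _ _ (kernel_closed f x) v (asboolT v0).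

Definition kernel_map M N M' N' (f : nat_trans M N) (f' : nat_trans M' N')
    (a : nat_trans M M')
    (h : forall x v, pmap f x v = 0 -> pmap f' x (pmap a x v) = 0) :
  nat_trans (kernel f) (kernel f').
Proof.
refine (@natural_map (kernel f) (kernel f')
  (fun x v => to_kernel (h x _ (kernelP v))) _ _).
- by move=> x c u v; apply: val_inj; rewrite /= linearP.
- by move=> x y t v; apply: val_inj; rewrite /= pmap_transit.
Defined.
End NaturalMaps.

Section Retract.
Variables (K : fieldType) (P : thin).

(** [F'] is the direct sum of the image of [phi] and of the kernel of [psi], the
   projection to the former being [phi] after the inverse of the composite of
   [phi] and [psi] after [psi]. *)
Lemma complex_retract (F F' : chain_complex K P)
    (phi : forall i, nat_trans (F i) (F' i))
    (psi : forall i, nat_trans (F' i) (F i)) :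
  (forall i x v, pmap (cbd F' i) x (pmap (phi i.+1) x v) =
                 pmap (phi i) x (pmap (cbd F i) x v)) ->
  (forall i x v, pmap (cbd F i) x (pmap (psi i.+1) x v) =
                 pmap (psi i) x (pmap (cbd F' i) x v)) ->
  (forall i x v, pmap (psi i) x (pmap (phi i) x v) = 0 -> v = 0) ->
  (forall i x w, exists v, pmap (psi i) x (pmap (phi i) x v) = w) ->
  exists G, complex_iso F' (complex_sum F G).
Proof.
move=> cphi cpsi inj surj.
have inv i := @inverse_map K P _ _ (comp_map (psi i) (phi i)) (inj i) (surj i).
pose a i := projT1 (cid (inv i)).
have aK i x v : pmap (a i) x (pmap (psi i) x (pmap (phi i) x v)) = v.
  by rewrite /a; case: cid => /= g /(_ x) [+ _]; exact.
have Ka i x v : pmap (psi i) x (pmap (phi i) x (pmap (a i) x v)) = v.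
  by rewrite /a; case: cid => /= g /(_ x) [_]; exact.
have ca i x v : pmap (cbd F i) x (pmap (a i.+1) x v) =
                pmap (a i) x (pmap (cbd F i) x v).
  by rewrite -[LHS]aK -cphi -cpsi Ka.
have dker i x v : pmap (psi i.+1) x v = 0 ->
    pmap (psi i) x (pmap (cbd F' i) x v) = 0.
  by move=> v0; rewrite -cpsi v0 linear0.
have dd i x (v : fiber (kernel (psi i.+2)) x) :
    pmap (kernel_map (dker i)) x (pmap (kernel_map (dker i.+1)) x v) = 0.
  by apply: val_inj; exact: cbd_cbd.
pose G := ChainComplex dd.
exists G.
have pker i x u :
    pmap (psi i) x (u - pmap (phi i) x (pmap (a i) x (pmap (psi i) x u))) = 0.
  by rewrite linearB /= Ka subrr.
have lf i x : linear (fun u => (pmap (psi i) x u, to_kernel (pker i x u)) :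
    fiber (complex_sum F G i) x).
  move=> c u v; congr pair; first by rewrite linearP.
  apply: val_inj => /=; by rewrite !linearP /= addrACA -scalerDr.
have nf i x y (h : tle x y) u :
    transit (complex_sum F G i) h (pmap (psi i) x u, to_kernel (pker i x u)) =
    (pmap (psi i) y (transit (F' i) h u), to_kernel (pker i y (transit (F' i) h u)))
      :> fiber (complex_sum F G i) y.
  congr pair; first by rewrite /= pmap_transit.
  by apply: val_inj; rewrite /= linearB /= !pmap_transit.
have lg i x : linear (fun w : fiber (complex_sum F G i) x =>
    pmap (phi i) x (pmap (a i) x w.1) + val w.2 : fiber (F' i) x).
  by move=> c u v /=; rewrite !linearP /= scalerDr addrACA.
have ng i x y (h : tle x y) (w : fiber (complex_sum F G i) x) :
    transit (F' i) h (pmap (phi i) x (pmap (a i) x w.1) + val w.2) =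
    pmap (phi i) y (pmap (a i) y (transit (complex_sum F G i) h w).1) +
    val (transit (complex_sum F G i) h w).2.
  by rewrite linearD /= !pmap_transit.
exists (fun i => natural_map (lf i) (nf i)), (fun i => natural_map (lg i) (ng i)).
split=> [i x|i x v]; first split=> [v|w].
- by rewrite /pmap /= addrC subrK.
- case: w => w1 w2.
  have E : pmap (psi i) x (pmap (phi i) x (pmap (a i) x w1) + val w2) = w1.
    by rewrite linearD /= Ka kernelP addr0.
  congr pair; first exact: E.
  by apply: val_inj; rewrite /= E addrC addKr.
- congr pair; first by rewrite /= -cpsi.
  by apply: val_inj; rewrite /= linearB /= cphi ca cpsi.
Qed.
End Retract.

(** * Free persistence modules *)

Section FreeModules.
Variables (K : fieldType) (P : thin).
Implicit Types M N : pmod K P.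

Section Maps.
Variables (I : choiceType) (g : I -> P).
Local Notation F := (free_pmod K g).

Definition coef x (c : fiber F x) (i : I) : K := val c i.

Lemma coef_inj x (c c' : fiber F x) : coef c =1 coef c' -> c = c'.
Proof. by move=> cc; apply: val_inj; apply/funext. Qed.

Lemma coefP x (c : fiber F x) : free_set g x (val c).
Proof. exact: asboolW (valP c). Qed.

Lemma coef_le x (c : fiber F x) i : coef c i != 0 -> tle (g i) x.
Proof. by move: i; have [] := coefP c. Qed.

Lemma coef_fin x (c : fiber F x) : finite_set [set i | coef c i != 0]%classic.
Proof. by have [] := coefP c. Qed.

Lemma coefD x (c c' : fiber F x) i : coef (c + c') i = coef c i + coef c' i.
Proof. by []. Qed.
Lemma coefB x (c c' : fiber F x) i : coef (c - c') i = coef c i - coef c' i.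
Proof. by []. Qed.
Lemma coefZ x a (c : fiber F x) i : coef (a *: c) i = a * coef c i.
Proof. by []. Qed.
Lemma coef0 x i : coef (0 : fiber F x) i = 0.
Proof. by []. Qed.
Lemma coef_transit x y (h : tle x y) c i : coef (transit F h c) i = coef c i.
Proof. by []. Qed.

Lemma coef_sum x (J : Type) (r : seq J) (p : pred J) (c : J -> fiber F x) i :
  coef (\sum_(j <- r | p j) c j) i = \sum_(j <- r | p j) coef (c j) i.
Proof. by elim/big_rec2: _ => // j a b _ <-. Qed.

Lemma gen_subproof x i (h : tle (g i) x) :
  free_set g x ((fun j => (j == i)%:R) : I -> K^o).
Proof.
split=> [|j]; last by have [->|_] := eqVneq j i; rewrite ?eqxx.
apply: (sub_finite_set _ (finite_set1 i)) => j /=.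
by have [->|_] := eqVneq j i; rewrite ?eqxx.
Qed.

Definition gen x i (h : tle (g i) x) : fiber F x :=
  @SubspaceElt K _ _ (free_closed K g x) _ (asboolT (gen_subproof h)).

Lemma coef_gen x i (h : tle (g i) x) j : coef (gen h) j = (j == i)%:R.
Proof. by []. Qed.

Lemma transit_gen x y i (h : tle (g i) x) (h' : tle x y) (h'' : tle (g i) y) :
  transit F h' (gen h) = gen h''.
Proof. exact: coef_inj. Qed.

Section Extend.
Variables (N : pmod K P) (n : forall i, fiber N (g i)).

(** The value 0 where the generator [i] is not yet born is harmless, since the
   coefficient of [i] vanishes there. *)
Definition push_to x i : fiber N x :=
  match pselect (tle (g i) x) with left h => transit N h (n i) | right _ => 0 end.

Lemma push_toE x i (h : tle (g i) x) : push_to x i = transit N h (n i).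
Proof.
rewrite /push_to; case: pselect => // h'.
by rewrite (_ : h = h') //; exact: Prop_irrelevance.
Qed.

Definition extend x (c : fiber F x) : fiber N x :=
  \sum_(i \in [set i | coef c i != 0]%classic) coef c i *: push_to x i.

Lemma extendE x (c : fiber F x) (A : set I) :
  ([set i | coef c i != 0] `<=` A)%classic ->
  extend c = \sum_(i \in A) coef c i *: push_to x i.
Proof.
move=> cA; apply: fsbig_widen => // i [_ /= /negP]; rewrite negbK => /eqP ->.
by rewrite scale0r.
Qed.

Lemma extend_linear x : linear (@extend x).
Proof.
move=> a c c'; pose A := ([set i | coef c i != 0] `|` [set i | coef c' i != 0])%classic.
have fA : finite_set A by rewrite finite_setU; split; exact: coef_fin.
rewrite !(@extendE _ _ A); [|by move=> i; right|by move=> i; left|]; last first.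
  move=> i /=; rewrite coefD coefZ; have [->|] := eqVneq (coef c i) 0.
    by rewrite mulr0 add0r; right.
  by move=> ? _; left.
rewrite !fsbig_finite //= scaler_sumr -big_split; apply: eq_bigr => i _ /=.
by rewrite coefD coefZ scalerDl scalerA.
Qed.

Lemma extend_natural x y (h : tle x y) c :
  transit N h (extend c) = extend (transit F h c).
Proof.
rewrite /extend !fsbig_finite; [|exact: coef_fin..].
rewrite linear_sum; apply: eq_big_seq => i.
rewrite in_fset_set; last exact: coef_fin.
move=> /set_mem /coef_le ix; rewrite linearZ /= (push_toE ix).
by rewrite (push_toE (tle_trans h ix)) (transit_comp _ _ (tle_trans h ix)).
Qed.

Definition free_map : nat_trans F N := natural_map extend_linear extend_natural.

Lemma free_map_gen x i (h : tle (g i) x) :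
  pmap free_map x (gen h) = transit N h (n i).
Proof.
rewrite [LHS](@extendE _ _ [set i]%classic) => [|j /=]; last first.
  by rewrite coef_gen; have [->|_] := eqVneq j i; rewrite ?eqxx.
by rewrite fsbig_set1 coef_gen eqxx scale1r (push_toE h).
Qed.
End Extend.

(** An element is the finite combination of the generators in its support. *)
Lemma free_span x (N : set (fiber F x)) (v : fiber F x) :
  submod_closed (fun v => `[< N v >]) ->
  (forall i (h : tle (g i) x), coef v i != 0 -> N (gen h)) -> N v.
Proof.
move=> [/asboolW N0 Nlin] Ngen.
have N1 a u : N u -> N (a *: u).
  by move=> Nu; rewrite -[_ *: u]addr0;
    exact: asboolW (Nlin a u 0 (asboolT Nu) (asboolT N0)).
have N2 u w : N u -> N w -> N (u + w).
  by move=> Nu Nw; rewrite -[u]scale1r;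
    exact: asboolW (Nlin 1 u w (asboolT Nu) (asboolT Nw)).
pose t i := match pselect (tle (g i) x) with
            | left h => coef v i *: gen h | right _ => 0 end.
have tE i j : coef (t i) j = (j == i)%:R * coef v i.
  rewrite /t; case: pselect => h; first by rewrite coefZ coef_gen mulrC.
  rewrite coef0; have [->|] := eqVneq (coef v i) 0; first by rewrite mulr0.
  by move/coef_le.
have -> : v = \sum_(i <- fset_set [set i | coef v i != 0]%classic) t i.
  apply: coef_inj => j; rewrite coef_sum; under eq_bigr do rewrite tE.
  have [v0|vj] := eqVneq (coef v j) 0.
    rewrite v0 big1 // => i _; have [<-|_] := eqVneq j i; rewrite ?mul0r //.
    by rewrite v0 mulr0.
  rewrite (bigD1_seq j) ?fset_uniq //=; last first.
    by rewrite in_fset_set; [exact/mem_set|exact: coef_fin].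
  rewrite eqxx mul1r big1 ?addr0 // => i; rewrite eq_sym => /negbTE ->.
  by rewrite mul0r.
elim/big_ind: _ => [||i _]; [exact: N0|exact: N2|].
rewrite /t; case: pselect => h; last exact: N0.
have [->|vi] := eqVneq (coef v i) 0; first by rewrite scale0r.
exact/N1/Ngen.
Qed.

Lemma free_ind (N : forall x, set (fiber F x)) :
  submodule N -> (forall i, N (g i) (gen (tle_refl (g i)))) ->
  forall x v, N x v.
Proof.
move=> [Nc Nt] Ng x v; apply: free_span => // i h _.
by rewrite -(transit_gen (tle_refl (g i)) h); exact: Nt.
Qed.

Lemma free_map_ext N (a b : nat_trans F N) :
  (forall i, pmap a (g i) (gen (tle_refl _)) = pmap b (g i) (gen (tle_refl _))) ->
  forall x v, pmap a x v = pmap b x v.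
Proof.
move=> ab; apply: (@free_ind (fun x v => pmap a x v = pmap b x v)) => //.
split=> [x|x y h v vab]; last by rewrite -!pmap_transit vab.
split=> [|c u w /asboolP ua /asboolP wa]; apply/asboolP; first by rewrite !linear0.
by rewrite !linearP ua wa.
Qed.
End Maps.

Definition projective (F : pmod K P) : Prop :=
  forall M N (q : nat_trans M N) (f : nat_trans F N),
    (forall x v, exists m, pmap q x m = pmap f x v) ->
    exists h : nat_trans F M, forall x v, pmap q x (pmap h x v) = pmap f x v.

(** The images of the generators are lifted one by one. *)
Lemma free_projective F : free_module F -> projective F.
Proof.
move=> [I [g [a [b ab]]]] M N q f qf.
pose g' : {classic I} -> P := g.
pose e i := pmap b _ (@gen {classic I} g' _ i (tle_refl (g' i))).
pose n i := projT1 (cid (qf _ (e i))).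
pose h := free_map n : nat_trans (free_pmod K g') M.
have aK x v : pmap b x (pmap a x v) = v.
  by have /(congr1 (fun k : {linear _ -> _} => k v)) := proj1 (ab x).
have hq x v : pmap q x (pmap h x v) = pmap f x (pmap b x v).
  move: x v; apply: (@free_map_ext _ g' _ (comp_map q h) (comp_map f b)) => i.
  rewrite !pmap_comp /h free_map_gen transit_id /n; by case: cid.
by exists (comp_map h a) => x v; rewrite pmap_comp hq aK.
Qed.
End FreeModules.

(** * Minimal resolutions of length one *)

Section LengthOne.
Variables (K : fieldType) (P : thin).

Lemma free_generators n (g : 'I_n -> P) :
  exists2 S, minimal_generating_set (M := free_pmod K g) S & (S #= `I_n)%card.
Proof.
pose e i : {x : P & fiber (free_pmod K g) x} := existT _ (g i) (gen K (tle_refl (g i))).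
have e_inj : injective e.
  move=> i j eij.
  pose f (u : {x : P & fiber (free_pmod K g) x}) := coef (projT2 u) j.
  have : f (e i) = f (e j) by rewrite eij.
  rewrite /f /= !coef_gen eqxx; have [->//|_] := eqVneq j i.
  by move/esym/eqP; rewrite oner_eq0.
exists (range e).
  split=> [N Nsub Ne|S' S'e S'gen].
    by apply: free_ind => // i; apply: (Ne (e i)); exists i.
  apply/seteqP; split=> // _ [i _ <-]; apply: contrapT => nS.
  suff : coef (projT2 (e i)) i = 0 by rewrite coef_gen eqxx; exact/eqP/oner_neq0.
  apply: (S'gen (fun x v => coef v i = 0)).
    split=> // x; split=> [|c u v /asboolP u0 /asboolP v0]; apply/asboolP => //.
    by rewrite coefD coefZ u0 v0 mulr0 addr0.
  move=> u uS'; have [j _ ju] := S'e _ uS'; rewrite -ju coef_gen.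
  by have [ij|//] := eqVneq i j; case: nS; rewrite ij ju.
apply: card_eq_trans (_ : ([set: 'I_n] #= _)%card); last first.
  by rewrite card_eq_sym; exact: card_II.
by rewrite card_eq_sym; apply/card_esym/inj_card_eq => i j _ _; exact: e_inj.
Qed.

(** The map [a] is the identity up to generators of strictly smaller degree. A
   generator of largest degree in the support of [v] keeps its coefficient in
   the image of [v], whence injectivity; surjectivity is by induction on the
   degree of the generators to reach. *)
Lemma coef_strict n (g : 'I_n -> P) (a : nat_trans (free_pmod K g) (free_pmod K g)) :
  (forall i l, coef (pmap a (g i) (gen K (tle_refl (g i))) - gen K (tle_refl (g i))) l != 0 ->
     ~ tle (g i) (g l)) ->
  forall x,
  (forall v, pmap a x v = 0 -> v = 0) /\
  (forall w, exists v, pmap a x v = w).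
Proof.
move=> strict x.
(* the rank [rk] grows strictly with the degree *)
pose below i := [set l | `[< tle (g l) (g i) >]].
pose rk i := #|below i|.
have rk_lt i l : tle (g l) (g i) -> ~ tle (g i) (g l) -> (rk l < rk i)%N.
  move=> li nil; apply: proper_card; apply/properP; split.
    apply/fintype.subsetP => m; rewrite !inE => /asboolP ml.
    by apply/asboolP; exact: tle_trans li ml.
  by exists i; rewrite !inE; apply/asboolP; [exact: tle_refl|].
have strict' y i l (h : tle (g i) y) :
    coef (pmap a y (gen K h) - gen K h) l != 0 -> (rk l < rk i)%N.
  rewrite -(transit_gen K (tle_refl (g i)) h h) -pmap_transit -linearB coef_transit.
  move=> al; apply: rk_lt; last exact: strict al.
  exact: (coef_le al).
have aB c u w : pmap a x (c *: u + w) - (c *: u + w) =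
    c *: (pmap a x u - u) + (pmap a x w - w).
  by rewrite linearP /= scalerBr opprD addrACA.
split=> [v av|w].
  apply: contrapT => v0.
  have [i vi] : exists i, coef v i != 0.
    apply: contrapT => nv; apply: v0; apply: coef_inj => i; rewrite coef0.
    by apply/eqP/negPn/negP => vi; apply: nv; exists i.
  have [{vi}i vi imax] := @arg_maxnP _ i (fun l => coef v l != 0) rk vi.
  suff : coef (pmap a x v - v) i = 0.
    rewrite av sub0r -[- v]scaleN1r coefZ mulN1r => /eqP; rewrite oppr_eq0.
    by rewrite (negbTE vi).
  apply: (free_span (N := fun u => coef (pmap a x u - u) i = 0)).
    split=> [|c u w /asboolP u0 /asboolP w0]; apply/asboolP.
      by rewrite linear0 subrr.
    by rewrite aB coefD coefZ u0 w0 mulr0 addr0.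
  move=> l h vl; apply/eqP/negPn/negP => /strict'.
  by rewrite ltnNge; apply/negP; rewrite negbK; exact: imax.
pose N w := exists v, pmap a x v = w.
have Nc : submod_closed (fun v => `[< N v >]).
  split=> [|c _ _ /asboolP[u <-] /asboolP[w' <-]]; apply/asboolP.
    by exists 0; rewrite linear0.
  by exists (c *: u + w'); rewrite linearP.
suff Ngen m i (h : tle (g i) x) : (rk i < m)%N -> N (gen K h).
  by apply: (free_span Nc) => i h _; exact: (Ngen (rk i).+1).
elim: m i h => // m IH i h im.
have [/asboolW N0 Nlin] := Nc.
have N1 : N (pmap a x (gen K h) - gen K h).
  apply: free_span => // l h' /strict' li; apply: IH.
  exact: leq_trans li _.
rewrite -(subKr (pmap a x (gen K h)) (gen K h)) addrC -scaleN1r.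
apply: asboolW (Nlin (-1) _ _ (asboolT N1) _); apply/asboolP.
by exists (gen K h).
Qed.

Variables (M : pmod K P) (n0 n1 : nat) (g0 : 'I_n0 -> P) (g1 : 'I_n1 -> P).
Variables (d : nat_trans (free_pmod K g1) (free_pmod K g0))
          (eps : nat_trans (free_pmod K g0) M).
Hypothesis dcok : is_cokernel d eps.
Hypothesis dinj : forall x v, pmap d x v = 0 -> v = 0.
Hypothesis drad : forall j i,
  coef (pmap d (g1 j) (gen K (tle_refl (g1 j)))) i != 0 -> ~ tle (g1 j) (g0 i).

Lemma eps_surj x q : exists v, pmap eps x v = q.
Proof. exact: (proj1 (dcok x)). Qed.

Lemma eps_ker x v : pmap eps x v = 0 <-> exists w, pmap d x w = v.
Proof. exact: (proj2 (dcok x)). Qed.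

(** The hypothesis on the relations passes to their combinations and to larger
   degrees. *)
Lemma rad_image x w l : coef (pmap d x w) l != 0 -> ~ tle x (g0 l).
Proof.
move: x w l; apply: (@free_ind _ _ _ g1
  (fun x w => forall l, coef (pmap d x w) l != 0 -> ~ tle x (g0 l))).
  split=> [x|x y h v H l].
    split=> [|c u w /asboolP ul /asboolP wl]; apply/asboolP => l.
      by rewrite linear0 coef0 eqxx.
    rewrite linearP coefD coefZ; have [->|u0 _] := eqVneq (coef (pmap d x u) l) 0.
      by rewrite mulr0 add0r; exact: wl.
    exact: ul.
  by rewrite -pmap_transit coef_transit => /H xl yl; apply: xl; exact: tle_trans yl h.
exact: drad.
Qed.

Definition res_mod (i : nat) : pmod K P :=
  match i with
  | 0 => free_pmod K g0
  | 1 => free_pmod K g1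
  | _ => free_pmod K (fun i : 'I_0 => False_rect P (notF (ltn_ord i)))
  end.

Definition res_bd (i : nat) : nat_trans (res_mod i.+1) (res_mod i) :=
  match i with 0 => d | _ => zero_map _ _ end.

Lemma res_high i x (v : fiber (res_mod i.+2) x) : v = 0.
Proof. by apply: coef_inj => -[]. Qed.

Lemma res_bdK i x v : pmap (res_bd i) x (pmap (res_bd i.+1) x v) = 0.
Proof. by rewrite pmap_zero linear0. Qed.

Definition short_resolution : chain_complex K P := ChainComplex res_bdK.

Lemma short_resolution_free : free_resolution M short_resolution.
Proof.
have iso_refl (F : pmod K P) : isomorphic F F.
  pose i : nat_trans F F := natural_map (fun x => linearP idfun)
    (fun x y h v => erefl (transit F h v)).
  by exists i, i => x; split; exact: lin_ext.
split=> [[|[|i]]|[|i] x v|].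
- by exists 'I_n0, g0.
- by exists 'I_n1, g1.
- by exists 'I_0, (fun i : 'I_0 => False_rect P (notF (ltn_ord i))).
- by move/dinj ->; exists 0; rewrite linear0.
- by move=> _; exists 0; rewrite linear0 (res_high v).
- by exists eps.
Qed.

(** A free presentation [0 -> F1 -> F0 -> M -> 0] is a minimal resolution as
   soon as every relation is a combination of generators of strictly smaller
   degree: comparing it with another free resolution and coming back gives an
   endomorphism of [F0] equal to the identity up to terms of strictly smaller
   degree, hence an isomorphism; on [F1] it is then bijective because [d] is
   injective. *)
Lemma short_resolution_minimal : minimal_resolution M short_resolution.
Proof.
split; first exact: short_resolution_free.
move=> F' [F'free F'ex [eps' F'cok]].
have [sfree _ _] := short_resolution_free.
have ck x v : pmap eps' x (pmap (cbd F' 0) x v) = 0.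
  by apply/(proj2 (F'cok x)); exists v.
have [phi0 phi0E] : exists h : nat_trans (free_pmod K g0) (F' 0%N),
    forall x v, pmap eps' x (pmap h x v) = pmap eps x v.
  by apply: (free_projective (sfree 0%N)) => x v; exact: (proj1 (F'cok x)).
have [phi1 phi1E] : exists h : nat_trans (free_pmod K g1) (F' 1%N),
    forall x v, pmap (cbd F' 0) x (pmap h x v) = pmap (comp_map phi0 d) x v.
  apply: (free_projective (sfree 1%N)) => x v; apply/(proj2 (F'cok x)).
  by rewrite pmap_comp phi0E; apply/eps_ker; exists v.
have [psi0 psi0E] : exists h : nat_trans (F' 0%N) (free_pmod K g0),
    forall x v, pmap eps x (pmap h x v) = pmap eps' x v.
  by apply: (free_projective (F'free 0%N)) => x v; exact: eps_surj.
have [psi1 psi1E] : exists h : nat_trans (F' 1%N) (free_pmod K g1),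
    forall x v, pmap d x (pmap h x v) = pmap (comp_map psi0 (cbd F' 0)) x v.
  apply: (free_projective (F'free 1%N)) => x v; apply/eps_ker.
  by rewrite pmap_comp psi0E ck.
pose phi i : nat_trans (short_resolution i) (F' i) :=
  match i with 0 => phi0 | 1 => phi1 | _ => zero_map _ _ end.
pose psi i : nat_trans (F' i) (short_resolution i) :=
  match i with 0 => psi0 | 1 => psi1 | _ => zero_map _ _ end.
have epsE x v : pmap eps x (pmap psi0 x (pmap phi0 x v)) = pmap eps x v.
  by rewrite psi0E phi0E.
have bij0 := @coef_strict _ _ (comp_map psi0 phi0) _.
have {bij0} bij0 x : (forall v, pmap psi0 x (pmap phi0 x v) = 0 -> v = 0) /\
    (forall w, exists v, pmap psi0 x (pmap phi0 x v) = w).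
  apply: bij0 => i l; set u := _ - _ => ul.
  have [w wu] : exists w, pmap d (g0 i) w = u.
    by apply/eps_ker; rewrite /u linearB /= epsE subrr.
  by move: ul; rewrite -wu => /rad_image.
have dE x v : pmap d x (pmap psi1 x (pmap phi1 x v)) =
              pmap psi0 x (pmap phi0 x (pmap d x v)).
  by rewrite psi1E pmap_comp phi1E.
apply: (@complex_retract _ _ _ _ phi psi).
- case=> [|i] x v; first exact: phi1E.
  by rewrite (res_high v) !linear0.
- case=> [|[|i]] x v; first exact: psi1E; last by rewrite !(res_high (pmap _ _ _)).
  rewrite [LHS]pmap_zero; apply/esym/dinj; rewrite psi1E pmap_comp.
  by rewrite cbd_cbd linear0.
- case=> [|[|i]] x v; first exact: (proj1 (bij0 x)); last by rewrite (res_high v).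
  by move=> v0; apply/dinj/(proj1 (bij0 x)); rewrite -dE v0 linear0.
- case=> [|[|i]] x w; first exact: (proj2 (bij0 x)); last first.
    by exists 0; rewrite (res_high w) (res_high (pmap _ _ _)).
  have [u uE] := proj2 (bij0 x) (pmap d x w).
  have [v vE] : exists v, pmap d x v = u.
    by apply/eps_ker; rewrite -epsE uE; apply/eps_ker; exists w.
  exists v; apply/eqP; rewrite -subr_eq0; apply/eqP/dinj.
  by rewrite linearB /= dE vE uE subrr.
Qed.

Lemma short_betti0 : betti M 0 n0.
Proof.
exists short_resolution; first exact: short_resolution_minimal.
exact: free_generators.
Qed.

Lemma short_betti1 : betti M 1 n1.
Proof.
exists short_resolution; first exact: short_resolution_minimal.
exact: free_generators.
Qed.

Lemma short_presented : finitely_presented M.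
Proof. by exists n0, n1, g0, g1, d, eps. Qed.
End LengthOne.

(** * Labels and their roots *)

Section Roots.
Variables (T : finType) (m : nat) (B : nat -> {set T}).
Variables (y : nat -> T -> option T) (lev : T -> nat).
Hypothesis B0 : B 0 = finset.set0.
Hypothesis yB : forall i b b', (i < m)%N -> b \in B i -> y i b = Some b' ->
  b' \in B i.+1 /\ (lev b <= lev b')%N.

(** Among the labels that become [b] without a change of level, one is chosen;
   the others will be identified with it. *)
Definition parent i b : option T :=
  [pick b' in B i | (y i b' == Some b) && (lev b' == lev b)].

Variant parent_spec i b : option T -> Prop :=
  | Parent b' of b' \in B i & y i b' = Some b & lev b' = lev b :
      parent_spec i b (Some b')
  | NoParent of (forall b', b' \in B i -> y i b' = Some b -> lev b' <> lev b) :
      parent_spec i b None.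

Lemma parentP i b : parent_spec i b (parent i b).
Proof.
rewrite /parent; case: pickP => [b' /and3P[b'B /eqP yb /eqP lb]|nop].
  by constructor.
constructor=> b' b'B /eqP yb /eqP lb.
by have := nop b'; rewrite b'B yb lb.
Qed.

(** The oldest ancestor along parents, with its stage of birth: the generator
   that [b] comes from. *)
Fixpoint root i b : 'I_m.+1 * T :=
  match i with
  | 0 => (ord0, b)
  | i'.+1 => if parent i' b is Some b' then root i' b' else (inord i, b)
  end.

Lemma root_spec i b : (i <= m)%N -> b \in B i ->
  [/\ (0 < (root i b).1 <= i)%N, (root i b).2 \in B (root i b).1,
      lev (root i b).2 = lev b & root (root i b).1 (root i b).2 = root i b].
Proof.
elim: i b => [|i IH] b im bB; first by move: bB; rewrite B0 inE.
rewrite /=; case: parentP => [b' b'B yb lb|nop].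
  have [/andP[r0 ri] rB rl rr] := IH b' (ltnW im) b'B.
  by split; rewrite ?r0 ?(leqW ri) // rl.
by rewrite !inordK //=; split=> //; case: parentP => // b' b'B yb /nop; case.
Qed.

Lemma root_inj i : (i <= m)%N -> {in B i &, injective (root i)}.
Proof.
elim: i => [|i IH] im b1 b2; first by rewrite B0 inE.
move=> b1B b2B /=; case: parentP => [b1' b1'B yb1 lb1|nop1].
  case: parentP => [b2' b2'B yb2 lb2|nop2 e].
    by move/(IH (ltnW im) _ _ b1'B b2'B) => e; move: yb1; rewrite e yb2 => -[].
  have [/andP[_ +] _ _ _] := root_spec (ltnW im) b1'B.
  by rewrite e inordK // ltnn.
case: parentP => [b2' b2'B yb2 lb2 e|nop2 []//].
have [/andP[_ +] _ _ _] := root_spec (ltnW im) b2'B.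
by rewrite -e inordK // ltnn.
Qed.

(** The ancestor of [b'] at stage [i] has the root of [b], hence is [b] by
   injectivity, and the next ancestor of [b'] is what [b] becomes. *)
Lemma root_persist i j b b' : (i < j <= m)%N -> b \in B i -> b' \in B j ->
  root j b' = root i b -> exists2 b1, y i b = Some b1 & root i.+1 b1 = root i b.
Proof.
case/andP; elim: j b' => // j IH b' ij jm bB b'B rE.
move: (rE) => /=; case: parentP => [b'' b''B yb'' lb rE'|_ e]; last first.
  have [/andP[_ +] _ _ _] := root_spec (leq_trans (ltnW ij) jm) bB.
  by rewrite -e inordK // leqNgt ij.
move: ij; rewrite ltnS leq_eqVlt => /orP[/eqP ij|ij]; last first.
  exact: (IH b'' ij (ltnW jm) bB b''B rE').
subst j; have eb := root_inj (ltnW jm) b''B bB rE'.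
by exists b'; [rewrite -eb|].
Qed.
End Roots.

(** * The resolution of a module with labelled bases *)

Section LabelledModule.
Variables (R : realType) (K : fieldType) (M : pmod K (Nop_R R)).
Variables (T : finType) (m : nat) (B : nat -> {set T}).
Variables (y : nat -> T -> option T) (lev : T -> nat) (sg : nat -> T -> K).
Variables (c : nat -> {r : R | 0 <= r}) (st : Nop_R R -> nat).
Variables (e : forall p : Nop_R R, T -> fiber M p).
Variables (co : forall p : Nop_R R, fiber M p -> T -> K).

Definition live (p : Nop_R R) (b : T) : bool :=
  (b \in B (st p)) && (val p.1 <= lev b)%N.

Hypothesis st_le : forall p, (st p <= m)%N.
Hypothesis st_scale : forall i p, (0 < i <= m)%N ->
  (i <= st p)%N = (val (c i) <= val p.2).
Hypothesis st_at : forall i k, (0 < i <= m)%N -> st (k, c i) = i.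
Hypothesis B0 : B 0 = finset.set0.
Hypothesis yB : forall i b b', (i < m)%N -> b \in B i -> y i b = Some b' ->
  b' \in B i.+1 /\ (lev b <= lev b')%N.
Hypothesis lev_gt0 : forall i b, b \in B i -> (0 < lev b)%N.
Hypothesis sg_neq0 : forall i b, sg i b != 0.
Hypothesis co_sum : forall p v, v = \sum_(b | live p b) co v b *: e p b.
Hypothesis co_e : forall p b b', live p b -> live p b' -> co (e p b) b' = (b == b')%:R.
Hypothesis co_linear : forall p a (u v : fiber M p) b,
  co (a *: u + v) b = a * co u b + co v b.
Hypothesis e_same : forall p q (h : tle p q) b, st p = st q -> live p b ->
  transit M h (e p b) = e q b.
Hypothesis e_step : forall p q (h : tle p q) b, st q = (st p).+1 -> live p b ->
  transit M h (e p b) =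
  if y (st p) b is Some b' then sg (st p) b *: e q b' else 0.

Local Notation L := ('I_m.+1 * T)%type.
Local Notation root := (root m B y lev).

Lemma tleE (p q : Nop_R R) :
  tle p q = ((val q.1 <= val p.1)%N /\ val p.2 <= val q.2) :> Prop.
Proof. by []. Qed.

Definition degree (k : nat) (i : nat) : Nop_R R :=
  (exist (fun k : nat => 0 < k)%N k.-1.+1 isT, c i).

Lemma degree_le k i p : (0 < k)%N -> (0 < i <= m)%N ->
  tle (degree k i) p <-> (val p.1 <= k)%N /\ (i <= st p)%N.
Proof. by case: k => // k _ im; rewrite tleE (st_scale _ im). Qed.

Definition gens : {set L} :=
  [set x : L | (x.2 \in B x.1) && (root x.1 x.2 == x)].
Definition gdeg (x : L) : Nop_R R := degree (lev x.2) x.1.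

Definition g0 (j : 'I_#|gens|) : Nop_R R := gdeg (enum_val j).
Local Notation F0 := (free_pmod K g0).

Lemma gelt_subproof p x : free_set g0 p
  ((fun j => ((enum_val j == x) && `[< tle (g0 j) p >])%:R) : 'I_#|gens| -> K^o).
Proof.
split=> [|j]; first exact: finite_finset.
by case: asboolP => //; rewrite andbF eqxx.
Qed.

(** The generator [x], or 0 if it is not born at [p]; being total in [x] avoids
   carrying indices and proofs of birth. *)
Definition gelt p x : fiber F0 p :=
  @SubspaceElt K _ _ (free_closed K g0 p) _ (asboolT (gelt_subproof p x)).

Lemma coef_gelt p x j :
  coef (gelt p x) j = ((enum_val j == x) && `[< tle (g0 j) p >])%:R.
Proof. by []. Qed.

Lemma gelt_gen p j (h : tle (g0 j) p) : gelt p (enum_val j) = gen K h.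
Proof.
apply: coef_inj => i; rewrite coef_gelt coef_gen (inj_eq enum_val_inj).
by have [->|//] := eqVneq i j; rewrite asboolT.
Qed.

Lemma gelt_transit p q (h : tle p q) x : tle (gdeg x) p ->
  transit F0 h (gelt p x) = gelt q x.
Proof.
move=> xp; apply: coef_inj => i; rewrite coef_transit !coef_gelt.
have [ix|//] := eqVneq (enum_val i) x; rewrite /= /g0 ix !asboolT //.
exact: tle_trans h xp.
Qed.

Definition eps : nat_trans F0 M :=
  free_map (fun j => e (g0 j) (enum_val j).2).

Lemma rootS i b : root i.+1 b =
  if parent B y lev i b is Some b' then root i b' else (inord i.+1, b).
Proof. by []. Qed.

Lemma st_gdeg (x : L) : x \in gens -> st (gdeg x) = x.1.
Proof.
rewrite inE => /andP[xB _]; apply: st_at; apply/andP; split; last by rewrite -ltnS; exact: ltn_ord.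
by case: posnP => // x0; move: xB; rewrite x0 B0 inE.
Qed.

Lemma root_gens i b : (i <= m)%N -> b \in B i -> root i b \in gens.
Proof.
move=> im bB; have [_ rB _ rr] := root_spec y lev B0 im bB.
by rewrite inE rB rr eqxx.
Qed.

Lemma root_born i b p : (i <= st p)%N -> b \in B i ->
  tle (gdeg (root i b)) p <-> (val p.1 <= lev b)%N.
Proof.
move=> ip bB; have im := leq_trans ip (st_le p).
have [/andP[r0 ri] _ lr _] := root_spec y lev B0 im bB.
rewrite /gdeg lr degree_le ?(lev_gt0 bB) ?r0 ?(leq_trans ri) //.
by split=> [[]|->]; rewrite ?(leq_trans ri).
Qed.

(** The factor by which the image of the generator of [b] differs from the basis
   element of [b]. *)
Fixpoint rootsg i b : K :=
  match i with
  | 0 => 1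
  | i'.+1 => if parent B y lev i' b is Some b' then rootsg i' b' * sg i' b' else 1
  end.

Lemma rootsg_neq0 i b : rootsg i b != 0.
Proof.
elim: i b => [|i IH] b /=; first exact: oner_neq0.
by case: parent => [b'|]; rewrite ?oner_neq0 // mulf_neq0.
Qed.

Lemma earlier_le i p : (0 < i <= st p)%N -> tle ((p.1, c i) : Nop_R R) p.
Proof.
move=> /andP[i0 ip]; rewrite tleE -st_scale ?leqnn //.
by rewrite i0 (leq_trans ip).
Qed.

Lemma live_pos p b : live p b -> (0 < st p <= m)%N.
Proof.
move=> /andP[bB _]; rewrite st_le andbT.
by case: posnP => // s0; move: bB; rewrite s0 B0 inE.
Qed.

Lemma eps_root p b : live p b ->
  pmap eps p (gelt p (root (st p) b)) = rootsg (st p) b *: e p b.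
Proof.
have [n sp] := ubnP (st p); elim: n p b sp => // n IH p b sp pb.
have /andP[bB bk] := pb; have [im rg] : (st p <= m)%N /\ root (st p) b \in gens.
  by split; [exact: st_le|apply: root_gens].
have rb : tle (gdeg (root (st p) b)) p by apply/(root_born (leqnn _) bB).
case E : (st p) (live_pos pb) => [|i]; first by [].
move=> sm; rewrite E in bB im rg rb *.
move: rg rb; rewrite rootS [rootsg _ _]/=; case: parentP => [b' b'B yb lb|nop] rg rb; last first.
  have /set0Pn : [set x in gens | x == (inord i.+1, b)] != finset.set0.
    by apply/set0Pn; exists (inord i.+1, b); rewrite inE rg eqxx.
  case=> x; rewrite inE => /andP[xg /eqP xE].
  pose j := enum_rank_in xg x.
  have jE : enum_val j = (inord i.+1, b) by rewrite /j enum_rankK_in.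
  rewrite scale1r -jE; rewrite -jE in rb.
  rewrite (gelt_gen rb) /eps free_map_gen jE /=; apply: e_same.
    by rewrite [LHS]st_gdeg ?enum_valP // jE /= inordK.
  rewrite /live [st _]st_gdeg ?enum_valP // jE /= inordK // bB /= /g0 jE /=.
  by rewrite prednK ?(lev_gt0 bB).
have i0 : (0 < i)%N by case: (posnP i) b'B => // ->; rewrite B0 inE.
have ism : (0 < i <= st p)%N by rewrite i0 E leqnSn.
pose p' : Nop_R R := (p.1, c i); have h : tle p' p := earlier_le ism.
have sp' : st p' = i by apply: st_at; rewrite i0 ltnW.
have p'b' : live p' b' by rewrite /live sp' b'B lb.
have rb' : tle (gdeg (root i b')) p'.
  by apply/(root_born _ b'B); rewrite ?sp' ?lb.
rewrite -(gelt_transit h rb') -pmap_transit -{1}sp' IH //; last by rewrite sp' -E ltnS in sp *.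
by rewrite transitZ e_step ?sp' ?E // yb scalerA.
Qed.

(** Each basis element is lifted to a multiple of its generator. *)
Definition section p (v : fiber M p) : fiber F0 p :=
  \sum_(b | live p b) (co v b / rootsg (st p) b) *: gelt p (root (st p) b).

Lemma sectionK p v : pmap eps p (section v) = v.
Proof.
rewrite /section linear_sum [RHS]co_sum; apply: eq_bigr => b pb.
by rewrite pmapZ eps_root // scalerA divfK // rootsg_neq0.
Qed.

Lemma section_linear p : linear (@section p).
Proof.
move=> a u v; rewrite /section scaler_sumr -big_split; apply: eq_bigr => b _ /=.
by rewrite co_linear mulrDl scalerDl scalerA mulrA.
Qed.

Lemma section0 p : section (0 : fiber M p) = 0.
Proof.
have := @section_linear p (-1) 0 0; rewrite scaler0 addr0 scaleN1r => ->.
exact: addNr.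
Qed.

Lemma section_e p b : live p b ->
  section (e p b) = (rootsg (st p) b)^-1 *: gelt p (root (st p) b).
Proof.
move=> pb; rewrite /section (bigD1 b) //= big1 => [|b' /andP[pb' b'b]].
  by rewrite co_e // eqxx mul1r addr0.
by rewrite co_e // eq_sym (negbTE b'b) mul0r scale0r.
Qed.

(** A label gives a relation when it loses its generator at the next stage, by
   vanishing or by becoming a label that has another root. *)
Definition rels : {set L} :=
  [set x : L | [&& (x.1 < m)%N, x.2 \in B x.1 &
     if y x.1 x.2 is Some b1 then root x.1.+1 b1 != root x.1 x.2 else true]].
Definition rdeg (x : L) : Nop_R R := degree (lev x.2) x.1.+1.
Definition g1 (j : 'I_#|rels|) : Nop_R R := rdeg (enum_val j).

Definition rel_tail p (x : L) : fiber F0 p :=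
  if y x.1 x.2 is Some b1 then
    (rootsg x.1 x.2 * sg x.1 x.2 / rootsg x.1.+1 b1) *: gelt p (root x.1.+1 b1)
  else 0.
Definition rel_elt p (x : L) : fiber F0 p := gelt p (root x.1 x.2) - rel_tail p x.

Definition bd : nat_trans (free_pmod K g1) F0 :=
  free_map (fun j => rel_elt (g1 j) (enum_val j)).

Lemma relsP x : x \in rels -> [/\ (0 < x.1 < m)%N, x.2 \in B x.1 &
   forall b1, y x.1 x.2 = Some b1 -> root x.1.+1 b1 <> root x.1 x.2].
Proof.
rewrite inE => /and3P[xm xB xy]; split=> // [|b1 yx].
  by rewrite xm andbT; case: posnP => // x0; move: xB; rewrite x0 B0 inE.
by move: xy; rewrite yx => /eqP.
Qed.

Lemma rdeg_le x p : x \in rels ->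
  tle (rdeg x) p <-> (val p.1 <= lev x.2)%N /\ (x.1 < st p)%N.
Proof.
by case/relsP=> /andP[x0 xm] xB _; rewrite /rdeg degree_le ?(lev_gt0 xB) ?xm.
Qed.

Lemma rel_transit p q (h : tle p q) x : x \in rels -> tle (rdeg x) p ->
  transit F0 h (rel_elt p x) = rel_elt q x.
Proof.
move=> xr /(rdeg_le _ xr)[kx xp]; have [/andP[x0 xm] xB _] := relsP xr.
rewrite /rel_elt /rel_tail transitB gelt_transit; last first.
  by apply/(root_born _ xB); [exact: ltnW|].
case E : (y _ _) => [b1|]; last by rewrite linear0.
have [b1B lb1] := yB xm xB E.
rewrite transitZ gelt_transit //; apply/(root_born _ b1B) => //.
exact: leq_trans lb1.
Qed.

Lemma bd_gen p j (h : tle (g1 j) p) : pmap bd p (gen K h) = rel_elt p (enum_val j).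
Proof. by rewrite /bd free_map_gen rel_transit ?enum_valP //; exact: tle_refl. Qed.

Lemma eps_step i b p : (0 < i < st p)%N -> b \in B i -> (val p.1 <= lev b)%N ->
  pmap eps p (gelt p (root i b)) =
  if y i b is Some b1 then
    (rootsg i b * sg i b / rootsg i.+1 b1) *: pmap eps p (gelt p (root i.+1 b1))
  else 0.
Proof.
move=> /andP[i0 ip] bB bk; have im := leq_trans ip (st_le p).
pose q : Nop_R R := (p.1, c i.+1); have qp : tle q p by exact: earlier_le.
pose p' : Nop_R R := (p.1, c i).
have sp' : st p' = i by apply: st_at; rewrite i0 ltnW.
have sq : st q = i.+1 by exact: st_at.
have h : tle p' q.
  rewrite tleE; split=> //; rewrite -(@st_scale i q) ?sq //.
  by rewrite i0 ltnW.
have pb : live p' b by rewrite /live sp' bB.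
have rb' : tle (gdeg (root i b)) p' by apply/(root_born _ bB); rewrite ?sp'.
rewrite -(gelt_transit (tle_trans qp h) rb') -pmap_transit -{1}sp' eps_root // sp'.
rewrite -(transit_comp h qp) transitZ e_step ?sp' ?sq //.
case E : (y i b) => [b1|]; last by rewrite !linear0.
have [b1B lb1] := yB im bB E.
have qb1 : live q b1 by rewrite /live sq b1B /= (leq_trans bk).
have rb1 : tle (gdeg (root i.+1 b1)) q.
  by apply/(root_born _ b1B); rewrite ?sq // (leq_trans bk).
rewrite -(gelt_transit qp rb1) -[in RHS]pmap_transit -[in gelt q _]sq eps_root // sq.
by rewrite !transitZ !scalerA divfK // rootsg_neq0.
Qed.

Lemma eps_bd p w : pmap eps p (pmap bd p w) = 0.
Proof.
move: p w; apply: (free_map_ext (a := comp_map eps bd) (b := zero_map _ M)) => j.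
rewrite pmap_comp bd_gen pmap_zero.
set x := enum_val j; have xr : x \in rels by exact: enum_valP.
have [/andP[x0 xm] xB _] := relsP xr.
have [kx xs] : (val (g1 j).1 <= lev x.2)%N /\ (x.1 < st (g1 j))%N.
  by apply/(rdeg_le _ xr); exact: tle_refl.
rewrite /rel_elt pmapB eps_step ?x0 // /rel_tail.
by case: (y _ _) => [b1|]; rewrite ?pmapZ ?linear0 ?subrr ?addr0.
Qed.

(** Congruence of [v] with the section of its image, modulo the relations. When
   the image of [v] is 0, it says that [v] is a combination of relations. *)
Definition reducible p (v : fiber F0 p) : Prop :=
  exists w, pmap bd p w = v - section (pmap eps p v).

Lemma reducible_closed p : submod_closed (fun v => `[< @reducible p v >]).
Proof.
have lin : linear (fun v => v - section (pmap eps p v)).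
  move=> a u v; rewrite linearP section_linear scalerBr opprD addrACA //.
split=> [|a u v /asboolP[w wE] /asboolP[w' w'E]]; apply/asboolP.
  by exists 0; rewrite !linear0 section0 subrr.
by exists (a *: w + w'); rewrite linearP wE w'E /= -lin.
Qed.

Lemma bd_reducible p w : reducible (pmap bd p w).
Proof.
by exists w; rewrite eps_bd section0 subr0.
Qed.

Lemma reducibleD p a (u v : fiber F0 p) : reducible u -> reducible v ->
  reducible (a *: u + v).
Proof.
by move=> u0 v0; have [_ /(_ a u v (asboolT u0) (asboolT v0))/asboolP] :=
  reducible_closed p.
Qed.

(** By induction on the number of stages left: at the next stage, the label
   keeps its generator, or a relation replaces the generator by the one of the
   label that it becomes. *)
Lemma root_reducible i b p : (i <= st p)%N -> b \in B i ->
  (val p.1 <= lev b)%N -> reducible (gelt p (root i b)).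
Proof.
have [n] := ubnP (st p - i); elim: n i b => // n IH i b.
rewrite ltnS => pin ip bB bk; have [ei|ni] := eqVneq i (st p).
  rewrite ei in bB *; have pb : live p b by rewrite /live bB.
  exists 0; rewrite linear0 eps_root // -[_ *: e p b]addr0 section_linear.
  rewrite section0 addr0 section_e // scalerA divff ?rootsg_neq0 //.
  by rewrite scale1r subrr.
have ilp : (i < st p)%N by rewrite ltn_neqAle ni.
have im := leq_trans ilp (st_le p).
have IH1 b1 : y i b = Some b1 -> reducible (gelt p (root i.+1 b1)).
  move=> E; have [b1B lb1] := yB im bB E; apply: IH => //.
    by rewrite subnS -ltnS prednK ?subn_gt0.
  exact: leq_trans lb1.
have iM : (i < m.+1)%N by exact: ltnW.
pose x : L := (Ordinal iM, b).
have [xr|nr] := boolP (x \in rels); last first.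
  move: nr; rewrite inE /= im bB /=; case E : (y i b) => [b1|//].
  by rewrite negbK => /eqP <-; exact: IH1.
have xp : tle (rdeg x) p by apply/(rdeg_le _ xr).
have relred : reducible (rel_elt p x).
  pose j := enum_rank_in xr x; have jE : enum_val j = x by rewrite enum_rankK_in.
  by rewrite -jE in xp *; rewrite -(bd_gen xp); exact: bd_reducible.
have -> : gelt p (root i b) = 1 *: rel_elt p x + rel_tail p x.
  by rewrite scale1r /rel_elt subrK.
apply: reducibleD => //; rewrite /rel_tail /=.
have red0 : @reducible p 0 by have [/asboolP] := reducible_closed p.
case E : (y i b) => [b1|//]; rewrite -[_ *: _]addr0.
by apply: reducibleD => //; exact: IH1.
Qed.

Lemma bd_cokernel : is_cokernel bd eps.
Proof.
move=> p; split=> [q|v]; first by exists (section q); rewrite sectionK.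
split=> [v0|[w <-]]; last exact: eps_bd.
suff [w wE] : reducible v by exists w; rewrite wE v0 section0 subr0.
apply: (free_span (reducible_closed p)) => j h _; rewrite -gelt_gen.
have /[dup] := enum_valP j; set x := enum_val j; rewrite {1}inE => /andP[xB /eqP rx] xg.
have [/andP[x0 _] _ _ _] := root_spec y lev B0 (leq_ord x.1) xB.
have xm : (0 < x.1 <= m)%N by rewrite rx in x0; rewrite x0 leq_ord.
have [kx xs] := (degree_le p (lev_gt0 xB) xm).1 h.
by rewrite -rx; exact: root_reducible.
Qed.

(** Take in the support of [w] a relation whose label has the earliest stage. The
   generator of this label occurs in no other relation of the support, for a
   generator that is lost is never a root again ([root_persist]). *)
Lemma bd_inj p w : pmap bd p w = 0 -> w = 0.
Proof.
move=> w0; apply: contrapT => wn0.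
have [j wj] : exists j, coef w j != 0.
  apply: contrapT => nw; apply: wn0; apply: coef_inj => j; rewrite coef0.
  by apply/eqP/negPn/negP => wj; apply: nw; exists j.
pose birth (l : 'I_#|rels|) : nat := (enum_val l).1.
have [{wj}j wj jmin] := @arg_minnP _ j (fun l => coef w l != 0) birth wj.
have [/andP[x0 xm] xB xy] := relsP (enum_valP j).
have rg := root_gens (ltnW xm) xB; set z := root _ _ in rg.
pose i := enum_rank_in rg z; have iE : enum_val i = z by rewrite enum_rankK_in.
suff : coef (pmap bd p w) i = coef w j.
  by rewrite w0 coef0 => /esym/eqP; rewrite (negbTE wj).
apply: (free_span (N := fun u => coef (pmap bd p u) i = coef u j)).
  split=> [|a u v /asboolP u0 /asboolP v0]; apply/asboolP.
    by rewrite linear0 !coef0.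
  by rewrite linearP !coefD !coefZ /= u0 v0.
move=> l h /jmin jl; rewrite bd_gen coef_gen /rel_elt coefB.
have [/andP[x'0 x'm] x'B x'y] := relsP (enum_valP l).
have [kx' x's] := (rdeg_le p (enum_valP l)).1 h.
have noroot i' b' : ((enum_val j).1 < i' <= m)%N -> b' \in B i' -> root i' b' <> z.
  move=> ij b'B re; have [b1 yb1 rb1] := root_persist B0 ij xB b'B re.
  exact: (xy b1 yb1).
have -> : coef (rel_tail p (enum_val l)) i = 0.
  rewrite /rel_tail; case E : (y _ _) => [b1|//]; rewrite coefZ coef_gelt iE.
  have [b1B _] := yB x'm x'B E.
  have [ze|_] := eqVneq z; last by rewrite mulr0.
  case: (noroot _ _ _ b1B (esym ze)); rewrite x'm andbT ltnS; exact: jl.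
rewrite subr0 coef_gelt iE; have [ejl|lj] := eqVneq j l.
  subst l; rewrite eqxx asboolT // /g0 iE; apply/(root_born _ xB) => //.
  exact: ltnW.
have [ze|//] := eqVneq z.
move: jl; rewrite /birth leq_eqVlt => /orP[/eqP jl|jl].
  case/eqP: lj; apply: enum_val_inj; apply/eqP; rewrite -pair_eqE /pair_eq.
  apply/andP; split; first exact/eqP/val_inj.
  apply/eqP/(root_inj (y := y) (lev := lev) B0 (ltnW xm) xB); first by rewrite jl.
  by move: ze; rewrite -jl.
case: (noroot _ _ _ x'B (esym ze)).
by apply/andP; split; [exact: jl|exact: ltnW].
Qed.

(** The scale of a relation is that of the stage following its label, so a
   generator of the same scale is born there. Its level is then strictly larger
   than that of the label, which would otherwise be a possible parent. *)
Lemma bd_strict j i : coef (pmap bd (g1 j) (gen K (tle_refl (g1 j)))) i != 0 ->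
  ~ tle (g1 j) (g0 i).
Proof.
rewrite bd_gen => ci /(rdeg_le _ (enum_valP j))[].
have [/andP[x0 xm] xB xy] := relsP (enum_valP j).
rewrite {2}/g0 st_gdeg ?enum_valP // => lz xz.
have [/andP[_ rx] _ _ _] := root_spec y lev B0 (ltnW xm) xB.
have zr : enum_val i <> root (enum_val j).1 (enum_val j).2.
  by move=> zE; move: xz; rewrite zE ltnNge rx.
move: ci; rewrite /rel_elt coefB coef_gelt; have [//|_] := eqVneq (enum_val i); rewrite sub0r.
rewrite /rel_tail; case E : (y _ _) => [b1|]; last by rewrite coef0 oppr0 eqxx.
have [b1B lb1] := yB xm xB E.
rewrite coefZ coef_gelt; have [ze _|] := eqVneq (enum_val i); last by rewrite mulr0 oppr0 eqxx.
have [/andP[r0 r1] _ lr _] := root_spec y lev B0 xm b1B.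
move: lz; rewrite /g0 /gdeg ze /= lr prednK ?(lev_gt0 b1B) // => lz.
move: xz; rewrite ze rootS; case: parentP => [b' b'B yb' lb'|/(_ _ xB E)]; last first.
  by case; apply/eqP; rewrite eqn_leq lb1.
have [/andP[_ +] _ _ _] := root_spec y lev B0 (ltnW xm) b'B.
by rewrite leqNgt => /negP.
Qed.

Lemma card_labels (S : {set L}) : (forall x : L, x \in S -> x.2 \in B x.1) ->
  (#|S| <= \sum_(i < m) #|B i.+1|)%N.
Proof.
move=> SB; apply: leq_trans (_ : #|[set x : L | x.2 \in B x.1]| <= _)%N.
  by apply: subset_leq_card; apply/fintype.subsetP => x /SB; rewrite inE.
rewrite -sum1_card; under eq_bigl do rewrite inE.
rewrite -(pair_big_dep xpredT (fun (i : 'I_m.+1) b => b \in B i) (fun _ _ => 1%N)) /=.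
rewrite big_ord_recl B0 big1 ?add0n => [|b]; last by rewrite inE.
by apply: leq_sum => i _; rewrite sum1_card.
Qed.

Theorem labelled_betti : exists n0 n1 : nat,
  [/\ betti M 0 n0, betti M 1 n1, finitely_presented M,
      (n0 <= \sum_(i < m) #|B i.+1|)%N & (n1 <= \sum_(i < m) #|B i.+1|)%N].
Proof.
exists #|gens|, #|rels|; split.
- exact: (short_betti0 bd_cokernel bd_inj bd_strict).
- exact: (short_betti1 bd_cokernel bd_inj bd_strict).
- exact: (short_presented bd_cokernel).
- by apply: card_labels => x; rewrite inE => /andP[].
- by apply: card_labels => x; rewrite inE => /and3P[].
Qed.
End LabelledModule.

(** * Bases of simplicial chains *)

Section Tuples.
Variables (T : finType) (j : nat).
Local Notation tuples := {ffun 'I_j.+1 -> T}.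
Implicit Types u v : tuples.

Definition permute u (s : 'S_j.+1) : tuples := [ffun i => u (s i)].
Definition support u : {set T} := [set u i | i : 'I_j.+1].

Lemma permuteM u s t : permute u (s * t)%g = permute (permute u t) s.
Proof. by apply/ffunP => i; rewrite !ffunE permM. Qed.

Lemma permute1 u : permute u 1%g = u.
Proof. by apply/ffunP => i; rewrite ffunE perm1. Qed.

Lemma support_permute u s : support (permute u s) = support u.
Proof.
apply/setP => x; apply/imsetP/imsetP => -[i _ ->].
  by exists (s i) => //; rewrite ffunE.
by exists (s^-1%g i) => //; rewrite ffunE permKV.
Qed.

Lemma permute_inj u s : injective u -> injective (permute u s).
Proof. by move=> ui i i'; rewrite !ffunE => /ui/perm_inj. Qed.

Lemma permute_inj_perm u s t : injective u -> permute u s = permute u t -> s = t.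
Proof.
by move=> ui /ffunP st; apply/permP => i; have := st i; rewrite !ffunE => /ui.
Qed.

Lemma card_support u : injective u -> #|support u| = j.+1.
Proof. by move=> ui; rewrite card_imset // card_ord. Qed.

Lemma same_support u v : injective u -> injective v -> support u = support v ->
  exists s, v = permute u s.
Proof.
move=> ui vi uv.
have ex i : exists i', v i == u i'.
  have : v i \in support u by rewrite uv; apply: imset_f.
  by case/imsetP => i' _ ->; exists i'.
pose g i := xchoose (ex i).
have gE i : v i = u (g i) by apply/eqP; exact: (xchooseP (ex i)).
have gi : injective g by move=> i i' gg; apply: vi; rewrite !gE gg.
by exists (perm gi); apply/ffunP => i; rewrite ffunE permE gE.
Qed.

(** A chosen ordering of the support of [u], depending on the support only. *)
Definition rep u : tuples :=
  odflt u [pick v : tuples | injectiveb v && (support v == support u)].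

Lemma rep_spec u : injective u -> injective (rep u) /\ support (rep u) = support u.
Proof.
move=> ui; rewrite /rep; case: pickP => //= v /andP[/injectiveP vi /eqP ->].
by split.
Qed.

Lemma rep_eq u v : injective u -> injective v -> support u = support v -> rep u = rep v.
Proof.
move=> /injectiveP ui /injectiveP vi uv; rewrite /rep uv; case: pickP => //= /(_ v).
by rewrite vi eqxx.
Qed.

Lemma rep_perm u : injective u -> exists s, u = permute (rep u) s.
Proof. by move=> ui; have [ri rs] := rep_spec ui; exact: same_support. Qed.

Definition canonical_tuple u := injectiveb u && (rep u == u).

Lemma rep_canonical u : injective u -> canonical_tuple (rep u).
Proof.
move=> ui; have [ri rs] := rep_spec ui; rewrite /canonical_tuple.
by apply/andP; split; [exact/injectiveP|rewrite (rep_eq ri ui)].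
Qed.

Lemma canonical_permute u v s : canonical_tuple u -> canonical_tuple v ->
  v = permute u s -> u = v /\ s = 1%g.
Proof.
move=> /andP[/injectiveP ui /eqP ru] /andP[/injectiveP vi /eqP rv] vE.
have uv : u = v by rewrite -ru -rv; apply: rep_eq; rewrite // vE support_permute.
by split=> //; apply: (permute_inj_perm ui); rewrite permute1 -vE uv.
Qed.

Definition repsign (K : fieldType) u : K :=
  (-1) ^+ odflt 1%g [pick s : 'S_j.+1 | u == permute (rep u) s].

Lemma repsign_neq0 K u : repsign K u != 0.
Proof. by rewrite signr_eq0. Qed.
End Tuples.

Section ComplexChains.
Variables (K : fieldType) (T : finType) (A : {set {set T}}) (cA : complex_in A).
Variables (k j : nat).
Local Notation L := (skeleton k (complex_of cA)).
Local Notation tuples := {ffun 'I_j.+1 -> T}.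
Implicit Types (u v : tuples) (w : ordered_tuple j L).

Definition raw (w : ordered_tuple j L) : tuples := [ffun i => val (w i)].

Lemma raw_inj : injective raw.
Proof.
by move=> w w' /ffunP ww; apply/ffunP => i; apply: val_inj; have := ww i; rewrite !ffunE.
Qed.

Lemma raw_support w : support (raw w) = val @: [set w i | i : 'I_j.+1].
Proof. by rewrite -imset_comp; apply: eq_imset => i; rewrite ffunE. Qed.

Lemma raw_face w : ([set w i | i : 'I_j.+1] \in faces L) =
  (support (raw w) \in A) && (#|support (raw w)| <= k.+1)%N.
Proof. by rewrite raw_support card_imset ?inE //; exact: val_inj. Qed.

Lemma raw_lift (u : tuples) : support u \in A -> exists w, raw w = u.
Proof.
move=> uA; have uv i : [set u i] \in A.
  apply: (proj2 cA _ _ uA); last by apply/set0Pn; exists (u i); rewrite inE.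
  by rewrite sub1set imset_f.
by exists [ffun i => exist _ (u i) (uv i)]; apply/ffunP => i; rewrite !ffunE.
Qed.

Lemma raw_permute w (s : 'S_j.+1) : raw [ffun i => w (s i)] = permute (raw w) s.
Proof. by apply/ffunP => i; rewrite !ffunE. Qed.

Lemma raw_injective w : injective w <-> injective (raw w).
Proof.
split=> wi i i'; first by rewrite !ffunE => /val_inj/wi.
by move=> ww; apply: wi; rewrite !ffunE ww.
Qed.

(** The elementary oriented chain of [u], as an alternating function. *)
Definition simplex_fun (u : tuples) (w : ordered_tuple j L) : K^o :=
  \sum_(s : 'S_j.+1) (-1) ^+ s * (raw w == permute u s)%:R.

Definition simplex_ok (u : tuples) : Prop :=
  [/\ injective u, support u \in A & (j <= k)%N].

Lemma simplex_fun0 u w : (forall s, raw w <> permute u s) -> simplex_fun u w = 0.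
Proof. by move=> wu; apply: big1 => s _; rewrite (introF eqP (wu s)) mulr0. Qed.

Lemma simplex_fun_permute u w s : injective u -> raw w = permute u s ->
  simplex_fun u w = (-1) ^+ s.
Proof.
move=> ui ws; rewrite /simplex_fun (bigD1 s) //= ws eqxx mulr1 big1 ?addr0 // => t ts.
have [/(permute_inj_perm ui) st|_] := eqVneq; last by rewrite mulr0.
by rewrite st eqxx in ts.
Qed.

Lemma simplex_funP u : simplex_ok u -> chain_set (simplex_fun u).
Proof.
move=> [ui uA jk]; split=> [w t|w wn|w wf].
- rewrite /simplex_fun mulr_sumr (reindex_inj (mulgI t)); apply: eq_bigr => s _ /=.
  rewrite odd_permM signr_addb -mulrA raw_permute permuteM.
  congr (_ * (_ * (nat_of_bool _)%:R)); apply/eqP/eqP => [/(congr1 (fun z => permute z t^-1%g))|->//].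
  by rewrite -!(permuteM _ t^-1%g t) mulVg !permute1.
- apply: simplex_fun0 => s ws; case/injectiveP: wn; apply/raw_injective.
  by rewrite ws; exact: permute_inj.
- apply: simplex_fun0 => s ws; case/negP: wf; rewrite raw_face ws support_permute.
  by rewrite uA card_support.
Qed.

Definition simplex_chain (u : tuples) : chains K j L :=
  match pselect (chain_set (simplex_fun u)) with
  | left h => @SubspaceElt K _ _ (chain_closed K j L) _ (asboolT h)
  | right _ => 0
  end.

Lemma simplex_chainE u : simplex_ok u -> val (simplex_chain u) = simplex_fun u.
Proof. by move=> /simplex_funP uP; rewrite /simplex_chain; case: pselect. Qed.

(** The sum has at most one term; it avoids lifting [u] to a tuple of vertices. *)
Definition simplex_coef (c : chains K j L) (u : tuples) : K :=
  \sum_(w | raw w == u) val c w.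

Lemma val_chainZD a (c c' : chains K j L) w :
  val (a *: c + c') w = a * val c w + val c' w.
Proof. by rewrite linearP. Qed.

Lemma val_chainZ a (c : chains K j L) w : val (a *: c) w = a * val c w.
Proof. by rewrite linearZ. Qed.

Lemma simplex_coef_linear a (c c' : chains K j L) u :
  simplex_coef (a *: c + c') u = a * simplex_coef c u + simplex_coef c' u.
Proof.
rewrite /simplex_coef; under eq_bigr do rewrite val_chainZD.
by rewrite big_split mulr_sumr.
Qed.

Lemma simplex_coefE c u w : raw w = u -> simplex_coef c u = val c w.
Proof.
move=> <-; rewrite /simplex_coef (big_pred1 w) // => w' /=.
by rewrite (inj_eq raw_inj).
Qed.

Lemma simplex_coef_chain u v : canonical_tuple u -> canonical_tuple v ->
  support u \in A -> support v \in A -> (j <= k)%N ->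
  simplex_coef (simplex_chain u) v = (u == v)%:R.
Proof.
move=> uc vc uA vA jk; have [w wv] := raw_lift vA; rewrite (simplex_coefE _ wv).
have ui : injective u by case/andP: uc => /injectiveP.
rewrite simplex_chainE //; have [uv|nuv] := eqVneq u v.
  by rewrite (simplex_fun_permute (s := 1%g)) ?odd_perm1 // permute1 uv.
apply: simplex_fun0 => s; rewrite wv => /(canonical_permute uc vc)[uv _].
by rewrite uv eqxx in nuv.
Qed.

Lemma chainP (c : chains K j L) : chain_set (val c).
Proof. exact: asboolW (valP c). Qed.

Lemma val_sumc (I : Type) (r : seq I) (P : pred I) (F : I -> chains K j L) w :
  val (\sum_(i <- r | P i) F i) w = \sum_(i <- r | P i) val (F i) w.
Proof. by rewrite raddf_sum fct_sumE. Qed.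

Lemma chain_decomp (c : chains K j L) (Q : pred tuples) :
  (forall u, Q u = [&& canonical_tuple u, support u \in A & (j <= k)%N]) ->
  c = \sum_(u | Q u) simplex_coef c u *: simplex_chain u.
Proof.
move=> QE; apply: val_inj; apply/funext => w; rewrite val_sumc.
set rhs := \sum_(u | Q u) simplex_coef c u *: simplex_chain u.
have [cs cn cf] := chainP c; have [rs rn rf] := chainP rhs.
rewrite -val_sumc -/rhs.
have [/injectiveP wi|wn] := boolP (injectiveb w); last by rewrite cn ?rn.
have [wA|wf] := boolP ([set w i | i : 'I_j.+1] \in faces L); last by rewrite cf ?rf.
move: (wA); rewrite raw_face => /andP[vA vk]; have vi := (raw_injective w).1 wi.
have jk : (j <= k)%N by rewrite card_support in vk.
have [s vs] := rep_perm vi; have [ri rsupp] := rep_spec vi.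
have rA : support (rep (raw w)) \in A by rewrite rsupp.
have Qr : Q (rep (raw w)) by rewrite QE rep_canonical // rA.
have [w0 w0E] := raw_lift rA.
have ww0 : w = [ffun i => w0 (s i)] by apply: raw_inj; rewrite raw_permute w0E.
rewrite /rhs val_sumc (bigD1 (rep (raw w))) // big1 => [|u /andP[Qu nu]].
  rewrite val_chainZ (simplex_coefE _ w0E) simplex_chainE //.
  by rewrite (simplex_fun_permute ri vs) {1}ww0 cs mulrC [RHS]addr0.
rewrite val_chainZ; move: Qu; rewrite QE => /and3P[uc uA _].
have ui : injective u by case/andP: uc => /injectiveP.
rewrite simplex_chainE // simplex_fun0 ?mulr0 // => t wt.
case/eqP: nu; have [_ /eqP <-] := andP uc.
by apply: rep_eq => //; rewrite wt support_permute.
Qed.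
End ComplexChains.

(** * Chains of a diagram that changes at finitely many scales *)

Section ChainPush.
Variables (K : fieldType) (T : finType) (A A' : {set {set T}}).
Variables (cA : complex_in A) (cA' : complex_in A') (k j : nat) (F : T -> T).
Variable g : simp_map (skeleton k (complex_of cA)) (skeleton k (complex_of cA')).
Hypothesis gF : forall v, val (g v) = F (val v).
Hypothesis FA : forall S, S \in A -> F @: S \in A'.
Local Notation tuples := {ffun 'I_j.+1 -> T}.
Implicit Types (u v : tuples).

Definition apply_tuple u : tuples := [ffun i => F (u i)].

Lemma support_apply u : support (apply_tuple u) = F @: support u.
Proof. by rewrite -imset_comp; apply: eq_imset => i; rewrite ffunE. Qed.

Lemma chain_map_simplex_fun u w' : simplex_ok A k u ->
  val (chain_map K j g (simplex_chain K cA k u)) w' =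
  simplex_fun K (cA := cA') (apply_tuple u) w'.
Proof.
move=> uok; have [ui uA jk] := uok.
rewrite /= /chain_push simplex_chainE // /simplex_fun exchange_big /=.
apply: eq_bigr => s _; rewrite -mulr_sumr; congr (_ * _).
have [w0 w0E] : exists w, raw (cA := cA) (k := k) w = permute u s.
  by apply: raw_lift; rewrite support_permute.
have gw : raw (cA := cA') (k := k) [ffun i => g (w0 i)] = permute (apply_tuple u) s.
  apply/ffunP => i; rewrite !ffunE gF; congr F.
  by have /ffunP/(_ i) := w0E; rewrite !ffunE.
rewrite -w0E -gw (inj_eq (@raw_inj _ _ _ _ _)) eq_sym.
under eq_bigr do rewrite (inj_eq (@raw_inj _ _ _ _ _)).
rewrite big_mkcond (bigD1 w0) //= eqxx big1 ?addr0 => [|w /negbTE ->]; last first.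
  by case: ifP.
by case: eqP.
Qed.

Lemma simplex_chain_permute u s : simplex_ok A k u ->
  simplex_chain K cA k (permute u s) = (-1) ^+ s *: simplex_chain K cA k u.
Proof.
move=> uok; have [ui uA jk] := uok.
have sok : simplex_ok A k (permute u s).
  by split; rewrite ?support_permute //; exact: permute_inj.
apply: val_inj; apply/funext => w; rewrite simplex_chainE //.
rewrite val_chainZ simplex_chainE // /simplex_fun mulr_sumr.
rewrite [RHS](reindex_inj (mulIg s)); apply: eq_bigr => t _.
rewrite odd_permM signr_addb permuteM mulrA; congr (_ * _).
by rewrite mulrCA -signr_addb addbb mulr1.
Qed.
End ChainPush.

Section ChainPushRep.
Variables (K : fieldType) (T : finType) (A A' : {set {set T}}).
Variables (cA : complex_in A) (cA' : complex_in A') (k j : nat) (F : T -> T).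
Variable g : simp_map (skeleton k (complex_of cA)) (skeleton k (complex_of cA')).
Hypothesis gF : forall v, val (g v) = F (val v).
Hypothesis FA : forall S, S \in A -> F @: S \in A'.

Lemma chain_map_simplex (u : {ffun 'I_j.+1 -> T}) : simplex_ok A k u ->
  chain_map K j g (simplex_chain K cA k u) =
  if injectiveb (apply_tuple F u) then
    repsign K (apply_tuple F u) *: simplex_chain K cA' k (rep (apply_tuple F u))
  else 0.
Proof.
move=> uok; have [ui uA jk] := uok; set v := apply_tuple F u.
have vA : support v \in A' by rewrite support_apply FA.
have [/injectiveP vi|/injectiveP vn] := ifPn.
  have [ri rs] := rep_spec vi.
  have rok : simplex_ok A' k (rep v) by split; rewrite ?rs.
  have -> : chain_map K j g (simplex_chain K cA k u) = simplex_chain K cA' k v.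
    apply: val_inj; apply/funext => w; rewrite (chain_map_simplex_fun K gF) //.
    by rewrite simplex_chainE.
  rewrite /repsign; case: pickP => [s /eqP vs|ns]; last first.
    by have [s vs] := rep_perm vi; have := ns s; rewrite -vs eqxx.
  by rewrite {1}vs simplex_chain_permute.
apply: val_inj; apply/funext => w.
have [/injectiveP wi|wn] := boolP (injectiveb w); last first.
  (* chains vanish on degenerate tuples *)
  have [_ cn _] := chainP (chain_map K j g (simplex_chain K cA k u)).
  exact: cn w wn.
rewrite (chain_map_simplex_fun K gF) // simplex_fun0 // => s ws; apply: vn => i i' vv.
have := (raw_injective w).1 wi; rewrite ws => /(_ (s^-1 i)%g (s^-1 i')%g).
by rewrite !ffunE !permKV; move: vv; rewrite !ffunE => vv /(_ vv)/perm_inj.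
Qed.
End ChainPushRep.

Section StagedSystem.
Variables (R : realType) (K : fieldType) (T : finType).
Variables (A : Nop_R R -> {set {set T}}) (f : Nop_R R -> Nop_R R -> T -> T).
Hypothesis cA : forall p, complex_in (A p).
Hypothesis fA : forall p q s, tle p q -> s \in A p -> f p q @: s \in A q.
Hypothesis f_id : forall p v, [set v] \in A p -> f p p v = v.
Hypothesis f_comp : forall p q r v, tle p q -> tle q r -> [set v] \in A p ->
  f p r v = f q r (f p q v).
Variables (m : nat) (N : nat -> {set {set T}}) (W : nat -> {set T}).
Variables (lv : {set T} -> nat) (F : nat -> T -> T).
Variables (c : nat -> {r : R | 0 <= r}) (st : Nop_R R -> nat).
Hypothesis st_le : forall p, (st p <= m)%N.
Hypothesis st_scale : forall i p, (0 < i <= m)%N ->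
  (i <= st p)%N = (val (c i) <= val p.2).
Hypothesis st_at : forall i k, (0 < i <= m)%N -> st (k, c i) = i.
Hypothesis AE : forall p S, (S \in A p) = (S \in N (st p)) && (val p.1 <= lv S)%N.
Hypothesis N0 : N 0 = finset.set0.
Hypothesis NF : forall i S, (i < m)%N -> S \in N i ->
  F i @: S \in N i.+1 /\ (lv S <= lv (F i @: S))%N.
Hypothesis NW : forall i S, S \in N i -> S \subset W i.
Hypothesis lv_gt0 : forall i S, S \in N i -> (0 < lv S)%N.
Hypothesis f_same : forall p q v, tle p q -> st p = st q -> [set v] \in A p ->
  f p q v = v.
Hypothesis f_step : forall p q v, tle p q -> st q = (st p).+1 -> [set v] \in A p ->
  f p q v = F (st p) v.

Local Notation G := (system_functor cA fA f_id f_comp).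

Section Degree.
Variables (k j : nat).
Local Notation tuples := {ffun 'I_j.+1 -> T}.
Local Notation M := (chain_module K j (skel k G)).

Definition labels i : {set tuples} :=
  [set u : tuples | [&& canonical_tuple u, support u \in N i & (j <= k)%N]].

(** The faces at each stage, represented by their canonical tuples, label bases
   of the chains in the sense of [labelled_betti]. *)
Lemma chains_betti : exists n0 n1 : nat,
  [/\ betti M 0 n0, betti M 1 n1, finitely_presented M,
      (n0 <= \sum_(i < m) #|labels i.+1|)%N & (n1 <= \sum_(i < m) #|labels i.+1|)%N].
Proof.
pose y i (u : tuples) : option tuples :=
  if injectiveb (apply_tuple (F i) u) then Some (rep (apply_tuple (F i) u)) else None.
pose e p u : fiber M p := simplex_chain K (cA p) k u.
pose co p (v : fiber M p) (u : tuples) : K := simplex_coef (cA := cA p) (k := k) v u.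
have liveE p u : live labels (fun u => lv (support u)) st p u =
    [&& canonical_tuple u, support u \in A p & (j <= k)%N].
  by rewrite /live inE AE; case: canonical_tuple; case: (_ \in _); case: leq;
    rewrite ?andbT ?andbF.
have live_ok p u : live labels (fun u => lv (support u)) st p u ->
    simplex_ok (A p) k u.
  by rewrite liveE => /and3P[/andP[/injectiveP]].
have liveA p u i : live labels (fun u => lv (support u)) st p u -> [set u i] \in A p.
  move=> /live_ok[_ uA _]; apply: (proj2 (cA p) _ _ uA).
    by rewrite sub1set imset_f.
  by apply/set0Pn; exists (u i); rewrite inE.
apply: (@labelled_betti R K M _ m labels y (fun u => lv (support u))
  (fun i u => repsign K (apply_tuple (F i) u)) c st e co) => //.
- by apply/setP => u; rewrite !inE N0 inE andbF.
- move=> i u u' im; rewrite !inE => /and3P[uc uN jk]; rewrite /y.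
  case: injectiveP => // vi [<-]; have [ri rs] := rep_spec vi.
  by rewrite rep_canonical // rs support_apply jk andbT /=; exact: NF.
- by move=> i u; rewrite inE => /and3P[_ /lv_gt0].
- by move=> i u; exact: repsign_neq0.
- by move=> p v; apply: chain_decomp.
- move=> p u u'; rewrite !liveE => /and3P[uc uA jk] /and3P[u'c u'A _].
  exact: simplex_coef_chain.
- move=> p a u v b; exact: simplex_coef_linear.
- move=> p q h u pq pu; have uok := live_ok p u pu.
  have fu : apply_tuple (f p q) u = u.
    by apply/ffunP => i; rewrite ffunE f_same //; exact: liveA.
  rewrite [LHS](chain_map_simplex K (F := f p q) (cA' := cA q)) //; last first.
    by move=> S; exact: fA.
  have [ui _ _] := uok; move: pu; rewrite liveE => /and3P[/andP[_ /eqP ru] _ _].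
  have ub : injectiveb u by exact/injectiveP.
  rewrite fu ub /repsign; case: pickP => [s /eqP us|ns].
    suff -> : s = 1%g by rewrite odd_perm1 scale1r ru.
    by rewrite ru in us; apply: (permute_inj_perm ui); rewrite -us permute1.
  by rewrite odd_perm1 scale1r ru.
- move=> p q h u pq pu; have uok := live_ok p u pu.
  have fu : apply_tuple (f p q) u = apply_tuple (F (st p)) u.
    by apply/ffunP => i; rewrite !ffunE f_step //; exact: liveA.
  rewrite [LHS](chain_map_simplex K (F := f p q) (cA' := cA q)) //; last first.
    by move=> S; exact: fA.
  by rewrite fu /y; case: ifP.
Qed.

Lemma card_labels_le i : (#|labels i| <= #|W i| ^ j.+1)%N.
Proof.
rewrite -[X in (_ <= _ ^ X)%N](card_ord j.+1) -card_ffun_on.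
apply/subset_leq_card/fintype.subsetP => u; rewrite inE => /and3P[_ uN _].
apply/ffun_onP => l; apply: (fintype.subsetP (NW uN)); exact: imset_f.
Qed.
End Degree.

Lemma staged_size k D : (forall i, (#|W i| <= D)%N) ->
  exists n, has_size K (skel k G) n /\ (n <= m * k.+2 * D ^ k.+1)%N.
Proof.
move=> WD.
have bound j : (\sum_(i < m) #|labels k j i.+1| <= m * D ^ j.+1)%N.
  rewrite -[X in (_ <= X * _)%N]card_ord -sum_nat_const; apply: leq_sum => i _.
  by apply: leq_trans (card_labels_le k j i.+1) _; rewrite leq_exp2r.
have Dle j : (j <= k)%N -> (D ^ j.+1 <= D ^ k.+1)%N.
  case: (posnP D) => [->|D0] jk; first by rewrite !exp0n.
  by rewrite leq_pexp2l.
have [b0 b0P] := choice (fun j => chains_betti k j).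
have [b1 [_ B1 _ _ b1le]] := b0P 0%N.
exists (b1 + \sum_(j < k.+1) b0 j)%N; split.
  split; first by move=> j; have [n1 []] := b0P j.
  exists b1, b0, k.+1; split=> // j; first by have [n1 []] := b0P j.
  move=> kj; have [n1 [_ _ _ + _]] := b0P j.
  rewrite big1 ?leqn0; first by move=> /eqP.
  move=> i _; apply/eqP; rewrite cards_eq0; apply/eqP/setP => u.
  by rewrite !inE [(j <= k)%N]leqNgt kj !andbF.
rewrite -mulnA mulSn mulnDr; apply: leq_add.
  apply: leq_trans b1le _; apply: leq_trans (bound 0%N) _.
  by rewrite leq_mul2l Dle ?orbT.
rewrite mulnCA -[X in (_ <= X * _)%N](card_ord k.+1) -sum_nat_const.
apply: leq_sum => j _; have [n1 [_ _ _ + _]] := b0P j.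
move/leq_trans; apply; apply: leq_trans (bound j) _.
by rewrite leq_mul2l Dle ?orbT // -ltnS.
Qed.
End StagedSystem.

(** * The size of the nerve *)

Section NerveSize.
Variables (R : realType) (T : finType) (dist : T -> T -> R).
Hypothesis dist_ge0 : forall x y, 0 <= dist x y.
Variables (le : rel T) (ole : total_order le).
Implicit Types (S : {set {set T}}) (r : R) (p q : Nop_R R).

Local Notation cs := (critical_scales dist).
Local Notation maxs := (max_simplices dist).

Lemma critical_sorted : sorted <%R cs.
Proof. by rewrite sort_lt_sorted undup_uniq. Qed.

Lemma critical_sortedW : sorted <=%R cs.
Proof. exact: sort_sorted (@le_total _ _) _. Qed.

Lemma critical_ge0 i : 0 <= nth 0 cs i.
Proof.
have [ii|?] := ltnP i (size cs); last by rewrite nth_default.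
have := mem_nth 0 ii; rewrite mem_sort mem_undup => /allpairsP[[x y] [_ _ ->]] /=.
by rewrite divr_ge0.
Qed.

Definition scale (i : nat) : {r : R | 0 <= r} :=
  exist (fun r : R => is_true (0 <= r)) _ (critical_ge0 i.-1).
(** Stage 0 precedes all the critical scales: there the Rips complex is empty. *)
Definition stage (p : Nop_R R) : nat := count (<= val p.2) cs.
Definition num_scales := size cs.

Lemma num_scales_le : (num_scales <= #|T| ^ 2)%N.
Proof.
rewrite /num_scales size_sort; apply: leq_trans (size_undup _) _.
by rewrite size_allpairs -cardT -mulnn.
Qed.

Lemma stage_le p : (stage p <= num_scales)%N.
Proof. exact: count_size. Qed.

Lemma stage_scale i p : (0 < i <= num_scales)%N ->
  (i <= stage p)%N = (val (scale i) <= val p.2).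
Proof.
case: i => // i im; apply/idP/idP => [ip|]; first exact: (nth_count_le 0 critical_sortedW ip).
apply: contraLR; rewrite -!ltNge -ltnNge ltnS => ip.
by apply: (nth_count_gt 0 critical_sortedW); rewrite ip.
Qed.

Lemma stage_at i k : (0 < i <= num_scales)%N -> stage (k, scale i) = i.
Proof. by case: i => // i im; exact: (count_le_nth 0 critical_sorted). Qed.

Lemma critical_stage x : x \in cs -> exists2 i, (0 < i <= num_scales)%N & x = val (scale i).
Proof.
move=> xc; exists (index x cs).+1; first by rewrite /= index_mem.
by rewrite /= nth_index.
Qed.

Lemma rips_stage p : (0 < stage p)%N ->
  rips dist (val p.2) = rips dist (val (scale (stage p))).
Proof.
move=> sp; have sm : (0 < stage p <= num_scales)%N by rewrite sp stage_le.
apply/eqP; rewrite eqEsubset; apply/andP; split; last first.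
  by apply: rips_mono; rewrite -(stage_scale p sm).
apply/fintype.subsetP => s /ripsP[s0 sr]; apply/ripsP; split=> // x y xs ys.
have := sr x y xs ys; rewrite mulrC -ler_pdivrMr // => dr.
rewrite mulrC -ler_pdivrMr //=.
have [i im di] := critical_stage (mem_critical dist x y).
have := stage_scale (p.1, scale (stage p)) im; rewrite stage_at // -di => /= <-.
by rewrite (stage_scale p im) -di.
Qed.

Lemma rips_stage0 p : stage p = 0%N -> rips dist (val p.2) = finset.set0.
Proof.
move=> sp; apply/setP => s; rewrite !inE; apply/negP => /andP[/set0Pn[x xs]].
move=> /forall_inP/(_ x xs)/forall_inP/(_ x xs); rewrite mulrC -ler_pdivrMr // => dr.
have [i im di] := critical_stage (mem_critical dist x x).
by have := stage_scale p im; rewrite sp -di dr; case: i im {di}.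
Qed.

Definition stage_max (i : nat) : {set {set T}} :=
  if i is 0 then finset.set0 else maxs (val (scale i)).

Lemma stage_maxE p : maxs (val p.2) = stage_max (stage p).
Proof.
rewrite /stage_max; case E : (stage p) => [|i].
  by apply/setP => s; rewrite inE rips_stage0 // !inE.
by rewrite /max_simplices rips_stage E.
Qed.

Definition stage_faces (i : nat) : {set {set {set T}}} :=
  [set S : {set {set T}} | [&& S != finset.set0, S \subset stage_max i & (0 < #|meet S|)%N]].

Lemma nerve_facesE p S :
  (S \in nerve_faces dist p) = (S \in stage_faces (stage p)) && (val p.1 <= #|meet S|)%N.
Proof.
rewrite !inE stage_maxE; have [//|S0 /=] := boolP (S == finset.set0).
have k0 : (0 < val p.1)%N by exact: (valP p.1).
rewrite meet_subdiv // -andbA; congr (_ && _); rewrite andb_idl //.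
exact: leq_trans.
Qed.

Lemma scales_between_stage p q x : val p.2 <= val q.2 ->
  (x \in scales_between dist (val p.2) (val q.2)) =
  (x \in [seq val (scale i) | i <- iota (stage p).+1 (stage q - stage p)]).
Proof.
move=> pq; rewrite mem_filter.
apply/andP/mapP => [[/andP[px xq] /critical_stage[i im xi]]|[i]].
  exists i => //; move: px xq; rewrite xi ltNge -!stage_scale // -ltnNge => px xq.
  rewrite mem_iota addSn subnKC ?(ltnW (leq_trans px xq)) //.
  by rewrite px ltnS.
rewrite mem_iota => /andP[pi iq] ->; case: (leqP (stage p) (stage q)) iq => pq'; last first.
  move: pq' => /ltnW; rewrite -subn_eq0 => /eqP ->; rewrite addn0 ltnS => ip.
  by move: pi; rewrite ltnNge ip.
rewrite addSn subnKC // ltnS => iq.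
have im : (0 < i <= num_scales)%N.
  by rewrite (leq_ltn_trans (leq0n _) pi) (leq_trans iq) ?stage_le.
rewrite ltNge -!stage_scale // -ltnNge pi iq; split=> //.
clear pi iq; case: i im => // i im; apply: mem_nth; exact: im.
Qed.

Lemma scales_between_uniq r r' : uniq (scales_between dist r r').
Proof. by rewrite filter_uniq // sort_uniq undup_uniq. Qed.

Lemma nerve_map_same p q v : val p.2 <= val q.2 -> stage p = stage q ->
  nerve_map dist le (val p.2) (val q.2) v = v.
Proof.
move=> pq spq; rewrite /nerve_map.
suff -> : scales_between dist (val p.2) (val q.2) = [::] by [].
apply: perm_small_eq => //; apply: uniq_perm => //; first exact: scales_between_uniq.
by move=> x; rewrite (scales_between_stage _ pq) spq subnn.
Qed.

(** Exactly one critical scale is crossed between consecutive stages. *)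
Lemma nerve_map_step p q v : val p.2 <= val q.2 -> stage q = (stage p).+1 ->
  nerve_map dist le (val p.2) (val q.2) v = lexmin dist le (val (scale (stage p).+1)) v.
Proof.
move=> pq spq; rewrite /nerve_map.
suff -> : scales_between dist (val p.2) (val q.2) = [:: val (scale (stage p).+1)] by [].
apply: perm_small_eq => //; apply: uniq_perm => //; first exact: scales_between_uniq.
by move=> x; rewrite (scales_between_stage _ pq) spq subSnn.
Qed.

Lemma scale_mono i : (0 < i < num_scales)%N -> val (scale i) <= val (scale i.+1).
Proof.
case/andP=> i0 im; have k1 : {k : nat | (0 < k)%N} by exists 1%N.
rewrite -(stage_scale (k1, scale i.+1)) ?i0 1?ltnW // stage_at //.
Qed.

(** The level of a set of maximal simplices is the number of their common
   vertices, and it grows along the structure maps since these enlarge maximal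
   simplices. *)
Theorem nerve_size (K : fieldType) (k D : nat) :
  (forall r, 0 <= r -> (#|maxs r| <= D)%N) ->
  exists n, has_size K (skel k (nerve_SR dist ole)) n /\
            (n <= #|T| ^ 2 * k.+2 * D ^ k.+1)%N.
Proof.
move=> maxD.
suff H cA fA f_id f_comp : exists n, has_size K (skel k (@system_functor (Nop_R R) _
    (nerve_faces dist) (fun a b => nerve_map dist le (val a.2) (val b.2))
    cA fA f_id f_comp)) n /\ (n <= num_scales * k.+2 * D ^ k.+1)%N.
  have [n [nG nle]] : exists n, has_size K (skel k (nerve_SR dist ole)) n /\
    (n <= num_scales * k.+2 * D ^ k.+1)%N by exact: H.
  exists n; split=> //; apply: leq_trans nle _.
  by rewrite !leq_mul2r num_scales_le !orbT.
apply: (@staged_size R K _ _ _ cA fA f_id f_comp num_scales stage_faces stage_max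
  (fun S => #|meet S|) (fun i => lexmin dist le (val (scale i.+1))) scale stage).
- exact: stage_le.
- exact: stage_scale.
- exact: stage_at.
- exact: nerve_facesE.
- by apply/setP => S; rewrite !inE subset0; case: (S == finset.set0).
- case=> [|i] S im; rewrite !inE; first by rewrite subset0; case: (S == finset.set0).
  move=> /and3P[S0 Sm S1].
  have rr : {subset rips dist (val (scale i.+1)) <= rips dist (val (scale i.+2))}.
    by apply/fintype.subsetP/rips_mono/scale_mono.
  have lm s : s \in S ->
      lexmin dist le (val (scale i.+2)) s \in maxs (val (scale i.+2)) /\
      s \subset lexmin dist le (val (scale i.+2)) s.
    move=> sS; have := fintype.subsetP Sm s sS; rewrite inE => /andP[/rr sr _].
    by have [] := lexminP ole sr.
  have sub : meet S \subset meet (lexmin dist le (val (scale i.+2)) @: S).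
    apply/bigcapsP => _ /imsetP[s sS ->]; apply: fintype.subset_trans (proj2 (lm s sS)).
    exact: bigcap_inf.
  split; last exact: subset_leq_card.
  rewrite imset_eq0 S0 (leq_trans S1 (subset_leq_card sub)) andbT /=.
  by apply/fintype.subsetP => _ /imsetP[s sS ->]; case: (lm s sS).
- by move=> i S; rewrite inE => /and3P[].
- by move=> i S; rewrite inE => /and3P[].
- by move=> p q v [_ pq] spq _; exact: nerve_map_same.
- by move=> p q v [_ pq] spq _; exact: nerve_map_step.
- by case=> [|i] /=; [rewrite cards0|apply: maxD; exact: critical_ge0].
Qed.
End NerveSize.

(** * Counting maximal simplices *)

Section CountMaximal.
Variables (R : realType) (T J : finType) (dist : T -> T -> R) (phi : J -> T -> R).
Hypothesis distE : forall x y (c : R), 0 <= c ->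
  (dist x y <= c) <-> (forall i, `|phi i x - phi i y| <= c).

(** A maximal simplex is a box cut out by the functionals, hence determined by
   the points where they reach their minima on it. *)
Lemma card_max_simplices r : 0 <= r -> (#|max_simplices dist r| <= #|T| ^ #|J|)%N.
Proof.
move=> r0; have r20 : 0 <= 2 * r by rewrite mulr_ge0.
pose box (m : {ffun J -> T}) :=
  [set x | [forall i, phi i (m i) <= phi i x <= phi i (m i) + 2 * r]].
suff sub : max_simplices dist r \subset box @: [set: {ffun J -> T}].
  apply: leq_trans (subset_leq_card sub) _; apply: leq_trans (leq_imset_card _ _) _.
  by rewrite cardsT card_ffun.
apply/fintype.subsetP => s; rewrite inE => /andP[/ripsP[/set0Pn[x0 x0s] sr] smax].
have ex i : exists m, (m \in s) && [forall x in s, phi i m <= phi i x].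
  have [m ms mmin] := @arg_minP _ _ _ x0 (mem s) (phi i) x0s.
  by exists m; rewrite [m \in s]ms; apply/forall_inP => x xs; exact: mmin.
pose m := [ffun i => xchoose (ex i)].
have mP i : m i \in s /\ forall x, x \in s -> phi i (m i) <= phi i x.
  by rewrite /m ffunE; have /andP[? /forall_inP] := xchooseP (ex i).
have sbox : s \subset box m.
  apply/fintype.subsetP => x xs; rewrite inE; apply/forallP => i.
  have [ms mmin] := mP i; rewrite mmin //= -lerBlDl.
  by apply: le_trans (ler_norm _) _; apply: ((distE x (m i) r20).1 (sr x (m i) xs ms) i).
apply/imsetP; exists m => //; apply/eqP; rewrite eqEproper sbox /=.
apply: contra smax => sb; apply/exists_inP; exists (box m) => //.
apply/ripsP; split; first by apply/set0Pn; exists x0; exact: (fintype.subsetP sbox).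
move=> x y; rewrite !inE => /forallP xb /forallP yb; apply/(distE _ _ r20) => i.
have /andP[x1 x2] := xb i; have /andP[y1 y2] := yb i; rewrite ler_norml; lra.
Qed.
End CountMaximal.

Section LpCount.
Variables (R : realType) (d : nat).
Implicit Types x y : 'rV[R]_d.

Lemma lp_dist_ge0 (p : \bar R) x y : 0 <= lp_dist p x y.
Proof.
case: p => [q||] /=; first exact: powR_ge0.
  by elim/big_rec: _ => // i z _ z0; rewrite le_max z0 orbT.
by elim/big_rec: _ => // i z _ z0; rewrite le_max z0 orbT.
Qed.

Lemma lp_dist_oo x y c : 0 <= c ->
  (lp_dist +oo%E x y <= c) <-> (forall i : 'I_d, `|x ord0 i - y ord0 i| <= c).
Proof.
move=> c0 /=; split=> [|xy]; last by apply: bigmax_le => // i _; exact: xy.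
by move=> + i; apply: le_trans; exact: le_bigmax.
Qed.

Lemma lp_dist_1 x y : lp_dist 1%:E x y = \sum_i `|x ord0 i - y ord0 i|.
Proof.
rewrite /= invr1 powRr1; last by apply: sumr_ge0 => i _; exact: powR_ge0.
by apply: eq_bigr => i _; rewrite powRr1.
Qed.
End LpCount.

Section SignFunctionals.
Variables (R : realType) (n : nat).
Implicit Types (z : 'I_n.+1 -> R) (s : {ffun 'I_n -> bool}).

Definition signed_sum s z : R := z ord0 + \sum_(i < n) (-1) ^+ s i * z (lift ord0 i).

(** The signs of the terms relative to the sign of the first one give a signed
   sum equal to the norm up to sign. Fixing the first sign halves the number of
   functionals. *)
Lemma sum_norm_le z c : (\sum_i `|z i| <= c) <-> (forall s, `|signed_sum s z| <= c).
Proof.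
split=> [zc s|zc].
  apply: le_trans zc; rewrite big_ord_recl /=; apply: le_trans (ler_normD _ _) _.
  rewrite lerD2l; apply: le_trans (ler_norm_sum _ _ _) _; apply: ler_sum => i _.
  by rewrite normrM normrX normrN1 expr1n mul1r.
pose b (u : R) : bool := u < 0.
have bE u : `|u| = (-1) ^+ b u * u.
  by rewrite /b; case: ltP => u0; rewrite ?mulN1r ?mul1r; [exact: ltr0_norm|exact: ger0_norm].
pose s := [ffun i : 'I_n => b (z ord0) (+) b (z (lift ord0 i))].
apply: le_trans (zc s); apply: le_trans (_ : (-1) ^+ b (z ord0) * signed_sum s z <= _).
  rewrite big_ord_recl /signed_sum mulrDr -bE lerD2l mulr_sumr ler_sum // => i _.
  by rewrite ffunE mulrA -signr_addb addKb -bE.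
by apply: le_trans (ler_norm _) _; rewrite normrM normrX normrN1 expr1n mul1r.
Qed.

Lemma signed_sumB s z z' :
  signed_sum s (fun i => z i - z' i) = signed_sum s z - signed_sum s z'.
Proof.
rewrite /signed_sum opprD addrACA; congr (_ + _).
by rewrite -sumrB; apply: eq_bigr => i _; rewrite mulrBr.
Qed.
End SignFunctionals.

Section NerveSizeLp.
Variables (R : realType) (K : fieldType).

Lemma nerve_size_functionals d (X : {fset 'rV[R]_d}) (le : rel X)
    (ole : total_order le) (dist : X -> X -> R) (J : finType) (phi : J -> X -> R) (k m : nat) :
  (forall x y, 0 <= dist x y) ->
  (forall x y (c : R), 0 <= c ->
    (dist x y <= c) <-> (forall i, `|phi i x - phi i y| <= c)) ->
  (#|J| <= m)%N ->
  exists n, has_size K (skel k (nerve_SR dist ole)) n /\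
    (n <= k.+2 * #|` X| ^ (m * k.+1 + 2))%N.
Proof.
move=> d0 dE Jm; have [n [sz nle]] := @nerve_size R X dist d0 le ole K k _
  (card_max_simplices dE).
exists n; split=> //; apply: leq_trans nle _.
rewrite -cardfE -mulnA mulnCA -expnM -expnD leq_mul2l /= addnC.
have [->|X0] := posnP #|` X|; first by rewrite !addn2 !exp0n.
by rewrite leq_pexp2l // leq_add2r leq_mul2r Jm orbT.
Qed.

Lemma lp_dist_dim1 (p : \bar R) (x y : 'rV[R]_1) : (1%:E <= p)%E ->
  lp_dist p x y = `|x ord0 ord0 - y ord0 ord0|.
Proof.
case: p => [q||] //= p1.
  rewrite big_ord1 -powRrM divff ?powRr1 //.
  by rewrite gt_eqF // (lt_le_trans ltr01).
by rewrite big_ord_recl big_ord0; apply/max_idPl.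
Qed.

Lemma nerve_size_lp d (p : \bar R) (X : {fset 'rV[R]_d}) (le : rel X)
    (ole : total_order le) (k : nat) : (0 < d)%N -> (1%:E <= p)%E ->
  [\/ d = 1%N, p = 1%:E | p = +oo%E] ->
  exists n, has_size K (skel k (nerve_SR_lp p ole)) n /\
    (n <= k.+2 * #|` X| ^ (alpha d p * k.+1 + 2))%N.
Proof.
move=> d0 p1 cases.
have dist0 (x y : X) : 0 <= lp_on p x y by exact: lp_dist_ge0.
have [d1|nd1] := eqVneq d 1%N.
  subst d; apply: (nerve_size_functionals ole (J := 'I_1)
    (phi := fun i (x : X) => val x ord0 i)) => // [x y c c0|].
    rewrite /lp_on lp_dist_dim1 //; split=> [xy i|]; last exact.
    by rewrite !(ord1 i).
  by rewrite card_ord /alpha eqxx orbT.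
have [poo|npoo] := eqVneq p +oo%E.
  rewrite poo; apply: (nerve_size_functionals ole (J := 'I_d)
    (phi := fun i (x : X) => val x ord0 i)) => // [x y|x y c c0|].
  - exact: lp_dist_ge0.
  - exact: lp_dist_oo.
  - by rewrite card_ord /alpha eqxx.
have {cases} p_1 : p = 1%:E.
  by case: cases => // e; [rewrite e eqxx in nd1|rewrite e eqxx in npoo].
subst p; case: d d0 X le ole nd1 {dist0} => // d' _ X le ole nd1.
apply: (nerve_size_functionals ole (J := {ffun 'I_d' -> bool})
  (phi := fun s (x : X) => signed_sum s (fun i => val x ord0 i))) => // [x y|x y c c0|].
- exact: lp_dist_ge0.
- rewrite /lp_on lp_dist_1 (sum_norm_le (fun i => val x ord0 i - val y ord0 i) c).
  by split=> h s; have := h s; rewrite signed_sumB.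
- rewrite card_ffun card_bool card_ord /alpha (negbTE npoo) (negbTE nd1) /= eqxx andbT.
  case: eqP => [[->] //|_].
  apply: leq_trans (leq_pmull _ (ltn0Sn d')); rewrite leq_exp2l //.
  by rewrite leq_subRL ?expn_gt0 // add1n -[X in (X <= _)%N]expn1 leq_pexp2l.
Qed.
End NerveSizeLp.

(** * Polyhedral approximation of norms *)

Section Norming.
Variables (R : realType) (n : nat).
Implicit Types (a u w z : 'rV[R]_n.+1) (F : 'rV[R]_n.+1 -> R).

Definition dot a z : R := \sum_i a ord0 i * z ord0 i.

Lemma dotB a z w : dot a (z - w) = dot a z - dot a w.
Proof. by rewrite /dot -sumrB; apply: eq_bigr => i _; rewrite !mxE mulrBr. Qed.

Lemma dotZ a t z : dot a (t *: z) = t * dot a z.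
Proof. by rewrite /dot mulr_sumr; apply: eq_bigr => i _; rewrite mxE mulrCA. Qed.

Lemma dot_delta a i : dot a (delta_mx ord0 i) = a ord0 i.
Proof.
rewrite /dot (bigD1 i) //= big1 => [|j ji]; rewrite mxE !eqxx ?mulr1 ?addr0 //.
by rewrite (negbTE ji) mulr0.
Qed.

(** What is used of a norm: a norming functional at every vector, and the
   normalization on the standard basis. *)
Definition norm_like F : Prop :=
  [/\ forall u, exists a, dot a u = F u /\ forall z, `|dot a z| <= F z,
      forall z i, `|z ord0 i| <= F z &
      forall i, F (delta_mx ord0 i) <= 1].

Section NormLike.
Variable F : 'rV[R]_n.+1 -> R.
Hypothesis FN : norm_like F.

Lemma norm_like_sum z : F z <= \sum_i `|z ord0 i|.
Proof.
have [dual _ unit] := FN; have [a [<- aF]] := dual z.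
apply: ler_sum => i _; apply: le_trans (ler_norm _) _; rewrite normrM.
rewrite ler_piMl //; apply: le_trans (unit i).
by rewrite -(dot_delta a i); exact: aF.
Qed.

Lemma norm_likeB w u : F w <= F u + F (w - u).
Proof.
have [dual _ _] := FN; have [a [<- aF]] := dual w.
have -> : dot a w = dot a u + dot a (w - u) by rewrite dotB addrC subrK.
by apply: lerD; apply: le_trans (ler_norm _) (aF _).
Qed.

Lemma norm_likeZ t z : F (t *: z) <= `|t| * F z.
Proof.
have [dual _ _] := FN; have [a [<- aF]] := dual (t *: z).
apply: le_trans (ler_norm _) _; rewrite dotZ normrM ler_wpM2l //.
Qed.

(** Here [dot a w] is at least [F u - eps / 3] and [F w] is at most
   [F u + eps / 3]; since [1 <= F u], the quotient is at most [1 + eps]. *)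
Lemma norming_near eps u a w : 0 < eps < 1 -> 1 <= F u -> dot a u = F u ->
  (forall z, `|dot a z| <= F z) -> F (w - u) <= eps / 3 ->
  F w <= (1 + eps) * `|dot a w|.
Proof.
move=> /andP[e0 e1] u1 au aF wu; have Fw := norm_likeB w u.
have aw : F u - eps / 3 <= dot a w.
  have -> : dot a w = dot a u + dot a (w - u) by rewrite dotB addrC subrK.
  have := le_trans (aF (w - u)) wu; rewrite ler_norml => /andP[+ _].
  by rewrite au; lra.
apply: le_trans (_ : (1 + eps) * dot a w <= _); last first.
  by rewrite ler_wpM2l ?ler_norm //; lra.
apply: le_trans (_ : (1 + eps) * (F u - eps / 3) <= _); last first.
  by rewrite ler_wpM2l //; lra.
have : 0 <= eps * (F u - 1) by rewrite mulr_ge0 // ?subr_ge0 // ltW.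
have : 0 <= eps * (1 - eps) by rewrite mulr_ge0 // ?subr_ge0 // ltW.
nra.
Qed.
End NormLike.

Section Grid.
Variable m : nat.
Hypothesis m_gt0 : (0 < m)%N.

(** Functionals are used up to sign, so one facet of the cube is kept out of each
   pair of opposite ones. *)
Definition grid_index : finType := ('I_n.+1 * {ffun 'I_n -> 'I_m.*2.+1})%type.

Definition grid_point (s : grid_index) : 'rV[R]_n.+1 :=
  \row_j if unlift s.1 j is Some i then ((s.2 i)%:R - m%:R) / m%:R else 1.

Lemma card_grid : #|grid_index| = (n.+1 * m.*2.+1 ^ n)%N.
Proof. by rewrite card_prod card_ffun !card_ord. Qed.

(** Scaling a nonzero vector so that its largest coordinate is 1 puts it on a
   facet of the unit cube, within [1 / m] of the grid in each coordinate. *)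
Lemma grid_near z : (exists i, z ord0 i != 0) ->
  exists s t, [/\ t != 0, (grid_point s) ord0 s.1 = 1 &
    \sum_i `|(t *: z - grid_point s) ord0 i| <= n%:R / m%:R].
Proof.
case=> i1 zi1; have mR : 0 < m%:R :> R by rewrite ltr0n.
have [i0 _ i0max] := @arg_maxP _ _ _ i1 xpredT (fun i => `|z ord0 i|) isT.
have zi0 : z ord0 i0 != 0.
  by rewrite -normr_gt0; apply: lt_le_trans (i0max i1 isT); rewrite normr_gt0.
pose w := (z ord0 i0)^-1 *: z.
have w1 i : `|w ord0 i| <= 1.
  rewrite mxE normrM normfV mulrC ler_pdivrMr ?normr_gt0 // mul1r; exact: i0max.
have ex i : exists g : 'I_m.*2.+1, `|w ord0 i * m%:R + m%:R - g%:R| <= 1.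
  pose t := w ord0 i * m%:R + m%:R.
  have /ler_normlP[wl wr] := w1 i.
  have t0 : 0 <= t by rewrite /t -{2}[m%:R]mul1r -mulrDl mulr_ge0 //; lra.
  have t2 : t <= m.*2%:R.
    rewrite /t -addnn natrD lerD2r -[leRHS]mul1r ler_wpM2r // ltW //.
  have gm : (Num.truncn t < m.*2.+1)%N.
    rewrite -(ltr_nat R); apply: le_lt_trans (_ : m.*2%:R < _); last by rewrite ltr_nat.
    by apply: le_trans t2; rewrite truncn_le.
  exists (Ordinal gm) => /=; have := truncnS_gt t; have := truncn_le t; rewrite t0 -/t.
  by rewrite -natr1 => tl tr; rewrite ler_norml; lra.
pose s : grid_index := (i0, [ffun i => projT1 (cid (ex (lift i0 i)))]).
have s0 : (grid_point s) ord0 i0 = 1 by rewrite mxE unlift_none.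
exists s, (z ord0 i0)^-1; split=> //; first by rewrite invr_eq0.
rewrite -/w (bigD1_ord i0) //=.
have -> : (w - grid_point s) ord0 i0 = 0 by rewrite !mxE unlift_none mulVf // subrr.
rewrite normr0 add0r.
have -> : n%:R / m%:R = \sum_(i < n) m%:R^-1 :> R.
  by rewrite sumr_const card_ord mulr_natl.
apply: ler_sum => i _; have [g gE gP] : exists2 g : 'I_m.*2.+1,
    grid_point s ord0 (lift i0 i) = (g%:R - m%:R) / m%:R &
    `|w ord0 (lift i0 i) * m%:R + m%:R - g%:R| <= 1.
  by rewrite mxE liftK /= ffunE; case: cid => g /= gP; exists g.
have -> : (w - grid_point s) ord0 (lift i0 i) =
    w ord0 (lift i0 i) - grid_point s ord0 (lift i0 i) by rewrite !mxE.
rewrite gE.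
have -> : w ord0 (lift i0 i) - (g%:R - m%:R) / m%:R =
    (w ord0 (lift i0 i) * m%:R + m%:R - g%:R) / m%:R.
  by field; rewrite gt_eqF.
by rewrite normrM normfV (gtr0_norm mR) ler_piMl // invr_ge0 ltW.
Qed.
End Grid.

(** The functionals norm the grid points; every vector has a multiple close to
   one of them. *)
Lemma polyhedral_approximation F eps m : norm_like F -> 0 < eps < 1 ->
  n%:R / m%:R <= eps / 3 -> (0 < m)%N ->
  exists a : grid_index m -> 'rV[R]_n.+1,
    forall z c, 0 <= c ->
      (F z <= c -> forall s, `|dot (a s) z| <= c) /\
      ((forall s, `|dot (a s) z| <= c) -> F z <= (1 + eps) * c).
Proof.
move=> FN e01 nm m0; have [dual lo unit] := FN; have /andP[e0 e1] := e01.
have [a aP] := choice (fun s : grid_index m => dual (grid_point s)).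
exists a => z c c0; split=> [zc s|ac].
  by apply: le_trans zc; have [_] := aP s; exact.
have [/existsP zn0|/existsPn z0] := boolP [exists i, z ord0 i != 0]; last first.
  apply: le_trans (norm_like_sum FN z) _; rewrite big1 => [|i _].
    by rewrite mulr_ge0 // addr_ge0 // ltW.
  by have := z0 i; rewrite negbK => /eqP ->; rewrite normr0.
have [s [t [t0 s1 near]]] := grid_near m0 zn0.
have [as_ aF] := aP s; have u1 : 1 <= F (grid_point s).
  by apply: le_trans (lo _ s.1); rewrite s1 normr1.
have Fw : F (t *: z) <= (1 + eps) * `|dot (a s) (t *: z)|.
  apply: (norming_near FN e01 u1 as_ aF).
  by apply: le_trans (norm_like_sum FN _) _; apply: le_trans near nm.
have zE : z = t^-1 *: (t *: z) by rewrite scalerA mulVf // scale1r.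
rewrite {1}zE; apply: le_trans (norm_likeZ FN _ _) _.
apply: le_trans (ler_wpM2l (normr_ge0 _) Fw) _.
rewrite mulrCA dotZ normrM [X in _ * X <= _]mulrA -normrM mulVf // normr1 mul1r.
by rewrite ler_wpM2l // addr_ge0 // ltW.
Qed.
End Norming.

Section LpNorm.
Variables (R : realType) (n : nat).
Implicit Types (z u : 'rV[R]_n.+1).

Definition lp_norm (p : \bar R) z : R := lp_dist p z 0.

Lemma lp_distE p (x y : 'rV[R]_n.+1) : lp_dist p x y = lp_norm p (x - y).
Proof.
rewrite /lp_norm /lp_dist; case: p => [q||]; [congr (_ `^ _)| |].
all: by apply: eq_bigr => i _; rewrite !mxE subr0.
Qed.

Lemma lp_norm_oo z : lp_norm +oo%E z = \big[Num.max/0]_i `|z ord0 i|.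
Proof. by rewrite /lp_norm /=; apply: eq_bigr => i _; rewrite mxE subr0. Qed.

Lemma lp_norm_fin q z : lp_norm q%:E z = (\sum_i `|z ord0 i| `^ q) `^ q^-1.
Proof.
by rewrite /lp_norm /=; congr (_ `^ _); apply: eq_bigr => i _; rewrite mxE subr0.
Qed.

Lemma normr_sgM (t : R) : Num.sg t * t = `|t|.
Proof. by rewrite -normrEsg. Qed.

Lemma normr_sg_le1 (t : R) : `|Num.sg t| <= 1.
Proof. by rewrite normr_sg; case: (_ != 0). Qed.

Lemma linf_norm_like : norm_like (lp_norm +oo%E : 'rV[R]_n.+1 -> R).
Proof.
split=> [u|z i|i]; rewrite ?lp_norm_oo; last 2 first.
- exact: (@le_bigmax _ _ _ 0 (fun i => `|z ord0 i|)).
- apply: bigmax_le => // j _; rewrite mxE eqxx /=.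
  by case: (_ == _); rewrite ?normr1 ?normr0.
have [i0 _ i0max] := @arg_maxP _ _ _ ord0 xpredT (fun i => `|u ord0 i|) isT.
exists (Num.sg (u ord0 i0) *: delta_mx ord0 i0).
have dE z : dot (Num.sg (u ord0 i0) *: delta_mx ord0 i0) z = Num.sg (u ord0 i0) * z ord0 i0.
  rewrite /dot (bigD1 i0) //= big1 => [|j ji]; rewrite !mxE !eqxx ?mulr1 ?addr0 //.
  by rewrite (negbTE ji) mulr0 mul0r.
split=> [|z].
  rewrite dE normr_sgM; apply/eqP; rewrite eq_le (@le_bigmax _ _ _ 0 (fun i => `|u ord0 i|)).
  by apply: bigmax_le => // i _; exact: i0max.
rewrite dE normrM lp_norm_oo.
apply: le_trans (@le_bigmax _ _ _ 0 (fun i => `|z ord0 i|) i0).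
by rewrite ler_piMl // normr_sg_le1.
Qed.

Lemma l1_norm z : lp_norm 1%:E z = \sum_i `|z ord0 i|.
Proof.
by rewrite /lp_norm lp_dist_1; apply: eq_bigr => i _; rewrite mxE subr0.
Qed.

Lemma l1_norm_like : norm_like (lp_norm 1%:E : 'rV[R]_n.+1 -> R).
Proof.
split=> [u|z i|i]; rewrite ?l1_norm; last 2 first.
- by rewrite (bigD1 i) //= lerDl sumr_ge0.
- rewrite (bigD1 i) //= big1 => [|j ji]; rewrite !mxE !eqxx ?normr1 ?addr0 //.
  by rewrite (negbTE ji) normr0.
exists (\row_i Num.sg (u ord0 i)); split=> [|z].
  by apply: eq_bigr => i _; rewrite mxE normr_sgM.
rewrite l1_norm; apply: le_trans (ler_norm_sum _ _ _) _; apply: ler_sum => i _.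
by rewrite mxE normrM ler_piMl // normr_sg_le1.
Qed.

Section Finite.
Variable q : R.
Hypothesis q1 : 1 < q.

Lemma q_gt0 : 0 < q. Proof. exact: lt_trans ltr01 q1. Qed.

Lemma lp_norm_pow z : lp_norm q%:E z `^ q = \sum_i `|z ord0 i| `^ q.
Proof.
rewrite lp_norm_fin -powRrM mulVf ?gt_eqF ?q_gt0 // powRr1 //.
by apply: sumr_ge0 => i _; exact: powR_ge0.
Qed.

Lemma lp_norm_ge z i : `|z ord0 i| <= lp_norm q%:E z.
Proof.
have q0 := q_gt0; rewrite lp_norm_fin.
have -> : `|z ord0 i| = (`|z ord0 i| `^ q) `^ q^-1.
  by rewrite -powRrM divff ?gt_eqF // powRr1.
apply: ge0_ler_powR; rewrite ?nnegrE ?invr_ge0 ?powR_ge0 ?(ltW q0) //.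
  by apply: sumr_ge0 => j _; exact: powR_ge0.
by rewrite (bigD1 i) //= lerDl sumr_ge0 // => j _; exact: powR_ge0.
Qed.

(** This case of the inequality of Hoelder is the sum of inequalities of Young
   for the conjugate exponents [q / (q - 1)] and [q]. *)
Lemma hoelder_unit (v w : 'I_n.+1 -> R) :
  \sum_i `|v i| `^ q = 1 -> \sum_i `|w i| `^ q = 1 ->
  \sum_i `|v i| `^ (q - 1) * `|w i| <= 1.
Proof.
move=> v1 w1; have q0 := q_gt0; have q10 : 0 < q - 1 by rewrite subr_gt0.
pose q' := q / (q - 1); have q'0 : 0 < q' by rewrite divr_gt0.
have qq : q'^-1 + q^-1 = 1 by rewrite /q'; field; rewrite !gt_eqF.
apply: le_trans (_ : \sum_i (`|v i| `^ q / q' + `|w i| `^ q / q) <= _).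
  apply: ler_sum => i _.
  have -> : `|v i| `^ q = (`|v i| `^ (q - 1)) `^ q'.
    by rewrite -powRrM; congr (_ `^ _); rewrite /q'; field; rewrite gt_eqF.
  by apply: conjugate_powR; rewrite ?powR_ge0.
by rewrite big_split /= -!mulr_suml v1 w1 !mul1r qq.
Qed.

Lemma lp_norm_eq0 z : lp_norm q%:E z = 0 -> forall i, z ord0 i = 0.
Proof.
by move=> z0 i; apply/eqP; rewrite -normr_le0 -z0; exact: lp_norm_ge.
Qed.

Lemma lp_norm_unit z : 0 < lp_norm q%:E z ->
  \sum_i `|z ord0 i / lp_norm q%:E z| `^ q = 1.
Proof.
move=> z0; under eq_bigr do rewrite normrM normfV (gtr0_norm z0) powRM // ?invr_ge0 ?(ltW z0) //.
by rewrite -mulr_suml -lp_norm_pow -powRM ?invr_ge0 ?(ltW z0) // divff ?gt_eqF // powR1.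
Qed.

(** For a nonzero [u], the functional is the derivative of the norm at [u]. *)
Lemma lp_norm_like : norm_like (lp_norm q%:E : 'rV[R]_n.+1 -> R).
Proof.
have q0 := q_gt0; split=> [u|z i|i]; last 2 first.
- exact: lp_norm_ge.
- rewrite lp_norm_fin (bigD1 i) //= big1 => [|j ji]; rewrite !mxE !eqxx.
    by rewrite normr1 addr0 !powR1.
  by rewrite (negbTE ji) normr0 powR0 ?gt_eqF.
have N0 z : 0 <= lp_norm q%:E z by rewrite lp_norm_fin powR_ge0.
have [u0|un0] := eqVneq (lp_norm q%:E u) 0.
  exists 0; have d0 z : dot 0 z = 0 by apply: big1 => i _; rewrite mxE mul0r.
  by split=> [|z]; rewrite d0 ?u0 // normr0.
have up : 0 < lp_norm q%:E u by rewrite lt0r un0 N0.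
pose v i := u ord0 i / lp_norm q%:E u.
have v1 : \sum_i `|v i| `^ q = 1 by exact: lp_norm_unit.
exists (\row_i (Num.sg (v i) * `|v i| `^ (q - 1))); split=> [|z].
  have uE i : u ord0 i = v i * lp_norm q%:E u by rewrite /v divfK.
  transitivity (\sum_i `|v i| `^ q * lp_norm q%:E u); last by rewrite -mulr_suml v1 mul1r.
  apply: eq_bigr => i _; rewrite mxE uE mulrA; congr (_ * _).
  have q1E : 1 + (q - 1) = q by rewrite addrC subrK.
  rewrite mulrAC normr_sgM -[X in X * _]powRr1 // -powRD ?q1E //.
  by rewrite gt_eqF.
have [z0|zn0] := eqVneq (lp_norm q%:E z) 0.
  rewrite z0 normr_le0 /dot big1 // => i _.
  by rewrite (lp_norm_eq0 z0) mulr0.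
have zp : 0 < lp_norm q%:E z by rewrite lt0r zn0 N0.
have h := hoelder_unit v1 (lp_norm_unit zp).
move: (lp_norm q%:E z) zp h => N zp h.
apply: le_trans (_ : \sum_i `|v i| `^ (q - 1) * `|z ord0 i| <= _).
  apply: le_trans (ler_norm_sum _ _ _) _; apply: ler_sum => i _; rewrite mxE.
  rewrite 2!normrM (ger0_norm (powR_ge0 _ _)) -mulrA.
  by rewrite ler_piMl ?normr_sg_le1 // mulr_ge0 // powR_ge0.
rewrite -[leRHS]mul1r -ler_pdivrMr // mulr_suml; apply: le_trans h; apply: ler_sum => i _.
by rewrite (normrM (z ord0 i)) normfV (gtr0_norm zp) mulrA.
Qed.
End Finite.

Lemma lp_norm_like_ge1 (p : \bar R) : (1%:E <= p)%E ->
  norm_like (lp_norm p : 'rV[R]_n.+1 -> R).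
Proof.
case: p => [q||] //; last by move=> _; exact: linf_norm_like.
rewrite lee_fin le_eqVlt => /orP[/eqP <-|]; first exact: l1_norm_like.
exact: lp_norm_like.
Qed.
End LpNorm.

(** * Interleavings and the main theorem *)

Section FunctorExt.
Variables (C D : category) (o : C -> D).
Variables m m' : forall x y : C, mor x y -> mor (o x) (o y).

Lemma functor_ext i c i' c' : (forall x y h, m (x := x) (y := y) h = m' h) ->
  @Functor C D o m i c = @Functor C D o m' i' c'.
Proof.
move=> mm; have E : m = m'.
  apply: functional_extensionality_dep => x; apply: functional_extensionality_dep => y.
  exact/funext/mm.
by subst m'; congr Functor; exact: Prop_irrelevance.
Qed.
End FunctorExt.

Section Interleave.
Variables (R : realType) (T : finType) (eps : R) (eps_ge0 : 0 <= eps).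
Variables (dist dist' : T -> T -> R).
Hypothesis dist'_le : forall x y c, 0 <= c -> dist x y <= c -> dist' x y <= c.
Hypothesis dist_le : forall x y c, 0 <= c -> dist' x y <= c -> dist x y <= (1 + eps) * c.

Definition inter_dist (b : bool) := if b then dist' else dist.

Definition inter_faces (a : interleaving_cat eps_ge0) : {set {set {set T}}} :=
  SR_faces (inter_dist a.2) a.1.

Lemma inter_complex a : complex_in (inter_faces a).
Proof. exact: subdiv_complex. Qed.

(** The factor [1 + eps] absorbs the change of distance in either direction. *)
Lemma rips_shift b b' (r r' : R) : 0 <= r -> r * (1 + eps) <= r' ->
  rips (inter_dist b) r \subset rips (inter_dist b') r'.
Proof.
move=> r0 rr; have r20 : 0 <= 2 * r by rewrite mulr_ge0.
have re : r <= r * (1 + eps) by rewrite mulrDr mulr1 lerDl mulr_ge0.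
apply/fintype.subsetP => s /ripsP[s0 sr]; apply/ripsP; split=> // x y xs ys.
have xy := sr x y xs ys; apply: le_trans (_ : (1 + eps) * (2 * r) <= _); last first.
  by rewrite mulrCA ler_wpM2l // mulrC.
have le1 : 2 * r <= (1 + eps) * (2 * r) by rewrite ler_peMl // lerDl.
case: b b' xy {sr} => [] [] /= xy; last exact: le_trans le1.
- exact: le_trans le1.
- exact: dist_le.
- by apply: le_trans le1; exact: dist'_le.
Qed.

Lemma inter_mono (a b : interleaving_cat eps_ge0) S : tle a b ->
  S \in inter_faces a -> [set s | s in S] \in inter_faces b.
Proof.
case: a b => [[k r] i] [[k' r'] j] ab; rewrite imset_id.
case: ab => [[/= kk rr]|[/= -> [/= kk rr]]].
  by apply/fintype.subsetP/subdiv_mono => //; apply: rips_shift => //; exact: (valP r).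
by apply/fintype.subsetP/subdiv_mono => //; exact: rips_mono.
Qed.

Definition inter_fun : functor (interleaving_cat eps_ge0) Simp :=
  @system_functor _ _ inter_faces (fun _ _ s => s) inter_complex inter_mono
    (fun _ _ _ => erefl) (fun _ _ _ _ _ _ _ => erefl).

Lemma inter_restrict b :
  compF (compF (realization_fun R) inter_fun) (inter_incl eps_ge0 b) =
  realize (SR (inter_dist b)).
Proof.
suff H cA fA f_id f_comp :
    compF (compF (realization_fun R) inter_fun) (inter_incl eps_ge0 b) =
    realize (@system_functor (Nop_R R) _ (SR_faces (inter_dist b)) (fun _ _ s => s)
      cA fA f_id f_comp) by exact: H.
have E : cA = fun p => inter_complex (p, b) by exact: Prop_irrelevance.
subst cA; apply: functor_ext => x y h.
apply: (congr1 (fmor (realization_fun R))).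
by apply: simp_map_ext => v; apply: val_inj.
Qed.

(** Both filtrations consist of subdivisions of complexes on the same vertices,
   so all the maps of the interleaving are inclusions. *)
Lemma SR_interleaved :
  interleaved eps_ge0 (realize (SR dist)) (realize (SR dist')).
Proof.
exists (compF (realization_fun R) inter_fun).
by split; [exact: (inter_restrict false)|exact: (inter_restrict true)].
Qed.

Lemma nerve_approximation (le : rel T) (ole : total_order le) :
  approximation eps_ge0 (realize (nerve_SR dist' ole)) (realize (SR dist)).
Proof.
exists (realize (SR dist)), (realize (SR dist')); split.
- exact: SR_interleaved.
- exact: rst_refl.
- exact: nerve_model.
Qed.
End Interleave.

Section Part2.
Variables (R : realType) (K : fieldType) (n : nat).

Lemma rank_total_order (T : finType) :
  total_order (fun x y : T => (enum_rank x <= enum_rank y)%N).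
Proof.
split=> [x|x y /anti_leq/val_inj/enum_rank_inj //|y x z|x y].
- exact: leqnn.
- exact: leq_trans.
- exact: leq_total.
Qed.

Definition grid_const : R := n.+1%:R * (6 * n.+1 + 3)%:R ^+ n.
Definition grid_size (eps : R) : nat := (Num.truncn (3 * n%:R / eps)).+1.

Lemma grid_size_fine eps : 0 < eps -> n%:R / (grid_size eps)%:R <= eps / 3.
Proof.
move=> e0; have : 3 * n%:R / eps < (grid_size eps)%:R by exact: truncnS_gt.
by rewrite ltr_pdivrMr // ler_pdivrMr ?ltr0n // => h; lra.
Qed.

(** The exponent [n] of [1 / eps] in the size of the grid is at most half of
   [(n + 1)^2 - 1], which is [n (n + 2)]. *)
Lemma card_grid_le eps : 0 < eps -> eps < 1 ->
  (#|grid_index n (grid_size eps)|)%:R <= beta n.+1 grid_const eps.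
Proof.
move=> e0 e1; rewrite card_grid /beta /grid_const natrM -mulrA ler_wpM2l //.
set m := grid_size eps.
have m2 : m.*2.+1%:R <= (6 * n.+1 + 3)%:R / eps :> R.
  have tr : m%:R <= 3 * n%:R / eps + 1.
    by rewrite /m /grid_size -natr1 lerD2r truncn_le divr_ge0 ?mulr_ge0 // ltW.
  rewrite -addn1 -addnn !natrD natrM -[n.+1%:R]natr1 ler_pdivlMr //.
  have me : m%:R * eps <= 3 * n%:R + eps.
    by move: tr; rewrite -lerBlDr ler_pdivlMr // => tr; lra.
  nra.
rewrite natrX; apply: le_trans (lerXn2r n _ _ m2) _; rewrite ?nnegrE //.
  by rewrite divr_ge0 // ltW.
rewrite exprMn ler_wpM2l ?exprn_ge0 // exprVn -powR_invn ?(ltW e0) //.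
apply: ger_powR; first by rewrite e0 ltW.
rewrite lerN2 ler_pdivlMr // -natrM ler_nat.
rewrite -[n.+1]addn1 sqrnD; lia.
Qed.

Theorem nerve_approximation_lp eps (eps0 : 0 < eps) (p : \bar R)
    (X : {fset 'rV[R]_n.+1}) : eps < 1 -> (1%:E <= p)%E ->
  exists G : functor (Nop_R R) Simp,
    approximation (ltW eps0) (realize G) (realize (SR_lp p X)) /\
    forall k : nat, exists s : nat, has_size K (skel k G) s /\
      s%:R <= k.+2%:R * #|` X|%:R `^ (beta n.+1 grid_const eps * k.+1%:R + 2).
Proof.
move=> eps1 p1; set m := grid_size eps.
have e01 : 0 < eps < 1 by rewrite eps0.
have [a aP] := polyhedral_approximation (m := m) (lp_norm_like_ge1 n p1) e01
  (grid_size_fine eps0) (ltn0Sn _).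
pose dist' (x y : X) : R := \big[Num.max/0]_s `|dot (a s) (val x) - dot (a s) (val y)|.
have dist'P x y c : 0 <= c ->
    (dist' x y <= c) <-> (forall s, `|dot (a s) (val x) - dot (a s) (val y)| <= c).
  move=> c0; split=> [xy s|xy]; last by apply: bigmax_le.
  by apply: le_trans xy; exact: (@le_bigmax _ _ _ 0
    (fun s => `|dot (a s) (val x) - dot (a s) (val y)|)).
have ole := rank_total_order X.
exists (nerve_SR dist' ole); split.
  apply: nerve_approximation => x y c c0 xy.
    apply/(dist'P _ _ _ c0) => s; rewrite -dotB; move: s.
    by apply: (proj1 (aP _ _ c0)); rewrite -lp_distE.
  rewrite /lp_on lp_distE; apply: (proj2 (aP _ _ c0)) => s; rewrite dotB.
  by move: s; apply/(dist'P _ _ _ c0).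
move=> k.
have dist'0 x y : 0 <= dist' x y by exact: bigmax_ge_id.
have [s [sz sle]] := nerve_size_functionals K ole k dist'0 dist'P (leqnn _).
exists s; split=> //; apply: le_trans (_ : (k.+2 * #|` X| ^ _)%:R <= _).
  by rewrite ler_nat; exact: sle.
rewrite natrM ler_wpM2l // natrX.
have [->|X0] := posnP #|` X|; first by rewrite addn2 expr0n /= powR_ge0.
rewrite -powR_mulrn //; apply: ler_powR; first by rewrite ler1n.
rewrite natrD natrM lerD2r ler_wpM2r //; exact: card_grid_le.
Qed.
End Part2.

Theorem corollary1p8 (R : realType) (K : fieldType) (d : nat) (hd : (0 < d)%N) :
  ((forall (p : \bar R), (1%:E <= p)%E ->
      [\/ d = 1%N, p = 1%:E | p = +oo%E] ->
      forall (X : {fset 'rV[R]_d}) (le : rel X) (ole : total_order le),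
        simplicial_model (nerve_SR_lp p ole) (realize (SR_lp p X))) /\
   (forall k : nat, exists C : R,
      forall (p : \bar R), (1%:E <= p)%E ->
      [\/ d = 1%N, p = 1%:E | p = +oo%E] ->
      forall (X : {fset 'rV[R]_d}) (le : rel X) (ole : total_order le),
        exists n : nat,
          has_size K (skel k (nerve_SR_lp p ole)) n /\
          n%:R <= C * #|` X|%:R ^+ (alpha d p * k.+1 + 2))) /\
  (exists c : R, 0 < c /\
     forall (eps : R) (eps0 : 0 < eps), eps < 1 ->
     exists C : nat -> R,
       forall (p : \bar R), (1%:E <= p)%E ->
       forall X : {fset 'rV[R]_d},
       exists G : functor (Nop_R R) Simp,
         approximation (ltW eps0) (realize G) (realize (SR_lp p X)) /\
         forall k : nat, exists n : nat,
           has_size K (skel k G) n /\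
           n%:R <= C k * #|` X|%:R `^ (beta d c eps * k.+1%:R + 2)).
Proof.
split; [split|].
- by move=> p _ _ X le ole; exact: nerve_model.
- move=> k; exists k.+2%:R => p p1 cases X le ole.
  have [n [sz nle]] := nerve_size_lp K ole k hd p1 cases.
  by exists n; split=> //; rewrite -natrX -natrM ler_nat.
- case: d hd => // n _; exists (grid_const R n); split.
    by rewrite /grid_const mulr_gt0 ?exprn_gt0 ?ltr0n // addn_gt0 orbT.
  move=> eps eps0 eps1; exists (fun k => k.+2%:R) => p p1 X.
  exact: nerve_approximation_lp.
Qed.
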